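(* Let $a\in\mathbb{C}$ and $y_3=1/(2a_r)$. For large $T$, $$2\pi\sum_{\substack{y_3+\delta<\beta_a\\ 0<\gamma_a<T}}1=O\left(\frac{T\log\log T}{\delta}\right)$$ uniformly for $\delta>0$ (that is, the implied constant depends on neither $\delta$ nor $T$). In particular, $$2\pi\sum_{\substack{y_3+\frac{(\log\log T)^2}{\log T}<\beta_a\\ 0<\gamma_a<T}}1=O\left(\frac{T\log T}{\log\log T}\right).$$
   Context: Fix an integer $r\ge 2$ and real numbers $a_1\ge a_2\ge\cdots\ge a_r>0$. The Euler-Zagier multiple zeta function is $\zeta(s_1,\dots,s_r)=\sum_{1\le n_1<\cdots<n_r} n_1^{-s_1}\cdots n_r^{-s_r}$, which converges absolutely when $\Re(s_l+\cdots+s_r)>r-l+1$ for all $1\le l\le r$ and is continued meromorphically to $\mathbb{C}^r$. With $\mathfrak{S}_r$ the symmetric group of degree $r$, define the meromorphic function on $\mathbb{C}$ $$\widetilde\zeta(s):=\sum_{\tau\in\mathfrak{S}_r}\zeta(a_{\tau(1)}s,\dots,a_{\tau(r)}s).$$ Equivalently (Hoffman's identity), $\widetilde\zeta(s)=\sum_{l=1}^r\sum_{P_1,\dots,P_l}(-1)^{r-l}\prod_{j=1}^l(\#(P_j)-1)!\,\zeta\bigl(\sum_{j'\in P_j}a_{j'}s\bigr)$, where $\{P_1,\dots,P_l\}$ runs over all partitions of the set $\{1,\dots,r\}$ into $l$ nonempty blocks and $\zeta$ on the right is the Riemann zeta function. An $a$-point of $\widetilde\zeta$ is a solution of $\widetilde\zeta(s)=a$;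 write $\rho_a=\beta_a+i\gamma_a$ ($\beta_a,\gamma_a\in\mathbb{R}$) for an $a$-point. Sums over $\beta_a,\gamma_a$ run over all $a$-points satisfying the indicated conditions, counted with multiplicity. *)

(* Defs.v *)
From HB Require Import structures.
From mathcomp Require Import all_boot all_order all_algebra perm.
From mathcomp Require Import complex.
From mathcomp Require Import all_classical all_reals all_analysis.

Set Implicit Arguments.
Unset Strict Implicit.
Unset Printing Implicit Defensive.

Import Order.TTheory GRing.Theory Num.Theory.
Import numFieldNormedType.Exports.

Local Open Scope classical_set_scope.
Local Open Scope ring_scope.

Definition holomorphic_at (R : realType) (V : normedModType (complex R))
    (f : V -> (complex R)^o) (p : V) : Prop :=
  \forall z \near p, differentiable f z.

Definition cexp (R : realType) (z : complex R) : complex R :=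
  Complex (expR (complex.Re z) * cos (complex.Im z))
          (expR (complex.Re z) * sin (complex.Im z)).

(* n ^ (- s), meant for n >= 1 (ln 0 is a junk value). *)
Definition npowN (R : realType) (n : nat) (s : complex R) : complex R :=
  cexp (- s * (ln n%:R)%:C%C).

(* The partial sum of the Euler-Zagier series over 1 <= n_1 < ... < n_r <= N;
   indices are shifted, so that s_(i+1) is s 0 i for i : 'I_r. *)
Definition mzeta_partial (R : realType) (r : nat) (s : 'rV[complex R]_r)
    (N : nat) : complex R :=
  \sum_(n : {ffun 'I_r -> 'I_N.+1} |
          [forall i, 0 < n i]%N &&
          [forall i : 'I_r, forall j : 'I_r, (i < j)%N ==> (n i < n j)%N])
    \prod_(i < r) npowN (n i) (s 0 i).

(* s_(l+1) + ... + s_r *)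
Definition tail_sum (R : realType) (r : nat) (s : 'rV[complex R]_r)
    (l : 'I_r) : complex R :=
  \sum_(i < r | (l <= i)%N) s 0 i.

(* Re (s_l + ... + s_r) > r - l + 1 for 1 <= l <= r. *)
Definition mzeta_domain (R : realType) (r : nat) : set 'rV[complex R]_r :=
  [set s | forall l : 'I_r, (r - l)%:R < complex.Re (tail_sum s l)].

(* The hyperplanes s_l + ... + s_r = k, with 1 <= l <= r and k <= r - l + 1
   an integer, which contain all the singularities of the continuation. *)
Definition mzeta_polar (R : realType) (r : nat) : set 'rV[complex R]_r :=
  [set s | exists (l : 'I_r) (k : int),
     k <= (r - l)%:Z /\ tail_sum s l = k%:~R].

(* F is the meromorphic continuation to C^r of the Euler-Zagier series: it
   extends the (absolutely convergent) series, it is locally a quotient of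
   holomorphic functions, and it is holomorphic off mzeta_polar. As the
   complement of mzeta_polar is connected, F is unique there; its values on
   mzeta_polar are unconstrained. *)
Record is_mzeta (R : realType) (r : nat) (F : 'rV[complex R]_r -> complex R) :
    Prop := IsMzeta {
  mzeta_series : forall s, mzeta_domain s ->
    mzeta_partial s N @[N --> \oo] --> (F s : (complex R)^o);
  mzeta_holomorphic : forall p, ~ mzeta_polar p -> holomorphic_at F p;
  mzeta_meromorphic : forall p,
    exists g h : 'rV[complex R]_r -> (complex R)^o,
      [/\ holomorphic_at g p, holomorphic_at h p,
          ~ (\forall z \near p, h z = 0) &
          \forall z \near p, ~ mzeta_polar z -> h z * F z = g z] }.

(* s |-> \sum_tau zeta (a_(tau 1) s, ..., a_(tau r) s), where zeta is F; the
   sequence a is indexed from 1. For a_1, ..., a_r > 0, the arguments of F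
   avoid mzeta_polar unless s is real. *)
Definition sym_mzeta (R : realType) (r : nat) (a : nat -> R)
    (F : 'rV[complex R]_r -> complex R) (s : complex R) : complex R :=
  \sum_(tau : {perm 'I_r}) F (\row_(i < r) ((a (tau i).+1)%:C%C * s)).

(* The order of vanishing of f at z; it is +oo if there is none. *)
Definition zero_order (R : realType) (f : complex R -> complex R)
    (z : complex R) : \bar R :=
  ereal_inf [set (m%:R)%:E | m in [set m : nat |
    exists g : (complex R)^o -> (complex R)^o,
      [/\ holomorphic_at g (z : (complex R)^o), g z != 0 &
          \forall w \near (z : (complex R)^o), f w = (w - z) ^+ m * g w]]].

(* The number of w-points beta + i gamma of f such that b < beta and
   0 < gamma < T, counted with multiplicity. *)
Definition count_points (R : realType) (f : complex R -> complex R)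
    (w : complex R) (b T : R) : \bar R :=
  \esum_(z in [set z : complex R | [/\ f z = w, b < complex.Re z,
                                      0 < complex.Im z & complex.Im z < T]])
    zero_order (fun s => f s - w) z.

(* Main.v *)
Require Import Defs.
From HB Require Import structures.
From mathcomp Require Import all_boot all_order all_algebra perm.
From mathcomp Require Import complex ring lra zify.
From mathcomp Require finmap.
From mathcomp Require Import all_classical all_reals all_analysis.

Set Implicit Arguments.
Unset Strict Implicit.
Unset Printing Implicit Defensive.

Import Order.TTheory GRing.Theory Num.Theory.
Import numFieldNormedType.Exports.

Local Open Scope classical_set_scope.
Local Open Scope ring_scope.

Local Notation Re := complex.Re.
Local Notation Im := complex.Im.

(* Let f be the symmetrised zeta function. By Hoffman's identity f is a polynomial in the
   zeta (b s), where b runs over the sums of blocks of the a_i, so multiplying f by finitely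
   many factors 1 - 2^(1 - b s) gives a function which is holomorphic on Re s > y3 and
   bounded by a product of factors 1 + |eta (b s)|, eta being the alternating zeta function;
   here Re (b s) > 1/2. The same multiple of f - w, normalised by an exponential so that it
   is bounded away from 0 and infinity as Re s grows, is a holomorphic function g whose
   zeros include the w-points of f. Jensen's formula for a half disc of radius between T
   and 2 T, whose diameter lies on a vertical line Re s = x0 slightly to the right of y3,
   counts a zero rho with weight (Re rho - x0) / T, up to constants, and bounds the total
   weight by the mean of ln |g| over the diameter, up to O(1). By concavity of ln that mean
   is at most the sum of the logarithms of the mean squares of the eta (b s), and these
   mean squares are O(ln T) since Re (b s) >= 1/2. So the total weight is O(ln (ln T)),
   whereas a zero with Re rho > y3 + delta has weight at least a constant times delta / T. *)

(** * Complex modulus and derivatives *)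

(** The continuation [F] is controlled only off its polar hyperplanes, so f agrees with the
    polynomial in the zeta (b s) for Im s > 0 and for Re s large, whereas the half disc must cross
    the real axis: zeros of small height would otherwise lie near its corner and carry almost no
    weight. Hence g is built from the polynomial and not from f, which makes it holomorphic on the
    whole half plane. Extra zeros coming from the factors 1 - 2^(1 - b s) can only increase an upper
    bound. With centre at height T / 2 and radius at least T, the zeros to be counted stay within
    3/4 of the radius, away from the arc. On the part of the arc with bounded real part only ln |g|
    = O(T) is known, but there the density of harmonic measure, proportional to the distance from
    the diameter, is O(1 / T); this is why the arc costs only O(1). Uniformity in delta comes from
    the mean square estimate, which holds up to Re (b s) = 1/2 without loss, so that x0 may approach
    y3 freely. Since ln |g| is singular at zeros, x0 and the radius are chosen generically, with no
    zero on the boundary. *)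

Section Modulus.
Variable R : realType.
Implicit Types (x y z : complex R) (a b : R).

Definition cabs z : R := Num.sqrt (Re z ^+ 2 + Im z ^+ 2).

Lemma cabsE z : cabs z = Normc.normc z.
Proof. by case: z. Qed.

Lemma ReD x y : Re (x + y) = Re x + Re y. Proof. by case: x; case: y. Qed.
Lemma ImD x y : Im (x + y) = Im x + Im y. Proof. by case: x; case: y. Qed.
Lemma ReN x : Re (- x) = - Re x. Proof. by case: x. Qed.
Lemma ImN x : Im (- x) = - Im x. Proof. by case: x. Qed.
Lemma ReB x y : Re (x - y) = Re x - Re y. Proof. by rewrite ReD ReN. Qed.
Lemma ImB x y : Im (x - y) = Im x - Im y. Proof. by rewrite ImD ImN. Qed.
Lemma ReM x y : Re (x * y) = Re x * Re y - Im x * Im y.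
Proof. by case: x; case: y. Qed.
Lemma ImM x y : Im (x * y) = Re x * Im y + Im x * Re y.
Proof. by case: x; case: y. Qed.
Lemma ReRM a x : Re (a%:C%C * x) = a * Re x.
Proof. by rewrite ReM /= mul0r subr0. Qed.
Lemma ImRM a x : Im (a%:C%C * x) = a * Im x.
Proof. by rewrite ImM /= mul0r addr0. Qed.

Lemma complex_eq x y : Re x = Re y -> Im x = Im y -> x = y.
Proof. by case: x; case: y => ? ? ? ? /= -> ->. Qed.

Lemma cabs_ge0 z : 0 <= cabs z. Proof. exact: sqrtr_ge0. Qed.
Lemma cabs0 : cabs 0 = 0. Proof. by rewrite cabsE Normc.normc0. Qed.
Lemma cabs1 : cabs 1 = 1. Proof. by rewrite cabsE Normc.normc1. Qed.
Lemma cabsM x y : cabs (x * y) = cabs x * cabs y.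
Proof. by rewrite !cabsE Normc.normcM. Qed.
Lemma cabsV x : cabs x^-1 = (cabs x)^-1.
Proof. by rewrite !cabsE Normc.normcV. Qed.
Lemma cabsN x : cabs (- x) = cabs x.
Proof. by rewrite /cabs ReN ImN !sqrrN. Qed.
Lemma cabsD x y : cabs (x + y) <= cabs x + cabs y.
Proof. by rewrite !cabsE; exact: le_normcD. Qed.
Lemma cabsB x y : cabs (x - y) = cabs (y - x).
Proof. by rewrite -cabsN opprB. Qed.
Lemma cabs_triB x y : cabs (x - y) <= cabs x + cabs y.
Proof. by rewrite -(cabsN y); exact: cabsD. Qed.
Lemma cabs_dist z x y : cabs (x - y) <= cabs (x - z) + cabs (z - y).
Proof. by have := cabsD (x - z) (z - y); rewrite addrA subrK. Qed.
Lemma cabs_rtri x y : cabs x - cabs y <= cabs (x + y).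
Proof. by rewrite lerBlDr -(cabsN y) -{1}(addrK y x); exact: cabsD. Qed.
Lemma cabs_rtriB x y : cabs x - cabs y <= cabs (x - y).
Proof. by rewrite -(cabsN y); exact: cabs_rtri. Qed.
Lemma cabsX x n : cabs (x ^+ n) = cabs x ^+ n.
Proof. by elim: n => [|n IH]; rewrite ?expr0 ?cabs1 // !exprS cabsM IH. Qed.
Lemma cabs_eq0 x : (cabs x == 0) = (x == 0).
Proof.
apply/eqP/eqP => [|->]; last exact: cabs0.
by rewrite cabsE => /Normc.eq0_normc.
Qed.
Lemma cabs_gt0 x : (0 < cabs x) = (x != 0).
Proof. by rewrite lt_def cabs_ge0 andbT cabs_eq0. Qed.
Lemma cabs_real a : cabs (a%:C%C) = `|a|.
Proof. by rewrite /cabs /= expr0n addr0 sqrtr_sqr. Qed.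
Lemma cabs_nat n : cabs (n%:R) = n%:R.
Proof. by rewrite -(rmorph_nat (real_complex R)) cabs_real ger0_norm. Qed.
Lemma cabs_i : cabs (Complex 0 1) = 1 :> R.
Proof. by rewrite /cabs /= expr0n add0r expr1n sqrtr1. Qed.
Lemma cabs_sqr z : cabs z ^+ 2 = Re z ^+ 2 + Im z ^+ 2.
Proof. by rewrite /cabs sqr_sqrtr // addr_ge0 // sqr_ge0. Qed.
Lemma Re_le_cabs z : `|Re z| <= cabs z.
Proof.
rewrite -(ler_pXn2r (ltn0Sn 1)) ?nnegrE ?normr_ge0 ?cabs_ge0 //.
by rewrite cabs_sqr real_normK ?num_real // lerDl sqr_ge0.
Qed.
Lemma Im_le_cabs z : `|Im z| <= cabs z.
Proof.
rewrite -(ler_pXn2r (ltn0Sn 1)) ?nnegrE ?normr_ge0 ?cabs_ge0 //.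
by rewrite cabs_sqr real_normK ?num_real // lerDr sqr_ge0.
Qed.
Lemma cabs_le_ReIm z : cabs z <= `|Re z| + `|Im z|.
Proof.
have -> : z = (Re z)%:C%C + Complex 0 1 * (Im z)%:C%C.
  by apply: complex_eq; rewrite ?(ReD, ImD, ReM, ImM) /=; ring.
apply: le_trans (cabsD _ _) _; rewrite cabsM cabs_i mul1r !cabs_real.
by rewrite ?(ReD, ImD, ReM, ImM) /= !(mul0r, mul1r, mulr0, addr0, add0r, subr0).
Qed.
Lemma cabs_sum (I : Type) (r : seq I) (P : pred I) (F : I -> complex R) :
  cabs (\sum_(i <- r | P i) F i) <= \sum_(i <- r | P i) cabs (F i).
Proof.
elim/big_ind2: _ => [|x a y b xa yb|//]; first by rewrite cabs0.
by apply: le_trans (cabsD _ _) _; exact: lerD.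
Qed.
Lemma cabs_prod (I : Type) (r : seq I) (P : pred I) (F : I -> complex R) :
  cabs (\prod_(i <- r | P i) F i) = \prod_(i <- r | P i) cabs (F i).
Proof. by elim/big_rec2: _ => [|i x a _ <-]; rewrite ?cabs1 ?cabsM. Qed.
Lemma cabs_conj z : cabs (z^*)%C = cabs z.
Proof. by case: z => a b; rewrite /cabs /= sqrrN. Qed.
Lemma cabs_sgn n : cabs ((-1) ^+ n) = 1.
Proof. by rewrite cabsX cabsN cabs1 expr1n. Qed.

Lemma cabs_norm z : `|z| = (cabs z)%:C%C.
Proof. by rewrite normc_def. Qed.

End Modulus.

Section Dif.
Variable R : realType.
Local Notation C := (complex R).

(* [i] is the inclusion of the domain into C: the identity for functions of a
   complex variable, x |-> x%:C for curves. *)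
Definition dif (T : zmodType) (i : T -> C) (f : T -> C) (z : T) (l : C) :=
  forall e : R, 0 < e -> exists2 d : R, 0 < d &
    forall h : T, cabs (i h) < d ->
      cabs (f (z + h) - f z - l * i h) <= e * cabs (i h).

Definition cnt (T : zmodType) (i : T -> C) (f : T -> C) (z : T) :=
  forall e : R, 0 < e -> exists2 d : R, 0 < d &
    forall h : T, cabs (i h) < d -> cabs (f (z + h) - f z) <= e.

Section Generic.
Variables (T : zmodType) (i : T -> C).
Implicit Types (f g : T -> C) (z : T) (l m : C).

Lemma dif_ext_near f g z l (d : R) : 0 < d -> i 0 = 0 ->
  (forall h, cabs (i h) < d -> f (z + h) = g (z + h)) ->
  dif i f z l -> dif i g z l.
Proof.
move=> d0 i0 fg df e /df[d1 d10 h1]; exists (Num.min d d1) => [|h].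
  by rewrite lt_min d0.
rewrite lt_min => /andP[hd hd1]; rewrite -fg //.
have := fg 0; rewrite i0 cabs0 addr0 => /(_ d0) <-; exact: h1.
Qed.

Lemma dif_ext f g z l : f =1 g -> dif i f z l -> dif i g z l.
Proof. by move=> fg df e /df[d d0 h]; exists d => // k; rewrite -!fg; exact: h. Qed.

Lemma cnt_ext f g z : f =1 g -> cnt i f z -> cnt i g z.
Proof. by move=> fg df e /df[d d0 h]; exists d => // k; rewrite -!fg; exact: h. Qed.

Lemma dif_cnt f z l : dif i f z l -> cnt i f z.
Proof.
move=> df e e0; have [d d0 h] := df 1 ltr01.
have k0 : 0 < 1 + cabs l by rewrite ltr_pwDl // cabs_ge0.
exists (Num.min d (e / (1 + cabs l))) => [|x].
  by rewrite lt_min d0 divr_gt0.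
rewrite lt_min ltr_pdivlMr // => /andP[/h xd /ltW xe].
rewrite -[f _ - _](subrK (l * i x)); apply: le_trans (cabsD _ _) _.
by rewrite cabsM; nra.
Qed.

Lemma cnt_cst l z : cnt i (fun=> l) z.
Proof. by move=> e e0; exists 1 => // h _; rewrite subrr cabs0 ltW. Qed.

Lemma cntD f g z : cnt i f z -> cnt i g z -> cnt i (fun x => f x + g x) z.
Proof.
move=> cf cg e e0; have e20 : 0 < e / 2 by lra.
have [d d0 h] := cf _ e20; have [d' d'0 h'] := cg _ e20.
exists (Num.min d d') => [|x]; first by rewrite lt_min d0.
rewrite lt_min => /andP[/h hx /h' h'x].
have -> : f (z + x) + g (z + x) - (f z + g z) =
  (f (z + x) - f z) + (g (z + x) - g z) by ring.
by apply: le_trans (cabsD _ _) _; lra.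
Qed.

Lemma cntM f g z : cnt i f z -> cnt i g z -> cnt i (fun x => f x * g x) z.
Proof.
move=> cf cg e e0; pose k := 1 + cabs (f z) + cabs (g z).
have fz := cabs_ge0 (f z); have gz := cabs_ge0 (g z).
have k0 : 0 < k by rewrite /k; lra.
pose e1 := Num.min 1 (e / k); have e10 : 0 < e1 by rewrite lt_min ltr01 divr_gt0.
have e11 : e1 <= 1 by rewrite ge_min lexx.
have e1k : e1 * k <= e by rewrite -ler_pdivlMr // ge_min lexx orbT.
have [d d0 h] := cf _ e10; have [d' d'0 h'] := cg _ e10.
exists (Num.min d d') => [|x]; first by rewrite lt_min d0.
rewrite lt_min => /andP[/h hx /h' h'x].
have -> : f (z + x) * g (z + x) - (f z * g z) =
  (f (z + x) - f z) * (g (z + x) - g z) + (f (z + x) - f z) * g z +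
  f z * (g (z + x) - g z) by ring.
apply: le_trans (cabsD _ _) _; apply: le_trans (lerD (cabsD _ _) (lexx _)) _.
rewrite !cabsM.
have a0 := cabs_ge0 (f (z + x) - f z); have b0 := cabs_ge0 (g (z + x) - g z).
rewrite /k in e1k; nra.
Qed.

Lemma cntV f z : f z != 0 -> cnt i f z -> cnt i (fun x => (f x)^-1) z.
Proof.
move=> fz0 cf e e0; have a0 : 0 < cabs (f z) by rewrite cabs_gt0.
pose e1 := Num.min (cabs (f z) / 2) (e * cabs (f z) ^+ 2 / 2).
have e10 : 0 < e1 by rewrite lt_min !divr_gt0 // mulr_gt0 // exprn_gt0.
have [d d0 h] := cf _ e10; exists d => // x /h hx.
have h1 : cabs (f (z + x) - f z) <= cabs (f z) / 2.
  by apply: le_trans hx _; rewrite ge_min lexx.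
have h2 : cabs (f (z + x) - f z) <= e * cabs (f z) ^+ 2 / 2.
  by apply: le_trans hx _; rewrite ge_min lexx orbT.
have fx : cabs (f z) / 2 <= cabs (f (z + x)).
  have := cabs_rtri (f z) (f (z + x) - f z); rewrite [f z + _]addrC subrK; lra.
have fx0 : f (z + x) != 0 by rewrite -cabs_gt0; lra.
have -> : (f (z + x))^-1 - (f z)^-1 = (f z - f (z + x)) / (f (z + x) * f z).
  by field; rewrite fx0 fz0.
rewrite cabsM cabsV cabsM ler_pdivrMr ?mulr_gt0 ?cabs_gt0 // cabsB.
apply: le_trans h2 _; have := ler_wpM2l (mulr_ge0 (ltW e0) (ltW a0)) fx.
rewrite expr2; lra.
Qed.

Lemma dif_cst l z : dif i (fun=> l) z 0.
Proof.
by move=> e e0; exists 1 => // h _; rewrite subrr mul0r subr0 cabs0 mulr_ge0 ?cabs_ge0 ?ltW.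
Qed.

Lemma difD f g z l m : dif i f z l -> dif i g z m ->
  dif i (fun x => f x + g x) z (l + m).
Proof.
move=> cf cg e e0; have e20 : 0 < e / 2 by lra.
have [d d0 h] := cf _ e20; have [d' d'0 h'] := cg _ e20.
exists (Num.min d d') => [|x]; first by rewrite lt_min d0.
rewrite lt_min => /andP[/h hx /h' h'x].
have -> : f (z + x) + g (z + x) - (f z + g z) - (l + m) * i x =
  (f (z + x) - f z - l * i x) + (g (z + x) - g z - m * i x) by ring.
by apply: le_trans (cabsD _ _) _; lra.
Qed.

Lemma difM f g z l m : dif i f z l -> dif i g z m ->
  dif i (fun x => f x * g x) z (l * g z + f z * m).
Proof.
move=> df dg e e0; pose k := 2 + cabs (f z) + cabs (g z) + cabs l.
have fz := cabs_ge0 (f z); have gz := cabs_ge0 (g z); have l0 := cabs_ge0 l.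
have k0 : 0 < k by rewrite /k; lra.
pose e1 := Num.min 1 (e / k); have e10 : 0 < e1 by rewrite lt_min ltr01 divr_gt0.
have e11 : e1 <= 1 by rewrite ge_min lexx.
have e1k : e1 * k <= e by rewrite -ler_pdivlMr // ge_min lexx orbT.
have [d d0 h] := df _ e10; have [d' d'0 h'] := dg _ e10.
have [d2 d20 h2] := dif_cnt dg e10.
exists (Num.min d (Num.min d' d2)) => [|x]; first by rewrite !lt_min d0 d'0.
rewrite !lt_min => /andP[/h hx /andP[/h' h'x /h2 h2x]].
have -> : f (z + x) * g (z + x) - (f z * g z) - (l * g z + f z * m) * i x =
  (f (z + x) - f z - l * i x) * (g (z + x) - g z) +
  (f (z + x) - f z - l * i x) * g z +
  (f z * (g (z + x) - g z - m * i x) + l * i x * (g (z + x) - g z)) by ring.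
apply: le_trans (cabsD _ _) _; apply: le_trans (lerD (cabsD _ _) (cabsD _ _)) _.
rewrite !cabsM.
have a0 := cabs_ge0 (f (z + x) - f z - l * i x).
have b0 := cabs_ge0 (g (z + x) - g z - m * i x).
have c0 := cabs_ge0 (g (z + x) - g z).
have x0 := cabs_ge0 (i x).
move: (cabs (f (z + x) - _ - _)) (cabs (g (z + x) - g z - _))
  (cabs (g (z + x) - g z)) (cabs (i x)) hx h'x h2x a0 b0 c0 x0
  => A B D X hx h'x h2x a0 b0 c0 x0.
apply: (@le_trans _ _ (e1 * X * 1 + e1 * X * cabs (g z) +
  (cabs (f z) * (e1 * X) + cabs l * X * e1))).
  apply: lerD; apply: lerD.
  - by apply: ler_pM => //; lra.
  - by apply: ler_wpM2r.
  - by apply: ler_wpM2l.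
  - by apply: ler_wpM2l => //; rewrite mulr_ge0.
have : (e1 * k) * X <= e * X by apply: ler_wpM2r.
have : 0 <= e1 * X by rewrite mulr_ge0 // ltW.
rewrite /k; nra.
Qed.

Lemma difZ c f z l : dif i f z l -> dif i (fun x => c * f x) z (c * l).
Proof. by move=> df; have := difM (dif_cst c z) df; rewrite mul0r add0r. Qed.

Lemma difN f z l : dif i f z l -> dif i (fun x => - f x) z (- l).
Proof.
move=> df; rewrite -mulN1r; apply: (@dif_ext (fun x => -1 * f x)).
  by move=> x; rewrite mulN1r.
exact: difZ.
Qed.

Lemma difB f g z l m : dif i f z l -> dif i g z m ->
  dif i (fun x => f x - g x) z (l - m).
Proof. by move=> df dg; apply: difD => //; exact: difN. Qed.

Lemma cntN f z : cnt i f z -> cnt i (fun x => - f x) z.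
Proof.
move=> df; apply: (@cnt_ext (fun x => -1 * f x)); first by move=> x; rewrite mulN1r.
apply: cntM => //; exact: cnt_cst.
Qed.

Lemma cntB f g z : cnt i f z -> cnt i g z -> cnt i (fun x => f x - g x) z.
Proof. by move=> df dg; apply: cntD => //; exact: cntN. Qed.

Lemma dif_comp (g : C -> C) f z l m : dif i f z l -> dif id g (f z) m ->
  dif i (fun x => g (f x)) z (m * l).
Proof.
move=> df dg e e0; have m0 := cabs_ge0 m; have l0 := cabs_ge0 l.
pose e2 := e / (2 * (1 + cabs l)).
have e20 : 0 < e2 by rewrite /e2 divr_gt0 // mulr_gt0 //; lra.
have [d2 d20 h2] := dg _ e20.
pose e1 := Num.min 1 (e / (2 * (1 + cabs m))).
have e10 : 0 < e1 by rewrite lt_min ltr01 divr_gt0 // mulr_gt0 //; lra.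
have [d1 d10 h1] := df _ e10.
have [d3 d30 h3] := dif_cnt df (divr_gt0 d20 (ltr0n R 2)).
exists (Num.min d1 d3) => [|x]; first by rewrite lt_min d10.
rewrite lt_min => /andP[/h1 h1x /h3 h3x].
have /h2 : cabs (f (z + x) - f z) < d2 by apply: le_lt_trans h3x _; lra.
rewrite [f z + _]addrC subrK => h2x.
have -> : g (f (z + x)) - g (f z) - m * l * i x =
  (g (f (z + x)) - g (f z) - m * (f (z + x) - f z)) +
  m * (f (z + x) - f z - l * i x) by ring.
apply: le_trans (cabsD _ _) _; rewrite cabsM.
have x0 := cabs_ge0 (i x).
have e1m : e1 * (1 + cabs m) <= e / 2.
  rewrite -ler_pdivlMr; last by lra.
  by rewrite ge_min -[X in _ || (_ <= X)]mulrA -invfM lexx orbT.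
have e2l : e2 * (1 + cabs l) = e / 2.
  by rewrite /e2; field; lra.
have e11 : e1 <= 1 by rewrite ge_min lexx.
have fx : cabs (f (z + x) - f z) <= (1 + cabs l) * cabs (i x).
  rewrite -[f _ - _](subrK (l * i x)); apply: le_trans (cabsD _ _) _.
  by rewrite cabsM; nra.
move: h1x h2x fx.
move: (cabs (f (z + x) - _ - _)) (cabs (f (z + x) - f z)) (cabs (g (f (z + x)) - _ - _)).
move=> A B D h1x h2x fx.
have : e2 * B <= e2 * ((1 + cabs l) * cabs (i x)) by apply: ler_wpM2l => //; lra.
rewrite mulrA e2l => hh.
have : cabs m * A <= cabs m * (e1 * cabs (i x)) by apply: ler_wpM2l.
have : e1 * (1 + cabs m) * cabs (i x) <= e / 2 * cabs (i x) by apply: ler_wpM2r.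
have : 0 <= e1 * cabs (i x) by rewrite mulr_ge0 // ltW.
nra.
Qed.

Lemma cnt_comp (g : C -> C) f z : cnt i f z -> cnt id g (f z) ->
  cnt i (fun x => g (f x)) z.
Proof.
move=> cf cg e /cg[d d0 h]; have [d' d'0 h'] := cf _ (divr_gt0 d0 (ltr0n R 2)).
exists d' => // x /h' hx; have := h (f (z + x) - f z).
by rewrite [f z + _]addrC subrK; apply; apply: le_lt_trans hx _; lra.
Qed.

End Generic.

Lemma dif_id z : dif id (@id C) z 1.
Proof.
move=> e e0; exists 1 => // h _; rewrite mul1r [z + h]addrC addrK subrr cabs0.
by rewrite mulr_ge0 ?cabs_ge0 // ltW.
Qed.

Lemma dif_inv (z : C) : z != 0 -> dif id (fun x : C => x^-1) z (- z ^- 2).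
Proof.
move=> z0 e e0; have a0 : 0 < cabs z by rewrite cabs_gt0.
pose d := Num.min (cabs z / 2) (e * cabs z ^+ 3 / 2).
exists d => [|h]; first by rewrite lt_min !divr_gt0 // mulr_gt0 // exprn_gt0.
rewrite lt_min => /andP[h1 h2].
have zh : cabs z / 2 <= cabs (z + h) by have := cabs_rtri z h; rewrite /=; lra.
have zh0 : z + h != 0 by rewrite -cabs_gt0; lra.
have -> : (z + h)^-1 - z^-1 - - z ^- 2 * h = h ^+ 2 / (z ^+ 2 * (z + h)).
  by field; rewrite z0 zh0.
rewrite cabsM cabsV cabsM !cabsX ler_pdivrMr; last first.
  by rewrite mulr_gt0 ?exprn_gt0 ?cabs_gt0.
apply: (@le_trans _ _ (cabs h * (e * (cabs z ^+ 2 * (cabs z / 2))))).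
  rewrite expr2; apply: ler_wpM2l; first exact: cabs_ge0.
  apply: le_trans (ltW h2) _; rewrite le_eqVlt; apply/orP; left; apply/eqP.
  by field.
rewrite [leRHS](_ : _ = cabs h * (e * (cabs z ^+ 2 * cabs (z + h)))); last by ring.
apply: ler_wpM2l; first exact: cabs_ge0.
by rewrite ler_pM2l // ler_pM2l ?exprn_gt0.
Qed.

Lemma cnt_id z : cnt id (@id C) z.
Proof. exact: dif_cnt (@dif_id z). Qed.

Lemma dif_unique (f : C -> C) z l m : dif id f z l -> dif id f z m -> l = m.
Proof.
move=> dl dm; apply/eqP; rewrite -subr_eq0 -cabs_eq0; apply/eqP/le_anti.
rewrite cabs_ge0 andbT; apply/ler_addgt0Pl => e e0; rewrite addr0.
have e20 : 0 < e / 2 by lra.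
have [d d0 h] := dl _ e20; have [d' d'0 h'] := dm _ e20.
pose r := Num.min d d' / 2; have r0 : 0 < r by rewrite divr_gt0 // lt_min d0.
have rd : r < Num.min d d' by rewrite /r in r0 *; lra.
move: rd; rewrite lt_min => /andP[rd rd'].
have cr : cabs (r%:C%C) = r by rewrite cabs_real gtr0_norm.
have := h r%:C%C; have := h' r%:C%C; rewrite cr => /(_ rd') h2 /(_ rd) h1.
have : cabs ((l - m) * r%:C%C) <= e * r.
  have -> : (l - m) * r%:C%C = (f (z + r%:C%C) - f z - m * r%:C%C) -
    (f (z + r%:C%C) - f z - l * r%:C%C) by ring.
  by apply: le_trans (cabs_triB _ _) _; lra.
by rewrite cabsM cr ler_pM2r.
Qed.

Lemma dif_pow (T : zmodType) (i : T -> C) f z l n : dif i f z l ->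
  dif i (fun x => f x ^+ n) z (n%:R * f z ^+ n.-1 * l).
Proof.
move=> df; elim: n => [|n IH]; first by rewrite !mul0r; exact: dif_cst.
have := difM df IH; set m := (X in dif _ _ _ X -> _).
have -> : m = n.+1%:R * f z ^+ n.+1.-1 * l.
  rewrite /m /=; case: n {IH m} => [|n]; first by rewrite !expr0; ring.
  rewrite -[n.+2]addn1 natrD exprS /= ; ring.
by apply: dif_ext => x; rewrite exprS.
Qed.

End Dif.

(** * Derivatives along real curves, mean value inequalities, the complex exponential *)

Section Curves.
Variable R : realType.
Local Notation C := (complex R).
Local Notation rc := (fun x : R => x%:C%C).

Lemma is_derive_eps (f : R -> R) (t v : R) : is_derive t 1 f v <->
  forall e : R, 0 < e -> exists2 d : R, 0 < d &
    forall h : R, `|h| < d -> `|f (t + h) - f t - v * h| <= e * `|h|.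
Proof.
split=> [[df vE] e e0|H].
- have : h^-1 *: (f (h *: 1 + t) - f t) @[h --> (0:R)^'] --> v by rewrite -vE.
  move=> /cvgrPdist_le/(_ e e0) [d d0 hd]; exists d => // h hh.
  have [->|h0] := eqVneq h 0.
    by rewrite addr0 subrr mulr0 subrr normr0 mulr0.
  have := hd h; rewrite /= sub0r normrN => /(_ hh h0).
  rewrite -(@ler_pM2r _ `|h|) ?normr_gt0 // -normrM; apply: le_trans.
  rewrite le_eqVlt; apply/orP; left; apply/eqP.
  rewrite mulrBl /GRing.scale /= mulr1 [h + t]addrC mulrAC mulVf // mul1r -normrN.
  by congr (`| _ |); ring.
- have H2 : h^-1 *: (f (h *: 1 + t) - f t) @[h --> (0:R)^'] --> v.
    apply/cvgrPdist_le => e e0; have [d d0 hd] := H e e0.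
    exists d => // h /=; rewrite sub0r normrN => /hd hh h0.
    rewrite -(@ler_pM2r _ `|h|) ?normr_gt0 // -normrM; apply: le_trans hh.
    rewrite le_eqVlt; apply/orP; left; apply/eqP.
    rewrite mulrBl /GRing.scale /= mulr1 [h + t]addrC mulrAC mulVf // mul1r -normrN.
    by congr (`| _ |); ring.
  apply: DeriveDef; last exact/cvg_lim.
  by apply/cvg_ex; exists v.
Qed.

Lemma is_derive_lin (k t : R) : is_derive t 1 (fun x : R => k * x) k.
Proof.
apply/is_derive_eps => e e0; exists 1 => // h _.
rewrite [X in `|X|](_ : _ = 0); last by ring.
by rewrite normr0 mulr_ge0 // ltW.
Qed.

Lemma is_derive_linr (k t : R) : is_derive t 1 (fun x : R => x * k) k.
Proof.
apply/is_derive_eps => e e0; exists 1 => // h _.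
rewrite [X in `|X|](_ : _ = 0); last by ring.
by rewrite normr0 mulr_ge0 // ltW.
Qed.

Lemma rdif_real (f : R -> R) (t v : R) : is_derive t 1 f v ->
  dif rc (fun x => (f x)%:C%C) t v%:C%C.
Proof.
move=> /is_derive_eps H e /H[d d0 hd]; exists d => // h.
by rewrite cabs_real => /hd; rewrite -!(rmorphB,rmorphM) /= cabs_real.
Qed.

Lemma rdif_Re (g : R -> C) t l : dif rc g t l -> is_derive t 1 (fun x => Re (g x)) (Re l).
Proof.
move=> H; apply/is_derive_eps => e /H[d d0 hd]; exists d => // h.
rewrite -{1}[h]/(Re (rc h)) -cabs_real => /hd; rewrite cabs_real; apply: le_trans.
apply: le_trans _ (Re_le_cabs _).
by rewrite !ReB [l * _]mulrC ReRM [h * _]mulrC.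
Qed.

Lemma rdif_Im (g : R -> C) t l : dif rc g t l -> is_derive t 1 (fun x => Im (g x)) (Im l).
Proof.
move=> H; apply/is_derive_eps => e /H[d d0 hd]; exists d => // h.
rewrite -{1}[h]/(Re (rc h)) -cabs_real => /hd; rewrite cabs_real; apply: le_trans.
apply: le_trans _ (Im_le_cabs _).
by rewrite !ImB [l * _]mulrC ImRM [h * _]mulrC.
Qed.

Lemma rdif_id t : dif rc rc t 1.
Proof.
move=> e e0; exists 1 => // h _.
rewrite rmorphD /= mul1r [t%:C%C + _]addrC addrK subrr cabs0.
by rewrite mulr_ge0 ?cabs_ge0 // ltW.
Qed.

Lemma rdif_conv (g : R -> C) t l l' : l = l' -> dif rc g t l -> dif rc g t l'.
Proof. by move=> ->. Qed.

Lemma dif_conv (g : C -> C) t l l' : l = l' -> dif id g t l -> dif id g t l'.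
Proof. by move=> ->. Qed.

Lemma derive_within (f f' : R -> R) (a b : R) :
  (forall t, a <= t <= b -> is_derive t 1 f (f' t)) -> {within `[a, b], continuous f}.
Proof.
move=> H; apply: derivable_within_continuous => t; rewrite in_itv /= => /H[df _]; exact: df.
Qed.

(** Takes the place of monotonicity of the integral: integrals over real intervals appear as
    increments of primitives, so an inequality between integrands becomes one between increments. *)
Lemma mono_derive (f f' g g' : R -> R) (a b : R) : a <= b ->
  (forall t, a <= t <= b -> is_derive t 1 f (f' t)) ->
  (forall t, a <= t <= b -> is_derive t 1 g (g' t)) ->
  (forall t, a <= t <= b -> f' t <= g' t) ->
  f b - f a <= g b - g a.
Proof.
move=> ab df dg fg.
have dh t : a <= t <= b -> is_derive t 1 (g - f) (g' t - f' t).
  by move=> tab; apply: is_deriveB; [exact: dg|exact: df].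
have [c cab E] := @MVT_segment R (g - f) (fun t => g' t - f' t) a b ab
  (fun x => ltac:(rewrite in_itv /= => /andP[x1 x2]; apply: dh; rewrite !ltW //))
  (derive_within dh).
have : 0 <= (g b - f b) - (g a - f a).
  by move: E; rewrite /= !fctE => ->; rewrite mulr_ge0 ?subr_ge0 // fg.
lra.
Qed.

(** A complex-valued curve has no mean value theorem, so with D = g b - g a the real comparison is
    applied to Re (conj D * g), whose increment is |D|^2. *)
Lemma mvi (g g' : R -> C) (M a b : R) : a <= b ->
  (forall t, a <= t <= b -> dif rc g t (g' t)) ->
  (forall t, a <= t <= b -> cabs (g' t) <= M) ->
  cabs (g b - g a) <= M * (b - a).
Proof.
move=> ab dg gM; set D := g b - g a.
have [D0|D0] := eqVneq D 0.
  rewrite D0 cabs0 mulr_ge0 ?subr_ge0 //; apply: le_trans (cabs_ge0 (g' a)) _.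
  by rewrite gM // lexx.
have cD : 0 < cabs D by rewrite cabs_gt0.
have dre t : a <= t <= b -> is_derive t 1 (fun x => Re ((D^*)%C * g x)) (Re ((D^*)%C * g' t)).
  by move=> tab; apply: rdif_Re; apply: difZ; exact: dg.
have dl t : a <= t <= b -> is_derive t 1 (fun x : R => (cabs D * M) * x) (cabs D * M).
  by move=> _; exact: is_derive_lin.
have := mono_derive ab dre dl _.
have E : Re ((D^*)%C * g b) - Re ((D^*)%C * g a) = cabs D ^+ 2.
  rewrite -ReB -mulrBr -/D cabs_sqr ReM; case: (D) => x y /=; ring.
rewrite E -mulrBr -mulrA expr2 ler_pM2l //; apply => t tab.
apply: le_trans (ler_norm _) _; apply: le_trans (Re_le_cabs _) _.
by rewrite cabsM cabs_conj ler_pM2l // gM.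
Qed.

Lemma curve_const (g : R -> C) a b : a <= b ->
  (forall t, a <= t <= b -> dif rc g t 0) -> g b = g a.
Proof.
move=> ab dg; have := @mvi g (fun=> 0) 0 a b ab dg.
rewrite mul0r => /(_ (fun _ _ => ltac:(rewrite cabs0 //))) H.
by apply/eqP; rewrite -subr_eq0 -cabs_eq0 eq_le H cabs_ge0.
Qed.

Lemma rdif_Complex (f g : R -> R) (t v w : R) : is_derive t 1 f v -> is_derive t 1 g w ->
  dif rc (fun x => Complex (f x) (g x)) t (Complex v w).
Proof.
move=> df dg.
apply: (@dif_ext _ _ rc (fun x => (f x)%:C%C + Complex 0 1 * (g x)%:C%C)).
  by move=> x; apply: complex_eq; rewrite ?(ReD,ImD,ReM,ImM) /=; ring.
apply: (@rdif_conv _ _ (v%:C%C + Complex 0 1 * w%:C%C)).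
  by apply: complex_eq; rewrite ?(ReD,ImD,ReM,ImM) /=; ring.
by apply: difD; [exact: rdif_real|apply: difZ; exact: rdif_real].
Qed.

Lemma cexpD (x y : C) : cexp (x + y) = cexp x * cexp y.
Proof.
rewrite /cexp ReD ImD expRD cosD sinD; apply: complex_eq; rewrite ?(ReM, ImM) /=; ring.
Qed.
Lemma cexp0 : cexp 0 = 1 :> C.
Proof. by rewrite /cexp /= expR0 cos0 sin0 mulr1 mulr0. Qed.
Lemma cexp_neq0 (x : C) : cexp x != 0.
Proof.
apply/eqP => h; have := cexpD x (- x); rewrite subrr cexp0 h mul0r => /eqP.
by rewrite oner_eq0.
Qed.
Lemma cabs_cexp (x : C) : cabs (cexp x) = expR (Re x).
Proof.
rewrite /cabs /cexp /= !exprMn -mulrDr cos2Dsin2 mulr1 sqrtr_sqr.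
by rewrite ger0_norm // expR_ge0.
Qed.
Lemma cexp_sum (I : Type) (r : seq I) (P : pred I) (F : I -> C) :
  cexp (\sum_(i <- r | P i) F i) = \prod_(i <- r | P i) cexp (F i).
Proof. by elim/big_rec2: _ => [|i x a _ <-]; rewrite ?cexp0 ?cexpD. Qed.

Lemma rdif_cexp_lin (w : C) t : dif rc (fun x : R => cexp (x%:C%C * w)) t
  (w * cexp (t%:C%C * w)).
Proof.
have E x : cexp (x%:C%C * w) = Complex (expR (x * Re w) * cos (x * Im w))
    (expR (x * Re w) * sin (x * Im w)) by rewrite /cexp ReRM ImRM.
apply: (@dif_ext _ _ rc (fun x => Complex (expR (x * Re w) * cos (x * Im w))
    (expR (x * Re w) * sin (x * Im w)))) => [x|]; first by rewrite E.
have de (u : R) : is_derive t 1 (fun x : R => expR (x * u)) (expR (t * u) * u).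
  exact: (@is_derive1_comp _ expR (fun x : R => x * u) t _ _ (is_derive_expR (t * u)) (is_derive_linr u t)).
have dc (u : R) : is_derive t 1 (fun x : R => cos (x * u)) (- sin (t * u) * u).
  exact: (@is_derive1_comp _ cos (fun x : R => x * u) t _ _ (is_derive_cos (t * u)) (is_derive_linr u t)).
have ds (u : R) : is_derive t 1 (fun x : R => sin (x * u)) (cos (t * u) * u).
  exact: (@is_derive1_comp _ sin (fun x : R => x * u) t _ _ (is_derive_sin (t * u)) (is_derive_linr u t)).
apply: (rdif_conv _ (rdif_Complex (is_deriveM (de (Re w)) (dc (Im w)))
  (is_deriveM (de (Re w)) (ds (Im w))))).
rewrite /cexp ReRM ImRM; apply: complex_eq;
  rewrite ?(ReM, ImM) /= /GRing.scale /=; ring.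
Qed.

Lemma cexp_sub1 (w : C) : cabs (cexp w - 1) <= cabs w * expR (cabs w).
Proof.
have := @mvi _ _ (cabs w * expR (cabs w)) 0 1 ler01 (fun t _ => rdif_cexp_lin w t).
rewrite mul1r mul0r cexp0 subr0 mulr1; apply => t /andP[t0 t1].
rewrite cabsM ler_wpM2l ?cabs_ge0 // cabs_cexp ler_expR ReRM.
apply: le_trans (ler_norm _) _; rewrite normrM ger0_norm //.
apply: le_trans (Re_le_cabs w); exact: ler_piMl.
Qed.

Lemma cexp_sub1D (w : C) : cabs (cexp w - 1 - w) <= cabs w ^+ 2 * expR (cabs w).
Proof.
have H t : dif rc (fun x : R => cexp (x%:C%C * w) - x%:C%C * w) t
    (w * cexp (t%:C%C * w) - w).
  apply: difB; first exact: rdif_cexp_lin.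
  apply: (@dif_ext _ _ rc (fun x => w * x%:C%C)) => [x|]; first by rewrite mulrC.
  by have := difZ w (rdif_id t); rewrite mulr1.
have := @mvi _ _ (cabs w ^+ 2 * expR (cabs w)) 0 1 ler01 (fun t _ => H t).
rewrite mul1r mul0r cexp0 !subr0 mulr1.
have -> : cexp w - w - 1 = cexp w - 1 - w by ring.
apply => t /andP[t0 t1].
have -> : w * cexp (t%:C%C * w) - w = w * (cexp (t%:C%C * w) - 1) by ring.
have tw : cabs (t%:C%C * w) <= cabs w.
  by rewrite cabsM cabs_real ger0_norm // ler_piMl // cabs_ge0.
rewrite cabsM expr2 -mulrA ler_wpM2l ?cabs_ge0 //.
apply: le_trans (cexp_sub1 _) _; apply: ler_pM; rewrite ?cabs_ge0 ?expR_ge0 //.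
by rewrite ler_expR.
Qed.

Lemma dif_cexp (z : C) : dif id (@cexp R) z (cexp z).
Proof.
move=> e e0; set k := cabs (cexp z) * expR 1.
have k0 : 0 < k by rewrite mulr_gt0 ?expR_gt0 // cabs_gt0 cexp_neq0.
exists (Num.min 1 (e / k)) => [|h]; first by rewrite lt_min ltr01 divr_gt0.
rewrite lt_min ltr_pdivlMr // => /andP[h1 /ltW hk].
have -> : cexp (z + h) - cexp z - cexp z * h = cexp z * (cexp h - 1 - h).
  by rewrite cexpD; ring.
rewrite cabsM; apply: le_trans (ler_wpM2l (cabs_ge0 _) (cexp_sub1D h)) _.
apply: (@le_trans _ _ (cabs h * k * cabs h)); last by rewrite ler_wpM2r // cabs_ge0.
rewrite /k expr2 [leRHS](_ : _ = cabs (cexp z) * (cabs h * cabs h * expR 1)); last by ring.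
rewrite ler_wpM2l ?cabs_ge0 // ler_wpM2l ?mulr_ge0 ?cabs_ge0 // ler_expR ltW //.
Qed.

(** Integrating from -1 up to 2 makes 0 and 1 interior points, so that the derivative is two-sided
    on all of [0, 1]. *)
Lemma real_prim (f : R -> R) : continuous f ->
  exists F : R -> R, forall t : R, -1 < t -> t < 2 -> is_derive t 1 F (f t).
Proof.
move=> cf.
exists (fun x => \int[@lebesgue_measure R]_(t in [set` `[-1, x]]) f t)%R => t t1 t2.
have [d E] := continuous_FTC1_closed t2
  (continuous_compact_integrable (@segment_compact R _ _) (continuous_subspaceT cf))
  t1 (cf t).
split; first exact: d.
by rewrite -derive1E E.
Qed.

End Curves.

(** * Cauchy's theorem and its consequences *)

Section Integral.
Variable R : realType.
Local Notation C := (complex R).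
Local Notation rc := (fun x : R => x%:C%C).
Implicit Types (f g : C -> C) (phi psi : R -> C) (a b c : C).

(** The retraction of the line onto [0, 1]. Composing with it turns a curve continuous on [0, 1]
    into one continuous everywhere, as [real_prim] requires. *)
Definition clamp (t : R) : R := Num.max 0 (Num.min 1 t).

Lemma clamp_in t : 0 <= clamp t <= 1.
Proof. by rewrite /clamp le_max lexx ge_max ler01 ge_min lexx. Qed.

Lemma clampE t : 0 <= t <= 1 -> clamp t = t.
Proof. by move=> /andP[t0 t1]; rewrite /clamp min_r // max_r. Qed.

Lemma clamp_lip s t : `|clamp s - clamp t| <= `|s - t|.
Proof.
rewrite /clamp; case: (leP 1 s) => hs; case: (leP 1 t) => ht;
  rewrite ?(@max_r _ R 0 1 ler01); try (case: (leP 0 s) => hs0);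
  try (case: (leP 0 t) => ht0); rewrite ler_norml; apply/andP; split;
  case: (ler0P (s - t)) => hst; lra.
Qed.

Lemma cnt_continuous phi (pr : C -> R) :
  (forall z, `|pr z| <= cabs z) -> {morph pr : x y / x - y} ->
  (forall t, 0 <= t <= 1 -> cnt rc phi t) ->
  continuous (fun t => pr (phi (clamp t))).
Proof.
move=> pr1 prB cf t; apply/cvgrPdist_le => e e0.
have [d d0 hd] := cf _ (clamp_in t) e e0.
exists d => // s /= hs; rewrite -prB; apply: le_trans (pr1 _) _.
rewrite cabsB -[clamp s](subrK (clamp t)) [_ + clamp t]addrC.
by apply: hd; rewrite cabs_real; apply: le_lt_trans (clamp_lip _ _) _; rewrite distrC.
Qed.

Definition antider phi (Phi : R -> C) :=
  forall t, 0 <= t <= 1 -> dif rc Phi t (phi t).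

Lemma antider_ex phi : (forall t, 0 <= t <= 1 -> cnt rc phi t) ->
  exists Phi, antider phi Phi.
Proof.
move=> cphi.
have [F dF] := real_prim (cnt_continuous (@Re_le_cabs R) (@ReB R) cphi).
have [G dG] := real_prim (cnt_continuous (@Im_le_cabs R) (@ImB R) cphi).
exists (fun t => Complex (F t) (G t)) => t t01.
have [t1 t2] : -1 < t /\ t < 2 by move: t01 => /andP[]; lra.
have := rdif_Complex (dF t t1 t2) (dG t t1 t2).
by rewrite clampE //; case: (phi t).
Qed.

(** The integral over [0, 1], as the increment of a chosen antiderivative. By [int01E] the choice is
    immaterial; the default makes the integral 0 when there is no antiderivative. *)
Definition int01 phi : C :=
  let Phi := xget (fun=> 0) [set Phi | antider phi Phi] in Phi 1 - Phi 0.

Lemma int01E phi Phi : antider phi Phi -> int01 phi = Phi 1 - Phi 0.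
Proof.
move=> dPhi; rewrite /int01; set Psi := xget _ _.
have dPsi : antider phi Psi.
  by rewrite /Psi; case: xgetP => [G _ //|/(_ Phi)].
have := @curve_const R (fun t => Psi t - Phi t) 0 1 ler01.
move=> /(_ (fun t t01 => rdif_conv (subrr _) (difB (dPsi t t01) (dPhi t t01)))) E.
by apply/eqP; rewrite -subr_eq0 -[X in _ == X](subrr (Psi 0 - Phi 0)) -{1}E; apply/eqP; ring.
Qed.

Lemma int01_ext phi psi : (forall t, phi t = psi t) -> int01 phi = int01 psi.
Proof. by move=> /funext ->. Qed.

Section Cont.
Variables (phi psi : R -> C).
Hypothesis cphi : forall t, 0 <= t <= 1 -> cnt rc phi t.
Hypothesis cpsi : forall t, 0 <= t <= 1 -> cnt rc psi t.

Lemma int01D : int01 (fun t => phi t + psi t) = int01 phi + int01 psi.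
Proof.
have [F dF] := antider_ex cphi; have [G dG] := antider_ex cpsi.
rewrite (int01E dF) (int01E dG) (@int01E _ (fun t => F t + G t)); first by ring.
by move=> t t01; apply: difD; [exact: dF|exact: dG].
Qed.

Lemma int01Z c : int01 (fun t => c * phi t) = c * int01 phi.
Proof.
have [F dF] := antider_ex cphi.
rewrite (int01E dF) (@int01E _ (fun t => c * F t)); first by ring.
by move=> t t01; apply: difZ; exact: dF.
Qed.

Lemma int01_le M : (forall t, 0 <= t <= 1 -> cabs (phi t) <= M) -> cabs (int01 phi) <= M.
Proof.
have [F dF] := antider_ex cphi => hM.
by rewrite (int01E dF); have := mvi ler01 dF hM; rewrite subr0 mulr1.
Qed.

End Cont.

Lemma int01B phi psi : (forall t, 0 <= t <= 1 -> cnt rc phi t) ->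
  (forall t, 0 <= t <= 1 -> cnt rc psi t) ->
  int01 (fun t => phi t - psi t) = int01 phi - int01 psi.
Proof.
move=> cphi cpsi; rewrite (@int01_ext _ (fun t => phi t + -1 * psi t)).
  rewrite int01D // ?int01Z ?mulN1r // => t t01.
  by apply: cntM; [exact: cnt_cst|exact: cpsi].
by move=> t; rewrite mulN1r.
Qed.

Lemma int01_cst c : int01 (fun=> c) = c.
Proof.
rewrite (@int01E _ (fun t => t%:C%C * c)); first by rewrite mul1r mul0r subr0.
move=> t _; have := difM (rdif_id t) (dif_cst rc c t).
by apply: rdif_conv; rewrite mul1r mulr0 addr0.
Qed.

Lemma rdif_affine (F : R -> C) (k c t : R) l : dif rc F (k * t + c) l ->
  dif rc (fun x => F (k * x + c)) t (k%:C%C * l).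
Proof.
move=> dF e e0; have k1 : 0 < 1 + `|k| by rewrite ltr_pwDl.
have [d d0 hd] := dF (e / (1 + `|k|)) (divr_gt0 e0 k1).
exists (d / (1 + `|k|)) => [|h]; first exact: divr_gt0.
rewrite cabs_real ltr_pdivlMr // => hh.
have -> : k * (t + h) + c = k * t + c + k * h by ring.
have kh : cabs ((k * h)%:C%C) <= (1 + `|k|) * `|h|.
  by rewrite cabs_real normrM ler_wpM2r // lerDr.
have /hd : cabs ((k * h)%:C%C) < d by apply: le_lt_trans kh _; rewrite mulrC.
rewrite rmorphM /= mulrA [l * _]mulrC => H; apply: le_trans H _.
rewrite -[leRHS]mulr1 -[X in _ <= _ * X](@divff _ (1 + `|k|)) ?gt_eqF //.
rewrite -rmorphM /= [leRHS](_ : _ = e / (1 + `|k|) * ((1 + `|k|) * `|h|)); last first.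
  by ring.
by rewrite ler_wpM2l // divr_ge0 // ltW.
Qed.

Definition seg (a b : C) (t : R) : C := a + t%:C%C * (b - a).

Lemma rdif_seg a b t : dif rc (seg a b) t (b - a).
Proof.
have := difD (dif_cst rc a t) (difM (rdif_id t) (dif_cst rc (b - a) t)).
by apply: rdif_conv; rewrite mul1r mulr0 addr0 add0r.
Qed.

Definition cseg (f : C -> C) (a b : C) : C := (b - a) * int01 (fun t => f (seg a b t)).

Definition onseg (P : C -> Prop) a b := forall t : R, 0 <= t <= 1 -> P (seg a b t).

Lemma cnt_seg (f : C -> C) a b : onseg (cnt id f) a b ->
  forall t, 0 <= t <= 1 -> cnt rc (fun t => f (seg a b t)) t.
Proof. by move=> H t t01; apply: cnt_comp; [exact: dif_cnt (rdif_seg a b t)|exact: H]. Qed.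

Lemma segC a b t : seg b a t = seg a b (1 - t).
Proof. by rewrite /seg rmorphB /=; ring. Qed.

Lemma cseg_sym f a b : onseg (cnt id f) a b -> cseg f b a = - cseg f a b.
Proof.
move=> H; have [F dF] := antider_ex (cnt_seg H).
rewrite /cseg (int01E dF) (@int01E _ (fun t => - F (-1 * t + 1))).
  by rewrite mulr1 mulr0 add0r addNr; ring.
move=> t t01; have t01' : 0 <= -1 * t + 1 <= 1 by move: t01 => /andP[]; lra.
have := difN (rdif_affine (dF _ t01')); apply: rdif_conv.
have -> : -1 * t + 1 = 1 - t by ring.
by rewrite [seg b a t]segC rmorphN1 mulN1r opprK.
Qed.

Lemma cseg_mid f a b : onseg (cnt id f) a b ->
  cseg f a b = cseg f a ((a + b) / 2) + cseg f ((a + b) / 2) b.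
Proof.
move=> H; have [F dF] := antider_ex (cnt_seg H).
have two0 : (2 : C) != 0 by rewrite pnatr_eq0.
have half : (2^-1 : R)%:C%C = 2^-1 :> C by rewrite fmorphV rmorph_nat.
rewrite /cseg (int01E dF) (@int01E _ (fun t => 2 * F (2^-1 * t + 0))); last first.
  move=> t t01; have t01' : 0 <= 2^-1 * t + 0 <= 1 by move: t01 => /andP[]; lra.
  have := difZ 2 (rdif_affine (dF _ t01')); apply: rdif_conv.
  rewrite half mulrA divff // mul1r; congr f.
  by rewrite /seg addr0 rmorphM /= half; field.
rewrite (@int01E _ (fun t => 2 * F (2^-1 * t + 2^-1))); last first.
  move=> t t01; have t01' : 0 <= 2^-1 * t + 2^-1 <= 1 by move: t01 => /andP[]; lra.
  have := difZ 2 (rdif_affine (dF _ t01')); apply: rdif_conv.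
  rewrite half mulrA divff // mul1r; congr f.
  by rewrite /seg rmorphD rmorphM /= half; field.
rewrite !mulr0 !add0r !mulr1 !addr0.
have -> : (2^-1 + 2^-1 : R) = 1 by field.
by field.
Qed.

Lemma cseg_prim (f F : C -> C) a b :
  onseg (fun z => dif id F z (f z)) a b -> cseg f a b = F b - F a.
Proof.
move=> H; have [->|ab] := eqVneq a b; first by rewrite /cseg !subrr mul0r.
have ab0 : b - a != 0 by rewrite subr_eq0 eq_sym.
rewrite /cseg (@int01E _ (fun t => (b - a)^-1 * F (seg a b t))).
  rewrite -mulrBr mulrA divff // mul1r /seg mul1r mul0r addr0.
  by congr (F _ - _); ring.
move=> t t01; have := difZ (b - a)^-1 (dif_comp (rdif_seg a b t) (H t t01)).
by apply: rdif_conv; field.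
Qed.

Lemma cseg_le f a b M : onseg (cnt id f) a b -> onseg (fun z => cabs (f z) <= M) a b ->
  cabs (cseg f a b) <= cabs (b - a) * M.
Proof.
move=> cf fM; rewrite /cseg cabsM ler_wpM2l ?cabs_ge0 // int01_le //.
exact: cnt_seg.
Qed.

Lemma csegB f g a b : onseg (cnt id f) a b -> onseg (cnt id g) a b ->
  cseg (fun z => f z - g z) a b = cseg f a b - cseg g a b.
Proof. by move=> cf cg; rewrite /cseg int01B ?mulrBr //; exact: cnt_seg. Qed.

Definition tri f a b c := cseg f a b + cseg f b c + cseg f c a.

(** Each side of the medial triangle is traversed twice, in opposite directions, and cancels. *)
Lemma tri_split f a b c (m1 := (a + b) / 2) (m2 := (b + c) / 2) (m3 := (c + a) / 2) :
  onseg (cnt id f) a b -> onseg (cnt id f) b c -> onseg (cnt id f) c a ->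
  onseg (cnt id f) m1 m2 -> onseg (cnt id f) m2 m3 -> onseg (cnt id f) m3 m1 ->
  tri f a b c = tri f a m1 m3 + tri f m1 b m2 + tri f m3 m2 c + tri f m2 m3 m1.
Proof.
move=> h1 h2 h3 h4 h5 h6; rewrite /tri (cseg_mid h1) (cseg_mid h2) (cseg_mid h3).
rewrite -/m1 -/m2 -/m3.
rewrite [cseg f m2 m1](cseg_sym h4) [cseg f m3 m2](cseg_sym h5) [cseg f m1 m3](cseg_sym h6).
ring.
Qed.

Definition cclosed (K : C -> Prop) :=
  forall z, (forall e : R, 0 < e -> exists2 k, K k & cabs (k - z) < e) -> K z.
Definition cconvex (K : C -> Prop) := forall a b, K a -> K b -> onseg K a b.

Lemma cauchy_R (u : nat -> R) :
  (forall e, 0 < e -> exists N, forall m n, (N <= m)%N -> (N <= n)%N -> `|u m - u n| <= e) ->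
  exists l, forall e, 0 < e -> exists N, forall n, (N <= n)%N -> `|u n - l| <= e.
Proof.
move=> H; have cu : cvgn u.
  apply/cauchy_cvgP/cauchy_exP => e e0.
  have [N hN] := H (e / 2) ltac:(lra).
  exists (u N); exists N => // n /= hn; rewrite /ball /=.
  by apply: le_lt_trans (hN N n (leqnn _) hn) _; lra.
exists (limn u) => e e0; have /cvgrPdist_le/(_ e e0) [N _ hN] := cu.
by exists N => n hn; rewrite distrC; exact: hN.
Qed.

Lemma cauchy_C (u : nat -> C) :
  (forall e, 0 < e -> exists N, forall m n, (N <= m)%N -> (N <= n)%N -> cabs (u m - u n) <= e) ->
  exists l, forall e, 0 < e -> exists N, forall n, (N <= n)%N -> cabs (u n - l) <= e.
Proof.
move=> H.
have [|x hx] := @cauchy_R (fun n => Re (u n)).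
  move=> e /H[N hN]; exists N => m n hm hn; rewrite -ReB.
  exact: le_trans (Re_le_cabs _) (hN m n hm hn).
have [|y hy] := @cauchy_R (fun n => Im (u n)).
  move=> e /H[N hN]; exists N => m n hm hn; rewrite -ImB.
  exact: le_trans (Im_le_cabs _) (hN m n hm hn).
exists (Complex x y) => e e0; have e20 : 0 < e / 2 by lra.
have [N hN] := hx _ e20; have [M hM] := hy _ e20; exists (maxn N M) => n.
rewrite geq_max => /andP[/hN hn /hM hm]; apply: le_trans (cabs_le_ReIm _) _.
by rewrite ReB ImB /=; lra.
Qed.

End Integral.

(** * Goursat's theorem and primitives on convex domains *)

Section Goursat.
Variable R : realType.
Local Notation C := (complex R).
Local Notation rc := (fun x : R => x%:C%C).
Implicit Types (f g : C -> C) (a b c : C) (U K : C -> Prop).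

Definition hol U f := forall z, U z -> exists l, dif id f z l.
Definition copen U := forall z, U z ->
  exists2 d : R, 0 < d & forall h, cabs h < d -> U (z + h).
(** Convexity in the form that Goursat's argument consumes: the nested triangles shrink to a limit
    point, which stays in U because the triangle lies in a closed convex subset. For a disc or a
    half plane this subset is a slightly smaller closed one. *)
Definition nice U := forall a b c, U a -> U b -> U c ->
  exists K, [/\ cclosed K, cconvex K, forall z, K z -> U z & [/\ K a, K b & K c]].

Lemma nice_seg U a b : nice U -> U a -> U b -> onseg U a b.
Proof.
move=> nU Ua Ub; have [K [_ cK KU [Ka Kb _]]] := nU _ _ _ Ua Ub Ub.
by move=> t t01; apply: KU; exact: cK.
Qed.

Lemma hol_cnt U f z : hol U f -> U z -> cnt id f z.
Proof. by move=> hf /hf[l]; exact: dif_cnt. Qed.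

Lemma onseg_sub U (P : C -> Prop) a b : (forall z, U z -> P z) ->
  onseg U a b -> onseg P a b.
Proof. by move=> UP H t /H /UP. Qed.

Lemma seg_mid a b : (a + b) / 2 = seg a b (2^-1).
Proof.
rewrite /seg; have -> : (2^-1 : R)%:C%C = 2^-1 :> C by rewrite fmorphV rmorph_nat.
by field.
Qed.

Lemma half01 : 0 <= (2^-1 : R) <= 1. Proof. lra. Qed.

Lemma seg_dist a b t : 0 <= t <= 1 -> cabs (seg a b t - a) <= cabs (b - a).
Proof.
move=> /andP[t0 t1]; rewrite /seg addrC addKr cabsM cabs_real ger0_norm //.
by rewrite ler_piMl // cabs_ge0.
Qed.

Lemma tri_affine (l m : C) a b c : tri (fun z => l + m * z) a b c = 0.
Proof.
have H z : dif id (fun z : C => l * z + m / 2 * z ^+ 2) z (l + m * z).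
  have := difD (difZ l (@dif_id R z)) (difZ (m / 2) (dif_pow 2 (@dif_id R z))).
  by apply: dif_conv; field.
rewrite /tri !(@cseg_prim R _ (fun z => l * z + m / 2 * z ^+ 2)) //.
by ring.
Qed.

Section Bisect.
Variables (K : C -> Prop) (f : C -> C).
Hypotheses (K_closed : cclosed K) (K_convex : cconvex K) (f_hol : hol K f).

Record tr := Tr { ta : C; tb : C; tc : C;
  ta_K : K ta; tb_K : K tb; tc_K : K tc }.

Let size (T : tr) : R := cabs (tb T - ta T) + cabs (tc T - ta T).
Let I (T : tr) : R := cabs (tri f (ta T) (tb T) (tc T)).

Let cntK a b : K a -> K b -> onseg (cnt id f) a b.
Proof.
move=> Ka Kb; apply: (@onseg_sub K); last exact: K_convex.
by move=> z; exact: hol_cnt.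
Qed.

Lemma bisect_step (T : tr) : exists T' : tr,
  [/\ size T' = size T / 2, cabs (ta T' - ta T) <= size T & I T / 4 <= I T'].
Proof.
case: T => a b c Ka Kb Kc; rewrite /size /I /=.
set m1 := (a + b) / 2; set m2 := (b + c) / 2; set m3 := (c + a) / 2.
have K1 : K m1 by rewrite /m1 seg_mid; apply: (K_convex Ka Kb); exact: half01.
have K2 : K m2 by rewrite /m2 seg_mid; apply: (K_convex Kb Kc); exact: half01.
have K3 : K m3 by rewrite /m3 seg_mid; apply: (K_convex Kc Ka); exact: half01.
have := @tri_split R f a b c (cntK Ka Kb) (cntK Kb Kc) (cntK Kc Ka)
  (cntK K1 K2) (cntK K2 K3) (cntK K3 K1).
rewrite -/m1 -/m2 -/m3 => E.
have c2 (z : C) : cabs (z / 2) = cabs z / 2 by rewrite cabsM cabsV cabs_nat.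
have s2 (z : C) : cabs (- (z / 2)) = cabs z / 2 by rewrite cabsN c2.
have p1 := cabs_ge0 (b - a); have p2 := cabs_ge0 (c - a).
set S := cabs (tri f a b c).
have [h1|h1] := leP (S / 4) (cabs (tri f a m1 m3)).
  exists (Tr Ka K1 K3); split=> //=; last by rewrite subrr cabs0 addr_ge0.
  have -> : m1 - a = (b - a) / 2 by rewrite /m1; field.
  have -> : m3 - a = (c - a) / 2 by rewrite /m3; field.
  by rewrite !c2; field.
have [h2|h2] := leP (S / 4) (cabs (tri f m1 b m2)).
  exists (Tr K1 Kb K2); split=> //=.
    have -> : b - m1 = (b - a) / 2 by rewrite /m1; field.
    have -> : m2 - m1 = (c - a) / 2 by rewrite /m1 /m2; field.
    by rewrite !c2; field.
  have -> : m1 - a = (b - a) / 2 by rewrite /m1; field.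
  by rewrite c2; lra.
have [h3|h3] := leP (S / 4) (cabs (tri f m3 m2 c)).
  exists (Tr K3 K2 Kc); split=> //=.
    have -> : m2 - m3 = (b - a) / 2 by rewrite /m2 /m3; field.
    have -> : c - m3 = (c - a) / 2 by rewrite /m3; field.
    by rewrite !c2; field.
  have -> : m3 - a = (c - a) / 2 by rewrite /m3; field.
  by rewrite c2; lra.
exists (Tr K2 K3 K1); split=> //=.
- have -> : m3 - m2 = - ((b - a) / 2) by rewrite /m2 /m3; field.
  have -> : m1 - m2 = - ((c - a) / 2) by rewrite /m1 /m2; field.
  by rewrite !s2; field.
- have -> : m2 - a = (b - a) / 2 + (c - a) / 2 by rewrite /m2; field.
  by apply: le_trans (cabsD _ _) _; rewrite !c2; lra.
- have : S <= cabs (tri f a m1 m3) + cabs (tri f m1 b m2) + cabs (tri f m3 m2 c)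
      + cabs (tri f m2 m3 m1).
    rewrite /S E; apply: le_trans (cabsD _ _) _; rewrite lerD2r.
    by apply: le_trans (cabsD _ _) _; rewrite lerD2r cabsD.
  lra.
Qed.

Lemma goursat a b c : K a -> K b -> K c -> tri f a b c = 0.
Proof.
move=> Ka Kb Kc; pose T0 := Tr Ka Kb Kc.
pose nxt T := sval (cid (bisect_step T)).
have nxtP T : [/\ size (nxt T) = size T / 2, cabs (ta (nxt T) - ta T) <= size T
    & I T / 4 <= I (nxt T)] by rewrite /nxt; case: cid.
pose T n := iter n nxt T0; pose D := size T0.
have D0 : 0 <= D by rewrite addr_ge0 // cabs_ge0.
have sT n : size (T n) = D / 2 ^+ n.
  elim: n => [|n IH]; first by rewrite expr0 divr1.
  by have [-> _ _] := nxtP (T n); rewrite IH exprS; field.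
have iT n : I T0 <= I (T n) * 4 ^+ n.
  elim: n => [|n IH]; first by rewrite expr0 mulr1.
  have [_ _ h] := nxtP (T n); apply: le_trans IH _.
  rewrite -/(T n.+1) in h.
  by rewrite exprS mulrA ler_wpM2r ?exprn_ge0 //; move: h; rewrite ler_pdivrMr.
have step n : cabs (ta (T n.+1) - ta (T n)) <= D / 2 ^+ n.
  by have [_ h _] := nxtP (T n); rewrite -sT.
(* The geometric sum of the steps D / 2 ^ n is kept in telescoping form, so that the induction on k
   closes. *)
have dist n k : cabs (ta (T (n + k)%N) - ta (T n)) <= 2 * D / 2 ^+ n - 2 * D / 2 ^+ (n + k).
  elim: k => [|k IH]; first by rewrite addn0 !subrr cabs0.
  apply: le_trans (cabs_dist (ta (T (n + k)%N)) _ _) _.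
  rewrite addnS; apply: le_trans (lerD (step _) IH) _.
  rewrite exprS; set q := 2 ^+ (n + k); have q0 : q != 0 by rewrite expf_neq0.
  have -> : 2 * D / (2 * q) = D / q by field.
  have -> : 2 * D / q = D / q + D / q by field.
  lra.
have dist' n k : cabs (ta (T (n + k)%N) - ta (T n)) <= 2 * D / 2 ^+ n.
  by apply: le_trans (dist n k) _; rewrite gerBl divr_ge0 ?exprn_ge0 // mulr_ge0.
have small e : 0 < e -> exists N, 2 * D / 2 ^+ N <= e.
  move=> e0; exists (Num.truncn (2 * D / e)).+1.
  have h : 2 * D / e < (Num.truncn (2 * D / e)).+1%:R by exact: truncnS_gt.
  set N := _.+1 in h *; rewrite ler_pdivrMr ?exprn_gt0 // [e * _]mulrC -ler_pdivrMr //.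
  apply: le_trans (ltW h) _; rewrite -natrX ler_nat; exact: ltnW (ltn_expl _ _).
have mono n k : 2 * D / 2 ^+ (n + k) <= 2 * D / 2 ^+ n :> R.
  rewrite ler_wpM2l ?mulr_ge0 // lef_pV2 ?posrE ?exprn_gt0 //.
  by rewrite ler_eXn2l ?ltr1n // leq_addr.
have [p hp] : exists p, forall e, 0 < e -> exists N, forall n, (N <= n)%N ->
    cabs (ta (T n) - p) <= e.
  apply: cauchy_C => e e0; have [N hN] := small (e / 2) ltac:(lra).
  exists N => m n /subnKC <- /subnKC <-; apply: le_trans (cabs_dist (ta (T N)) _ _) _.
  rewrite [X in _ + X]cabsB; have := dist' N (m - N)%N; have := dist' N (n - N)%N.
  lra.
have tp n : cabs (ta (T n) - p) <= 2 * D / 2 ^+ n.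
  apply/ler_addgt0Pr => e e0; have [N hN] := hp e e0.
  apply: le_trans (cabs_dist (ta (T (n + N)%N)) _ _) _.
  by rewrite addrC addrC; apply: lerD; [rewrite cabsB|apply: hN; rewrite leq_addl].
have Kp : K p.
  apply: K_closed => e e0; have [N hN] := hp (e / 2) ltac:(lra).
  by exists (ta (T N)); [exact: ta_K|apply: le_lt_trans (hN N (leqnn _)) _; lra].
have [l dl] := f_hol Kp.
apply/eqP; rewrite -cabs_eq0 eq_le cabs_ge0 andbT -/(I T0).
apply/ler_addgt0Pr => e e0; rewrite add0r.
(* The integral over the N-th triangle will be at most 8 e1 q^2 with q = D / 2 ^ N: perimeter at
   most 2 q, distance to p at most 4 q. Multiplied by 4 ^ N this is 8 D^2 e1; the + 1 covers D =
   0. *)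
pose e1 := e / (8 * D ^+ 2 + 1).
have D2 : 0 < 8 * D ^+ 2 + 1 by rewrite ltr_wpDl // mulr_ge0 // sqr_ge0.
have e10 : 0 < e1 by rewrite divr_gt0.
have [d d0 hd] := dl _ e10.
have [N hN] := small (d / 4) ltac:(lra).
apply: le_trans (iT N) _.
move: (sT N) (tp N) hN; case: (T N) => a' b' c' Ka' Kb' Kc'; rewrite /size /I /= => sN tN hN.
set q := D / 2 ^+ N in sN; have q0 : 0 <= q by rewrite divr_ge0 ?exprn_ge0.
have Eq : 2 * D / 2 ^+ N = 2 * q by rewrite /q mulrA.
rewrite Eq in tN hN.
(* The first-order expansion at p is affine, so its integral round the triangle vanishes and only
   the remainder f - g has to be estimated. *)
pose g z := f p + l * (z - p).
have tg : tri g a' b' c' = 0.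
  rewrite -[RHS](tri_affine (f p - l * p) l a' b' c').
  by rewrite /tri /cseg; congr (_ * _ + _ * _ + _ * _); apply: int01_ext => t;
    rewrite /g; ring.
have cg z : cnt id g z.
  apply: cntD; first exact: cnt_cst.
  by apply: cntM; [exact: cnt_cst|apply: cntB; [exact: cnt_id|exact: cnt_cst]].
have close u v : K u -> K v -> cabs (u - a') + cabs (v - u) <= 2 * q ->
    cabs (cseg f u v - cseg g u v) <= cabs (v - u) * (e1 * (4 * q)).
  move=> Ku Kv uv; rewrite -csegB; first last.
  - by move=> t _; exact: cg.
  - exact: cntK.
  apply: cseg_le => t t01.
    by apply: cntB; [exact: cntK|exact: cg].
  set z := seg u v t.
  have zp : cabs (z - p) <= 4 * q.
    apply: le_trans (cabs_dist u _ _) _; apply: le_trans (lerD (seg_dist _ _ t01) (cabs_dist a' _ _)) _.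
    lra.
  have := hd (z - p); rewrite [p + _]addrC subrK.
  rewrite /g opprD addrA => H; apply: le_trans (H _) _; first by lra.
  by rewrite ler_wpM2l // ltW.
have cb : cabs (c' - b') <= cabs (b' - a') + cabs (c' - a').
  by have := cabs_dist a' c' b'; rewrite [cabs (a' - b')]cabsB; lra.
have p1 := cabs_ge0 (b' - a'); have p2 := cabs_ge0 (c' - a').
have h1 := close a' b' Ka' Kb'; have h2 := close b' c' Kb' Kc'.
have h3 := close c' a' Kc' Ka'.
rewrite [cabs (a' - c')]cabsB subrr cabs0 in h1 h3.
have e4 : 0 <= e1 * (4 * q) := mulr_ge0 (ltW e10) (mulr_ge0 (ler0n _ 4) q0).
have -> : tri f a' b' c' = (cseg f a' b' - cseg g a' b') +
   (cseg f b' c' - cseg g b' c') + (cseg f c' a' - cseg g c' a').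
  by rewrite -[LHS]subr0 -tg /tri; ring.
have H : cabs ((cseg f a' b' - cseg g a' b') +
   (cseg f b' c' - cseg g b' c') + (cseg f c' a' - cseg g c' a')) <= 8 * e1 * q ^+ 2.
  apply: le_trans (cabsD _ _) _; apply: le_trans (lerD (cabsD _ _) (lexx _)) _.
  apply: le_trans (lerD (lerD (h1 _) (h2 _)) (h3 _)) _; try lra.
  have : (cabs (b' - a') + cabs (c' - b') + cabs (c' - a')) * (e1 * (4 * q)) <=
      (2 * q) * (e1 * (4 * q)) by apply: ler_wpM2r => //; lra.
  rewrite expr2; lra.
apply: le_trans (ler_wpM2r _ H) _; first by rewrite exprn_ge0.
have -> : 8 * e1 * q ^+ 2 * 4 ^+ N = 8 * D ^+ 2 * e1.
  have -> : 4 ^+ N = (2 ^+ N) ^+ 2 :> R.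
    by rewrite -exprM mulnC exprM; congr (_ ^+ _); ring.
  by rewrite /q; field; rewrite expf_neq0.
rewrite /e1 mulrA ler_pdivrMr // mulrC ler_wpM2l ?(ltW e0) //; lra.
Qed.

End Bisect.

Section Primitive.
Variables (U : C -> Prop) (f : C -> C).
Hypotheses (U_open : copen U) (U_nice : nice U).
Hypothesis f_cnt : forall z, U z -> cnt id f z.
Hypothesis f_tri : forall a b c, U a -> U b -> U c -> tri f a b c = 0.

Lemma tri_primitive p : U p -> forall z, U z -> dif id (cseg f p) z (f z).
Proof.
move=> Up z Uz e e0; have [d1 d10 h1] := U_open Uz.
have [d2 d20 h2] := f_cnt Uz e0.
exists (Num.min d1 d2) => [|h]; first by rewrite lt_min d10.
rewrite lt_min => /andP[hd1 hd2]; have Uzh := h1 _ hd1.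
have onU a b : U a -> U b -> onseg (cnt id f) a b.
  by move=> Ua Ub; apply: (@onseg_sub U) => //; exact: nice_seg.
have := f_tri Up Uz Uzh; rewrite /tri (cseg_sym (onU _ _ Up Uzh)) => E.
have -> : cseg f p (z + h) - cseg f p z - f z * h =
    cseg f z (z + h) - cseg (fun=> f z) z (z + h).
  rewrite (@cseg_prim R (fun=> f z) (fun x => f z * x)); last first.
    by move=> t _; have := difZ (f z) (@dif_id R (seg z (z + h) t)); rewrite mulr1.
  have -> : cseg f p (z + h) = cseg f p z + cseg f z (z + h).
    by apply/eqP; rewrite -subr_eq0 -oppr_eq0 -E; apply/eqP; ring.
  by ring.
rewrite -csegB; first last.
- by move=> t _; exact: cnt_cst.
- exact: onU.
rewrite mulrC; have {2}-> : h = z + h - z by ring.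
apply: cseg_le => t t01.
  by apply: cntB; [exact: onU|exact: cnt_cst].
have := h2 (seg z (z + h) t - z); rewrite [z + (_ - _)]addrC subrK; apply.
by apply: le_lt_trans (seg_dist _ _ t01) _; rewrite [z + h]addrC addrK.
Qed.

End Primitive.

Lemma hol_tri U f a b c : nice U -> hol U f -> U a -> U b -> U c -> tri f a b c = 0.
Proof.
move=> nU hf Ua Ub Uc; have [K [Kcl Kcv KU [Ka Kb Kc]]] := nU _ _ _ Ua Ub Uc.
by apply: (@goursat K) => // z /KU; exact: hf.
Qed.

Lemma hol_primitive U f p : copen U -> nice U -> hol U f -> U p ->
  forall z, U z -> dif id (cseg f p) z (f z).
Proof.
move=> oU nU hf Up z Uz; apply: (@tri_primitive U) => //.
  by move=> x; exact: hol_cnt.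
by move=> a b c; exact: hol_tri.
Qed.

Definition cdisc (p : C) (r : R) (z : C) := cabs (z - p) < r.
Definition rhalf (x : R) (z : C) := x < Re z.
Definition uhalf (y : R) (z : C) := y < Im z.

Lemma copen_disc p r : copen (cdisc p r).
Proof.
move=> z zr; exists (r - cabs (z - p)) => [|h hh]; first by rewrite subr_gt0.
rewrite /cdisc addrAC; apply: le_lt_trans (cabsD _ _) _; lra.
Qed.
Lemma copen_rhalf x : copen (rhalf x).
Proof.
move=> z zr; exists (Re z - x) => [|h hh]; first by rewrite subr_gt0.
rewrite /rhalf ReD; have := Re_le_cabs h; rewrite ler_norml => /andP[]; lra.
Qed.
Lemma copen_uhalf x : copen (uhalf x).
Proof.
move=> z zr; exists (Im z - x) => [|h hh]; first by rewrite subr_gt0.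
rewrite /uhalf ImD; have := Im_le_cabs h; rewrite ler_norml => /andP[]; lra.
Qed.
Lemma copenI U V : copen U -> copen V -> copen (fun z => U z /\ V z).
Proof.
move=> oU oV z [/oU[d d0 h] /oV[d' d'0 h']]; exists (Num.min d d') => [|k].
  by rewrite lt_min d0.
by rewrite lt_min => /andP[/h ? /h' ?].
Qed.

Lemma niceI U V : nice U -> nice V -> nice (fun z => U z /\ V z).
Proof.
move=> nU nV a b c [Ua Va] [Ub Vb] [Uc Vc].
have [K [h1 h2 h3 [h4 h5 h6]]] := nU _ _ _ Ua Ub Uc.
have [L [l1 l2 l3 [l4 l5 l6]]] := nV _ _ _ Va Vb Vc.
exists (fun z => K z /\ L z); split=> //.
- move=> z H; split; [apply: h1|apply: l1] => e /H[k [? ?] ?]; by exists k.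
- by move=> x y [? ?] [? ?] t t01; split; [apply: h2|apply: l2].
- by move=> z [/h3 ? /l3 ?].
Qed.

Lemma nice_disc p r : nice (cdisc p r).
Proof.
move=> a b c Ha Hb Hc.
pose m := Num.max (cabs (a - p)) (Num.max (cabs (b - p)) (cabs (c - p))).
have mr : m < r by rewrite !gt_max; apply/and3P; split.
exists (fun z => cabs (z - p) <= m); split.
- move=> z H; apply/ler_addgt0Pr => e /H[k km kz].
  by apply: le_trans (cabs_dist k _ _) _; rewrite cabsB; lra.
- move=> x y hx hy t /andP[t0 t1].
  have -> : seg x y t - p = (1 - t)%:C%C * (x - p) + t%:C%C * (y - p).
    by rewrite /seg rmorphB /=; ring.
  apply: le_trans (cabsD _ _) _; rewrite !cabsM !cabs_real !ger0_norm ?subr_ge0 //.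
  nra.
- by move=> z zm; apply: le_lt_trans zm mr.
- by rewrite !le_max !lexx !orbT.
Qed.

Lemma nice_rhalf x : nice (rhalf x).
Proof.
move=> a b c Ha Hb Hc.
pose m := Num.min (Re a) (Num.min (Re b) (Re c)).
have mr : x < m by rewrite !lt_min; apply/and3P; split.
exists (fun z => m <= Re z); split.
- move=> z H; apply/ler_addgt0Pr => e /H[k km kz].
  have := Re_le_cabs (k - z); rewrite ler_norml ReB => /andP[]; lra.
- move=> u v hu hv t /andP[t0 t1].
  rewrite /seg ReD ReRM ReB; nra.
- by move=> z zm; exact: lt_le_trans mr zm.
- by rewrite !ge_min !lexx !orbT.
Qed.

End Goursat.

(** * Cauchy's integral formula *)

Section Cauchy.
Variable R : realType.
Local Notation C := (complex R).
Local Notation rc := (fun x : R => x%:C%C).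
Implicit Types (f g : C -> C) (phi : R -> C) (p z : C) (U : C -> Prop).

(** Compactness of [0, 1] merges local constants into one; since P is stable under decreasing d, the
    smallest of finitely many d serves everywhere. *)
Lemma unif01 (P : R -> R -> Prop) :
  (forall t d d', d' <= d -> P t d -> P t d') ->
  (forall t0, 0 <= t0 <= 1 -> exists del d, [/\ 0 < del, 0 < d &
     forall t, `|t - t0| < del -> P t d]) ->
  exists2 d, 0 < d & forall t, 0 <= t <= 1 -> P t d.
Proof.
move=> mono loc.
have /compact_near_coveringP K : compact `[(0:R), 1]%classic by exact: segment_compact.
have := K R ((0:R)^'+) (fun d t => P t d) _.
case=> [t0|d d0 H].
  move=> HH; have {HH} : t0 \in `[0, 1]%R := HH; rewrite in_itv /= => /loc[del [d [del0 d0 H]]].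
  exists (ball t0 del, [set x | 0 < x < d]); first split.
  - exact: nbhsx_ballx.
  - by near=> x => /=; apply/andP; split.
  - move=> [t x] [/= tb /andP[x0 xd]]; apply: mono (ltW xd) (H _ _).
    by rewrite distrC.
exists (d / 2) => [|t t01]; first by rewrite divr_gt0.
apply: (H (d / 2)) => //=.
  by rewrite sub0r normrN gtr0_norm ?divr_gt0 //; move: d0 => /=; lra.
by rewrite divr_gt0.
Unshelve. all: by end_near. Qed.

Lemma unif_cnt_curve f (x : R -> C) :
  (forall t, 0 <= t <= 1 -> cnt rc x t) ->
  (forall t, 0 <= t <= 1 -> cnt id f (x t)) ->
  forall e, 0 < e -> exists2 d, 0 < d & forall t, 0 <= t <= 1 ->
    forall k, cabs k < d -> cabs (f (x t + k) - f (x t)) <= e.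
Proof.
move=> cx cf e e0.
have [||d d0 H] := @unif01 (fun t d => 0 <= t <= 1 ->
  forall k, cabs k < d -> cabs (f (x t + k) - f (x t)) <= e).
- by move=> t d d' dd' H t01 k kd; apply: H => //; exact: lt_le_trans kd dd'.
- move=> t0 t01; have [d d0 hd] := cf _ t01 (e / 2) ltac:(lra).
  have [del del0 hdel] := cx _ t01 (d / 3) ltac:(lra).
  exists del, (d / 2); split; [by []|lra|] => t tt _ k kd.
  have := hdel (t - t0); rewrite cabs_real [t0 + _]addrC subrK => /(_ tt) xt.
  have h1 := hd (x t - x t0 + k); have h2 := hd (x t - x t0).
  rewrite addrA [x t0 + _]addrC subrK in h1; rewrite [x t0 + _]addrC subrK in h2.
  apply: le_trans (cabs_dist (f (x t0)) _ _) _; rewrite [X in _ + X]cabsB.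
  have H1 : cabs (f (x t + k) - f (x t0)) <= e / 2.
    by apply: h1; apply: le_lt_trans (cabsD _ _) _; lra.
  have H2 : cabs (f (x t) - f (x t0)) <= e / 2 by apply: h2; lra.
  lra.
- by exists d => // t t01; exact: H.
Qed.

(** Differentiation under the integral sign. The remainder estimate is uniform in t and therefore
    survives integration; it is later supplied by explicit kernels or by [unif_cnt_curve]. *)
Lemma dif_int (T : zmodType) (i : T -> C) (G : T -> R -> C) (g : R -> C) (s : T) :
  (forall t, 0 <= t <= 1 -> cnt rc g t) ->
  (exists2 d, 0 < d & forall h, cabs (i h) < d -> forall t, 0 <= t <= 1 ->
     cnt rc (G (s + h)) t) -> i 0 = 0 ->
  (forall e, 0 < e -> exists2 d, 0 < d & forall h, cabs (i h) < d ->
    forall t, 0 <= t <= 1 -> cabs (G (s + h) t - G s t - g t * i h) <= e * cabs (i h)) ->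
  dif i (fun s => int01 (G s)) s (int01 g).
Proof.
move=> cg [d1 d10 cG] i0 H e /H[d d0 hd]; exists (Num.min d d1) => [|h].
  by rewrite lt_min d0.
rewrite lt_min => /andP[/hd Hh hd1].
have cGs t : 0 <= t <= 1 -> cnt rc (G s) t.
  by move=> t01; have := cG 0; rewrite i0 cabs0 addr0; apply.
have cgh t : 0 <= t <= 1 -> cnt rc (fun t => i h * g t) t.
  by move=> t01; apply: cntM; [exact: cnt_cst|exact: cg].
rewrite [int01 g * _]mulrC -int01Z // -int01B //; last by move=> t; exact: cG.
rewrite -int01B //; last by move=> t t01; apply: cntB; [exact: cG|exact: cGs].
apply: int01_le => [t t01|t t01].
  by apply: cntB; [apply: cntB; [exact: cG|exact: cGs]|exact: cgh].
by rewrite [i h * _]mulrC; exact: Hh.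
Qed.

(** 2 pi i: a circle is traversed once as t runs from 0 to 1. *)
Definition omega : C := Complex 0 (2 * pi).
Definition ecirc (t : R) : C := cexp (t%:C%C * omega).
Definition wcirc (p : C) (r : R) (t : R) : C := p + r%:C%C * ecirc t.
Definition dcirc (r : R) (t : R) : C := omega * (r%:C%C * ecirc t).

Lemma omega_neq0 : omega != 0.
Proof. by apply/eqP => -[/eqP]; rewrite mulf_eq0 pnatr_eq0 /= gt_eqF // pi_gt0. Qed.

Lemma cabs_ecirc t : cabs (ecirc t) = 1.
Proof. by rewrite cabs_cexp ReRM /= mulr0 expR0. Qed.

Lemma ecirc1 : ecirc 1 = ecirc 0.
Proof.
rewrite /ecirc mul1r mul0r cexp0 /cexp /omega /= expR0 !mul1r.
have -> : 2 * pi = pi *+ 2 :> R by rewrite mulr_natl.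
by rewrite cos2pi sin2pi.
Qed.

Lemma wcirc1 p r : wcirc p r 1 = wcirc p r 0. Proof. by rewrite /wcirc ecirc1. Qed.

Lemma rdif_wcirc p r t : dif rc (wcirc p r) t (dcirc r t).
Proof.
have := difD (dif_cst rc p t) (difZ r%:C%C (rdif_cexp_lin omega t)).
by apply: rdif_conv; rewrite add0r /dcirc /ecirc; ring.
Qed.

Lemma cnt_wcirc p r t : cnt rc (wcirc p r) t.
Proof. exact: dif_cnt (rdif_wcirc p r t). Qed.

Lemma cnt_dcirc r t : cnt rc (dcirc r) t.
Proof.
apply: cntM; first exact: cnt_cst; apply: cntM; first exact: cnt_cst.
exact: dif_cnt (rdif_cexp_lin omega t).
Qed.

Lemma cabs_wcirc p r t : 0 <= r -> cabs (wcirc p r t - p) = r.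
Proof. by move=> r0; rewrite /wcirc addrC addKr cabsM cabs_ecirc mulr1 cabs_real ger0_norm. Qed.

Lemma cabs_dcirc r t : 0 <= r -> cabs (dcirc r t) = 2 * pi * r.
Proof.
move=> r0; rewrite /dcirc !cabsM cabs_ecirc mulr1 cabs_real (ger0_norm r0).
have -> : omega = Complex 0 1 * (2 * pi)%:C%C by apply: complex_eq; rewrite ?(ReM, ImM) /=; ring.
by rewrite cabsM cabs_i mul1r cabs_real ger0_norm // mulr_ge0 // pi_ge0.
Qed.

Section OnCircle.
Variables (p : C) (r : R).
Hypothesis r0 : 0 < r.
Local Notation w := (wcirc p r).

Lemma circ_far z t : cdisc p r z -> r - cabs (z - p) <= cabs (w t - z).
Proof.
by move=> _; have := cabs_dist z (w t) p; rewrite cabs_wcirc ?(ltW r0) //; lra.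
Qed.

Lemma circ_neq z t : cdisc p r z -> w t - z != 0.
Proof.
move=> zr; rewrite -cabs_gt0; apply: lt_le_trans (circ_far t zr).
by rewrite subr_gt0.
Qed.

(** The Cauchy transform of order n. The factor dw belongs to [phi], where it appears as [dcirc]. *)
Definition ctrans (n : nat) phi z := int01 (fun t => phi t / (w t - z) ^+ n).

Lemma cnt_kernel n phi z : cdisc p r z ->
  (forall t, 0 <= t <= 1 -> cnt rc phi t) ->
  forall t, 0 <= t <= 1 -> cnt rc (fun t => phi t / (w t - z) ^+ n) t.
Proof.
move=> zr cphi t t01; apply: cntM; first exact: cphi.
apply: cntV; first by rewrite expf_neq0 // circ_neq.
apply: (dif_cnt (dif_pow n (difB (rdif_wcirc p r t) (dif_cst rc z t)))).
Qed.

Lemma phi_bound phi : (forall t, 0 <= t <= 1 -> cnt rc phi t) ->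
  exists2 M, 0 <= M & forall t, 0 <= t <= 1 -> cabs (phi t) <= M.
Proof.
move=> cphi.
(* The bound is encoded as 1 / d, so that decreasing d weakens the claim; the alternative d <= 0
   keeps the predicate monotone for all real d. *)
have [||d d0 H] := @unif01 (fun t d => 0 <= t <= 1 -> cabs (phi t) <= d^-1 /\ 0 < d \/ d <= 0).
- move=> t d d' dd' H /H[[H1 H2]|H1]; last by right; exact: le_trans dd' H1.
  case: (ltP 0 d') => d'0; [left|by right]; split=> //.
  by apply: le_trans H1 _; rewrite lef_pV2.
- move=> t0 t01; have [d d0 hd] := cphi _ t01 1 ltr01.
  exists d, (1 + cabs (phi t0))^-1.
  have k0 : 0 < 1 + cabs (phi t0) by rewrite ltr_pwDl // cabs_ge0.
  split; [by []|by rewrite invr_gt0|] => t tt _; left; rewrite invrK invr_gt0; split=> //.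
  have := hd (t - t0); rewrite cabs_real [t0 + _]addrC subrK => /(_ tt).
  have := cabs_rtriB (phi t) (phi t0); lra.
- exists d^-1; first by rewrite invr_ge0 ltW.
  by move=> t t01; case: (H t t01 t01) => [[]//|]; rewrite leNgt d0.
Qed.

Lemma dif_ctrans1 phi z : cdisc p r z -> (forall t, 0 <= t <= 1 -> cnt rc phi t) ->
  dif id (ctrans 1 phi) z (ctrans 2 phi z).
Proof.
move=> zr cphi; have [M M0 hM] := phi_bound cphi.
set m := r - cabs (z - p); have m0 : 0 < m by rewrite subr_gt0.
apply: dif_int => //.
- exact: cnt_kernel.
- by have [d d0 hd] := copen_disc zr; exists d => // h /hd zh; exact: cnt_kernel.
(* The remainder is at most k |h|^2, because |w t - z| >= m and |w t - z - h| >= m / 2 once |h| < m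
   / 2. *)
move=> e e0; pose k := M * 2 / m ^+ 3 + 1.
have k0 : 0 < k by rewrite ltr_wpDl // divr_ge0 ?exprn_ge0 ?mulr_ge0 // ltW.
exists (Num.min (m / 2) (e / k)) => [|h]; first by rewrite lt_min !divr_gt0.
rewrite lt_min => /andP[h1]; rewrite ltr_pdivlMr // => h2 t t01.
have a0 := circ_neq t zr; have := circ_far t zr; rewrite -/m => am.
have ah : m / 2 <= cabs (w t - z - h) by have := cabs_rtriB (w t - z) h; lra.
have ah0 : w t - z - h != 0 by rewrite -cabs_gt0; lra.
have E : phi t / (w t - (z + h)) ^+ 1 - phi t / (w t - z) ^+ 1 - phi t / (w t - z) ^+ 2 * h
   = phi t * (h ^+ 2 / ((w t - z) ^+ 2 * (w t - z - h))).
  have -> : w t - (z + h) = w t - z - h by ring.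
  by rewrite !expr1; field; rewrite ?a0 ?ah0.
rewrite E cabsM [cabs (h ^+ 2 / _)]cabsM cabsV [cabs (_ ^+ 2 * _)]cabsM !cabsX.
have D : m ^+ 3 / 2 <= cabs (w t - z) ^+ 2 * cabs (w t - z - h).
  have -> : m ^+ 3 / 2 = m ^+ 2 * (m / 2) by field.
  by apply: ler_pM => //; rewrite ?exprn_ge0 ?divr_ge0 ?(ltW m0) // lerXn2r ?nnegrE ?cabs_ge0 ?(ltW m0).
have m3 : 0 < m ^+ 3 / 2 by rewrite divr_gt0 // exprn_gt0.
apply: (@le_trans _ _ (M * (cabs h ^+ 2 / (m ^+ 3 / 2)))).
  apply: ler_pM => //; rewrite ?cabs_ge0 ?divr_ge0 ?exprn_ge0 ?cabs_ge0 ?mulr_ge0 ?exprn_ge0 ?cabs_ge0 ?hM //.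
  rewrite ler_wpM2l ?exprn_ge0 ?cabs_ge0 // lef_pV2 // posrE //.
  exact: lt_le_trans m3 D.
have -> : M * (cabs h ^+ 2 / (m ^+ 3 / 2)) = (M * 2 / m ^+ 3) * cabs h * cabs h.
  by field; rewrite gt_eqF.
rewrite ler_wpM2r ?cabs_ge0 //; apply: le_trans _ (ltW h2); rewrite mulrC.
by rewrite ler_wpM2l ?cabs_ge0 // /k lerDl.
Qed.

Lemma dif_ctrans2 phi z : cdisc p r z -> (forall t, 0 <= t <= 1 -> cnt rc phi t) ->
  dif id (ctrans 2 phi) z (2 * ctrans 3 phi z).
Proof.
move=> zr cphi; have [M M0 hM] := phi_bound cphi.
set m := r - cabs (z - p); have m0 : 0 < m by rewrite subr_gt0.
rewrite /ctrans -int01Z; last exact: cnt_kernel.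
apply: dif_int => //.
- by move=> t t01; apply: cntM; [exact: cnt_cst|exact: cnt_kernel].
- by have [d d0 hd] := copen_disc zr; exists d => // h /hd zh; exact: cnt_kernel.
move=> e e0; pose k := M * 16 / m ^+ 4 + 1.
have k0 : 0 < k by rewrite ltr_wpDl // divr_ge0 ?exprn_ge0 ?mulr_ge0 // ltW.
exists (Num.min (m / 2) (e / k)) => [|h]; first by rewrite lt_min !divr_gt0.
rewrite lt_min => /andP[h1]; rewrite ltr_pdivlMr // => h2 t t01.
have a0 := circ_neq t zr; have := circ_far t zr; rewrite -/m => am.
set a := w t - z in a0 am *.
have ah : cabs a / 2 <= cabs (a - h) by have := cabs_rtriB a h; lra.
have ah0 : a - h != 0 by rewrite -cabs_gt0; lra.
have E : phi t / (w t - (z + h)) ^+ 2 - phi t / a ^+ 2 - 2 * (phi t / a ^+ 3) * h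
   = phi t * (h ^+ 2 * (3 * a - 2 * h) / (a ^+ 3 * (a - h) ^+ 2)).
  have -> : w t - (z + h) = a - h by rewrite /a; ring.
  by field; rewrite ?a0 ?ah0.
rewrite E cabsM [cabs (h ^+ 2 * _ / _)]cabsM cabsV [cabs (h ^+ 2 * _)]cabsM
  [cabs (a ^+ 3 * _)]cabsM !cabsX.
set A := cabs a in am ah *; set B := cabs (a - h) in ah *.
have n3 : cabs (3 * a - 2 * h) <= 4 * A.
  by apply: le_trans (cabs_triB _ _) _; rewrite !cabsM !cabs_nat -/A; lra.
have A0 : 0 < A by lra.
have D : A ^+ 5 / 4 <= A ^+ 3 * B ^+ 2.
  have -> : A ^+ 5 / 4 = A ^+ 3 * (A / 2) ^+ 2 by field.
  by rewrite ler_wpM2l ?exprn_ge0 ?(ltW A0) // lerXn2r ?nnegrE ?cabs_ge0 // divr_ge0 ?ltW.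
have A5 : 0 < A ^+ 5 / 4 by rewrite divr_gt0 // exprn_gt0.
have H : cabs h ^+ 2 * cabs (3 * a - 2 * h) / (A ^+ 3 * B ^+ 2) <=
    cabs h ^+ 2 * (4 * A) / (A ^+ 5 / 4).
  apply: ler_pM; rewrite ?invr_ge0 ?mulr_ge0 ?exprn_ge0 ?cabs_ge0 //.
    by rewrite ler_wpM2l // exprn_ge0 // cabs_ge0.
  by rewrite lef_pV2 // posrE //; exact: lt_le_trans A5 D.
have E2 : cabs h ^+ 2 * (4 * A) / (A ^+ 5 / 4) = cabs h ^+ 2 * 16 / A ^+ 4.
  by field; rewrite gt_eqF.
have H2 : cabs h ^+ 2 * 16 / A ^+ 4 <= cabs h ^+ 2 * 16 / m ^+ 4.
  rewrite ler_wpM2l ?mulr_ge0 ?exprn_ge0 ?cabs_ge0 // lef_pV2 ?posrE ?exprn_gt0 //.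
  by rewrite lerXn2r ?nnegrE // ltW.
apply: (@le_trans _ _ (M * (cabs h ^+ 2 * 16 / m ^+ 4))).
  apply: ler_pM; rewrite ?cabs_ge0 ?hM //.
    by rewrite divr_ge0 ?mulr_ge0 ?exprn_ge0 ?cabs_ge0.
  by apply: le_trans H _; rewrite E2.
have -> : M * (cabs h ^+ 2 * 16 / m ^+ 4) = (M * 16 / m ^+ 4) * cabs h * cabs h.
  by field; rewrite gt_eqF.
rewrite ler_wpM2r ?cabs_ge0 //; apply: le_trans _ (ltW h2); rewrite mulrC.
by rewrite ler_wpM2l ?cabs_ge0 // /k lerDl.
Qed.

Lemma ctrans_dcirc2 z : cdisc p r z -> ctrans 2 (dcirc r) z = 0.
Proof.
move=> zr; rewrite /ctrans (@int01E R _ (fun t => - (w t - z)^-1)).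
  by rewrite wcirc1 subrr.
move=> t t01; have a0 := circ_neq t zr.
have := difN (dif_comp (difB (rdif_wcirc p r t) (dif_cst rc z t)) (dif_inv a0)).
by apply: rdif_conv; field.
Qed.

(** The winding number is constant in z: its derivative integrates an exact form over a closed
    curve. At the centre the integrand is the constant 2 pi i. *)
Lemma ctrans_dcirc z : cdisc p r z -> ctrans 1 (dcirc r) z = omega.
Proof.
move=> zr.
have pr : cdisc p r p by rewrite /cdisc subrr cabs0.
have -> : omega = ctrans 1 (dcirc r) p.
  rewrite /ctrans (@int01_ext _ _ (fun=> omega)) ?int01_cst // => t.
  have /= a0 := circ_neq t pr.
  have E : w t - p = r%:C%C * ecirc t by rewrite /wcirc addrC addKr.
  by rewrite expr1 E /dcirc mulfK // -E.
have inD t : 0 <= t <= 1 -> cdisc p r (seg p z t).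
  by move=> t01; apply: le_lt_trans (seg_dist _ _ t01) zr.
have H t : 0 <= t <= 1 -> dif rc (fun t => ctrans 1 (dcirc r) (seg p z t)) t 0.
  move=> t01; have cphi (s : R) (_ : 0 <= s <= 1) := cnt_dcirc r s.
  have := dif_comp (rdif_seg p z t) (dif_ctrans1 (inD t t01) cphi).
  by apply: rdif_conv; rewrite ctrans_dcirc2 ?mul0r //; exact: inD.
have := curve_const ler01 H.
rewrite /seg mul1r mul0r addr0 [p + _]addrC subrK //.
Qed.

End OnCircle.

Section Formula.
Variables (p : C) (r r1 : R).
Hypotheses (r0 : 0 < r) (rr1 : r < r1).
Local Notation w := (wcirc p r).

Let w_in t : cdisc p r1 (w t).
Proof. by rewrite /cdisc cabs_wcirc // ltW. Qed.

Let seg_in z t s : cdisc p r z -> 0 <= s <= 1 -> cdisc p r1 (seg z (w t) s).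
Proof.
move=> zr s01; apply: (nice_seg (@nice_disc R p r1)) => //.
exact: lt_trans zr rr1.
Qed.

(** The circle is contracted to z along the segments [x s t]. The integral of F (x s t) dw / (w - z)
    does not depend on s; at s = 1 it is the Cauchy integral and at s = 0 it is F z times the
    winding integral. Continuity of the derivative f justifies differentiating in s. *)
Lemma cauchy_C1 (F f : C -> C) z :
  (forall x, cdisc p r1 x -> dif id F x (f x)) ->
  (forall x, cdisc p r1 x -> cnt id f x) -> cdisc p r z ->
  ctrans p r 1 (fun t => F (w t) * dcirc r t) z = omega * F z.
Proof.
move=> dF cf zr.
pose x s t := seg z (w t) s.
have dx s t : dif rc (x s) t (s%:C%C * dcirc r t).
  have := difD (dif_cst rc z t) (difZ s%:C%C (difB (rdif_wcirc p r t) (dif_cst rc z t))).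
  by apply: rdif_conv; rewrite add0r subr0.
have cx s t : cnt rc (x s) t := dif_cnt (dx s t).
pose G s t := F (x s t) * (dcirc r t / (w t - z)).
have cker t : cnt rc (fun t => dcirc r t / (w t - z)) t.
  apply: cntM; first exact: cnt_dcirc.
  apply: cntV; first exact: circ_neq.
  by apply: cntB; [exact: cnt_wcirc|exact: cnt_cst].
have cG s t : 0 <= s <= 1 -> cnt rc (G s) t.
  move=> s01; apply: cntM => //; apply: cnt_comp => //.
  exact: dif_cnt (dF _ (seg_in t zr s01)).
have J0 : int01 (G 0) = omega * F z.
  rewrite (@int01_ext _ _ (fun t => F z * (dcirc r t / (w t - z) ^+ 1))).
    rewrite int01Z; last by move=> t t01; rewrite /=; exact: (cker t).
    by rewrite -/(ctrans p r 1 (dcirc r) z) ctrans_dcirc // mulrC.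
  by move=> t; rewrite /G /x /seg mul0r addr0.
have J1 : int01 (G 1) = ctrans p r 1 (fun t => F (w t) * dcirc r t) z.
  apply: int01_ext => t; rewrite /G /x /seg mul1r [z + _]addrC subrK.
  by rewrite mulrA.
rewrite -J1 -J0.
(* This is the derivative in s: the factor w t - z from the chain rule cancels the kernel, and for s
   != 0 the rest is 1 / s times the derivative of F along the closed curve [x s]. *)
have zero s : 0 <= s <= 1 -> int01 (fun t => f (x s t) * dcirc r t) = 0.
  move=> s01; have [->|s0] := eqVneq s 0.
    rewrite (@int01E R _ (fun t => f z * w t)); first by rewrite wcirc1 subrr.
    move=> t t01; have := difZ (f z) (rdif_wcirc p r t).
    by apply: rdif_conv; rewrite /x /seg mul0r addr0.
  have s0' : s%:C%C != 0 :> C by rewrite fmorph_eq0.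
  rewrite (@int01E R _ (fun t => s%:C%C^-1 * F (x s t))).
    by rewrite /x wcirc1 subrr.
  move=> t t01; have := difZ s%:C%C^-1 (dif_comp (dx s t) (dF _ (seg_in t zr s01))).
  by apply: rdif_conv; rewrite /x; field.
have u2 t : cabs (w t - z) <= 2 * r.
  apply: le_trans (cabs_dist p _ _) _; rewrite cabs_wcirc ?(ltW r0) // [cabs (p - z)]cabsB.
  by rewrite /cdisc in zr; lra.
have r20 : 0 < 2 * r by rewrite mulr_gt0.
pose eta := (r1 - r) / (2 * r); have eta0 : 0 < eta by rewrite divr_gt0 ?subr_gt0.
have etaE : eta * (2 * r) = r1 - r by rewrite /eta; field; rewrite gt_eqF.
have near_in s h t : 0 <= s <= 1 -> `|h| < eta -> cdisc p r1 (x (s + h) t).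
  move=> /andP[s0 s1] hh; rewrite /cdisc.
  have -> : x (s + h) t - p = (x s t - p) + h%:C%C * (w t - z).
    by rewrite /x /seg rmorphD /=; ring.
  apply: le_lt_trans (cabsD _ _) _.
  have xs : cabs (x s t - p) <= r.
    have -> : x s t - p = (1 - s)%:C%C * (z - p) + s%:C%C * (w t - p).
      by rewrite /x /seg rmorphB /=; ring.
    apply: le_trans (cabsD _ _) _; rewrite !cabsM !cabs_real !ger0_norm ?subr_ge0 //.
    have s1' : 0 <= 1 - s by lra.
    have := ler_wpM2l s1' (ltW zr); rewrite cabs_wcirc ?(ltW r0) //; lra.
  rewrite cabsM cabs_real.
  have : `|h| * cabs (w t - z) < eta * (2 * r).
    apply: le_lt_trans (ler_wpM2l _ (u2 t)) _ => //.
    by rewrite ltr_pM2r.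
  rewrite etaE; lra.
have H s : 0 <= s <= 1 -> dif rc (fun s => int01 (G s)) s 0.
  move=> s01; rewrite -(zero s s01).
  have cfx t : cnt rc (fun t => f (x s t)) t.
    by apply: cnt_comp => //; exact: cf (seg_in t zr s01).
  apply: dif_int => //.
  - by move=> t t01; apply: cntM => //; exact: cnt_dcirc.
  - exists eta => // h; rewrite cabs_real => hh t t01; apply: cntM => //.
    apply: cnt_comp => //; apply: dif_cnt (dF _ _); exact: near_in.
  move=> e e0; pose e1 := e / (2 * pi * r).
  have pr0 : 0 < 2 * pi * r by rewrite !mulr_gt0 // pi_gt0.
  have e10 : 0 < e1 by rewrite divr_gt0.
  have [||d d0 hd] := @unif_cnt_curve f (x s) _ _ e1 e10.
  - by [].
  - by move=> t t01; exact: cf (seg_in t zr s01).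
  exists (Num.min eta (d / (2 * r))) => [|h]; first by rewrite lt_min eta0 divr_gt0.
  rewrite cabs_real lt_min => /andP[h1 h2] t t01.
  set u := w t - z; have u0 : u != 0 by exact: circ_neq.
  have xsh (k : R) : x (s + k) t = x s t + k%:C%C * u.
    by rewrite /x /seg rmorphD /= /u; ring.
  rewrite /G -/u xsh.
  have -> : F (x s t + h%:C%C * u) * (dcirc r t / u) - F (x s t) * (dcirc r t / u) -
      f (x s t) * dcirc r t * h%:C%C =
    (F (x s t + h%:C%C * u) - F (x s t) - f (x s t) * (h%:C%C * u)) * (dcirc r t / u).
    by field.
  rewrite cabsM [cabs (dcirc r t / u)]cabsM cabsV cabs_dcirc ?(ltW r0) //.
  have hu : cabs (h%:C%C * u) < d.
    rewrite cabsM cabs_real; apply: le_lt_trans (ler_wpM2l _ (u2 t)) _ => //.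
    by rewrite -ltr_pdivlMr.
  suff K : cabs (F (x s t + h%:C%C * u) - F (x s t) - f (x s t) * (h%:C%C * u)) <=
      (e1 * (`|h| * cabs u)).
    apply: le_trans (ler_wpM2r _ K) _; first by rewrite divr_ge0 ?cabs_ge0 ?(ltW pr0).
    have cu0 : cabs u != 0 by rewrite cabs_eq0.
    rewrite /e1 le_eqVlt; apply/orP; left; apply/eqP.
    by move: (2 * pi * r) pr0 => P P0; field; rewrite cu0 gt_eqF.
  set v := h%:C%C * u.
  have dg y : 0 <= y <= 1 -> dif rc (fun y : R => F (x s t + y%:C%C * v) - f (x s t) * (y%:C%C * v)) y
     (v * (f (x s t + y%:C%C * v) - f (x s t))).
    move=> /andP[y0 y1].
    have d1 : dif rc (fun y : R => y%:C%C * v) y v.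
      have := difM (rdif_id y) (dif_cst rc v y).
      by apply: rdif_conv; rewrite mul1r mulr0 addr0.
    have d2 : dif rc (fun y : R => x s t + y%:C%C * v) y v.
      by have := difD (dif_cst rc (x s t) y) d1; apply: rdif_conv; rewrite add0r.
    have inD : cdisc p r1 (x s t + y%:C%C * v).
      rewrite /v mulrA -rmorphM /= -xsh; apply: near_in => //.
      by rewrite normrM ger0_norm //; apply: le_lt_trans h1; rewrite ler_piMl.
    have := difB (dif_comp d2 (dF _ inD)) (difZ (f (x s t)) d1).
    by apply: rdif_conv; ring.
  have := mvi (M := e1 * (`|h| * cabs u)) ler01 dg.
  rewrite mul1r mul0r addr0 mulr0 !subr0 mulr1.
  have -> : F (x s t + v) - f (x s t) * v - F (x s t) =
    F (x s t + v) - F (x s t) - f (x s t) * v by ring.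
  apply=> y /andP[y0 y1]; rewrite cabsM mulrC /v cabsM cabs_real.
  rewrite ler_wpM2r ?mulr_ge0 ?cabs_ge0 //; apply: hd => //.
  by apply: le_lt_trans _ hu; rewrite -/v cabsM cabs_real ger0_norm // ler_piMl // cabs_ge0.
exact: curve_const ler01 H.
Qed.

(** Continuity of the derivative of f is not known yet, so [cauchy_C1] is applied to a primitive F
    of f, whose derivative f is continuous. Differentiating that formula in z gives a kernel of
    order 2 acting on F. *)
Lemma cauchy_hol f z : hol (cdisc p r1) f -> cdisc p r z ->
  ctrans p r 1 (fun t => f (w t) * dcirc r t) z = omega * f z.
Proof.
move=> hf zr.
have pp : cdisc p r1 p by rewrite /cdisc subrr cabs0; exact: lt_trans r0 rr1.
have dF := hol_primitive (@copen_disc R p r1) (@nice_disc R p r1) hf pp.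
set F := cseg f p in dF.
have cf x : cdisc p r1 x -> cnt id f x by move=> /hf[l]; exact: dif_cnt.
have cphi t : 0 <= t <= 1 -> cnt rc (fun t => F (w t) * dcirc r t) t.
  move=> t01; apply: cntM; last exact: cnt_dcirc.
  by apply: cnt_comp; [exact: cnt_wcirc|apply: dif_cnt (dF _ (w_in t))].
have cphi' t : 0 <= t <= 1 -> cnt rc (fun t => f (w t) * dcirc r t) t.
  move=> t01; apply: cntM; last exact: cnt_dcirc.
  by apply: cnt_comp; [exact: cnt_wcirc|apply: cf].
have E x : cdisc p r x -> ctrans p r 1 (fun t => F (w t) * dcirc r t) x = omega * F x.
  exact: (cauchy_C1 dF cf).
have d1 : dif id (fun x => omega * F x) z (ctrans p r 2 (fun t => F (w t) * dcirc r t) z).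
  have [d d0 hd] := copen_disc zr.
  apply: (dif_ext_near d0 _ _ (dif_ctrans1 r0 zr cphi)) => // h /hd zh.
  exact: E.
have d2 := difZ omega (dF z (lt_trans zr rr1)).
rewrite -(dif_unique d1 d2).
(* integration by parts on the circle *)
apply/eqP; rewrite -subr_eq0; apply/eqP.
rewrite /ctrans -int01B; first last.
- exact: cnt_kernel.
- exact: cnt_kernel.
rewrite (@int01E R _ (fun t => F (w t) / (w t - z))); first by rewrite wcirc1 subrr.
move=> t t01; have a0 := circ_neq r0 t zr.
have da := dif_comp (difB (rdif_wcirc p r t) (dif_cst rc z t)) (dif_inv a0).
have := difM (dif_comp (rdif_wcirc p r t) (dF _ (w_in t))) da.
by apply: rdif_conv; rewrite expr1; field.
Qed.

End Formula.

Definition deriv f (z : C) : C := xget 0 [set l | dif id f z l].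

Lemma derivP U f z : hol U f -> U z -> dif id f z (deriv f z).
Proof.
move=> hf /hf[l dl]; rewrite /deriv; case: xgetP => [m _ //|].
by move=> /(_ l).
Qed.

Lemma deriv_eq f z l : dif id f z l -> deriv f z = l.
Proof.
move=> dl; rewrite /deriv; case: xgetP => [m _ /= dm|/(_ l)//].
exact: dif_unique dm dl.
Qed.

Lemma open_disc_sub U z : copen U -> U z -> exists2 r, 0 < r & forall x, cdisc z r x -> U x.
Proof.
move=> oU /oU[d d0 hd]; exists d => // x /hd.
by rewrite [z + _]addrC subrK.
Qed.

Lemma hol_cnt_circ p r r1 f : 0 < r -> r < r1 -> hol (cdisc p r1) f ->
  forall t, cnt rc (fun t => f (wcirc p r t)) t.
Proof.
move=> r0 rr1 hf t; apply: cnt_comp; first exact: cnt_wcirc.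
by apply: (hol_cnt hf); rewrite /cdisc cabs_wcirc // ltW.
Qed.

Lemma hol_deriv U f : copen U -> hol U f -> hol U (deriv f).
Proof.
move=> oU hf z Uz; have [r1 r10 sub] := open_disc_sub oU Uz.
pose r := r1 / 2; have r0 : 0 < r by rewrite divr_gt0.
have rr1 : r < r1 by rewrite /r; lra.
have hf1 : hol (cdisc z r1) f by move=> x /sub; exact: hf.
have zr : cdisc z r z by rewrite /cdisc subrr cabs0.
pose phi t := f (wcirc z r t) * dcirc r t.
have cphi t : 0 <= t <= 1 -> cnt rc phi t.
  by move=> _; apply: cntM; [exact: hol_cnt_circ hf1 t|exact: cnt_dcirc].
have E x : cdisc z r x -> f x = omega^-1 * ctrans z r 1 phi x.
  by move=> xr; rewrite /phi (cauchy_hol r0 rr1 hf1 xr) mulKf // omega_neq0.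
have d1 x : cdisc z r x -> dif id f x (omega^-1 * ctrans z r 2 phi x).
  move=> xr; have [d d0 hd] := copen_disc xr.
  apply: (dif_ext_near d0 _ _ (difZ omega^-1 (dif_ctrans1 r0 xr cphi))) => // h /hd xh.
  by rewrite E.
exists (omega^-1 * (2 * ctrans z r 3 phi z)).
have [d d0 hd] := copen_disc zr.
apply: (dif_ext_near d0 _ _ (difZ omega^-1 (dif_ctrans2 r0 zr cphi))) => // h /hd zh.
by rewrite (deriv_eq (d1 _ zh)).
Qed.

(** Near p the difference quotient, completed by the derivative at p, is the Cauchy transform of f /
    (w - p) and hence differentiable at p too. The factorisation holds for every z, inside U or not,
    which later spares side conditions. *)
Lemma hol_quot U f p : copen U -> hol U f -> U p -> exists q : C -> C,
  hol U q /\ forall z, f z = f p + (z - p) * q z.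
Proof.
move=> oU hf Up.
pose q z := if z == p then deriv f p else (f z - f p) / (z - p).
exists q; split; last first.
  move=> z; rewrite /q; case: eqVneq => [->|zp]; first by rewrite subrr mul0r addr0.
  by field; rewrite subr_eq0.
move=> z Uz; have [zp|zp] := eqVneq z p; last first.
  have zp0 : z - p != 0 by rewrite subr_eq0.
  have := difM (difB (derivP hf Uz) (dif_cst id (f p) z))
    (dif_comp (difB (@dif_id R z) (dif_cst id p z)) (dif_inv zp0)).
  set l := (X in dif _ _ _ X) => dl; exists l.
  have n0 : 0 < cabs (z - p) by rewrite cabs_gt0.
  apply: (dif_ext_near n0 _ _ dl) => // h hh.
  rewrite /q; case: eqVneq => // E; move: hh; rewrite -E opprD addrA subrr sub0r cabsN ltxx //.
rewrite {z Uz}zp.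
have [r1 r10 sub] := open_disc_sub oU Up.
pose r := r1 / 2; have r0 : 0 < r by rewrite divr_gt0.
have rr1 : r < r1 by rewrite /r; lra.
have hf1 : hol (cdisc p r1) f by move=> x /sub; exact: hf.
have pr : cdisc p r p by rewrite /cdisc subrr cabs0.
pose phi t := f (wcirc p r t) * dcirc r t.
have cphi t : 0 <= t <= 1 -> cnt rc phi t.
  by move=> _; apply: cntM; [exact: hol_cnt_circ hf1 t|exact: cnt_dcirc].
have E x : cdisc p r x -> f x = omega^-1 * ctrans p r 1 phi x.
  by move=> xr; rewrite /phi (cauchy_hol r0 rr1 hf1 xr) mulKf // omega_neq0.
pose psi t := phi t / (wcirc p r t - p).
have cpsi t : 0 <= t <= 1 -> cnt rc psi t.
  by move=> t01; have := cnt_kernel r0 1 pr cphi t01; apply: cnt_ext => s; rewrite expr1.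
have d1 : dif id f p (omega^-1 * ctrans p r 2 phi p).
  have [d d0 hd] := copen_disc pr.
  apply: (dif_ext_near d0 _ _ (difZ omega^-1 (dif_ctrans1 r0 pr cphi))) => // h /hd xh.
  by rewrite E.
have Q x : cdisc p r x -> q x = omega^-1 * ctrans p r 1 psi x.
  move=> xr; rewrite /q; case: eqVneq => [->|xp].
    rewrite (deriv_eq d1); congr (_ * _); apply: int01_ext => t.
    have a0 := circ_neq r0 t pr.
    by rewrite /psi; field.
  have xp0 : x - p != 0 by rewrite subr_eq0.
  rewrite !E // -mulrBr -mulrA; congr (_ * _).
  rewrite -int01B; try exact: cnt_kernel.
  rewrite mulrC -int01Z; last first.
    by move=> t t01; apply: cntB; exact: cnt_kernel.
  apply: int01_ext => t; have a0 := circ_neq r0 t pr; have b0 := circ_neq r0 t xr.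
  by rewrite /psi !expr1; field; rewrite a0 b0 xp0.
exists (omega^-1 * ctrans p r 2 psi p).
have [d d0 hd] := copen_disc pr.
apply: (dif_ext_near d0 _ _ (difZ omega^-1 (dif_ctrans1 r0 pr cpsi))) => // h /hd xh.
by rewrite Q.
Qed.

End Cauchy.

(** * Identity principle, limits, logarithms and zeros of holomorphic functions *)

Section Hol.
Variable R : realType.
Local Notation C := (complex R).
Local Notation rc := (fun x : R => x%:C%C).
Implicit Types (f g : C -> C) (p z : C) (U : C -> Prop).

Lemma hol_cst U c : hol U (fun=> c : C).
Proof. by move=> z _; exists 0; exact: dif_cst. Qed.
Lemma hol_id U : hol U (@id C).
Proof. by move=> z _; exists 1; exact: dif_id. Qed.
Lemma holD U f g : hol U f -> hol U g -> hol U (fun z => f z + g z).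
Proof. by move=> hf hg z Uz; have [l ?] := hf z Uz; have [m ?] := hg z Uz; exists (l + m); exact: difD. Qed.
Lemma holB U f g : hol U f -> hol U g -> hol U (fun z => f z - g z).
Proof. by move=> hf hg z Uz; have [l ?] := hf z Uz; have [m ?] := hg z Uz; exists (l - m); exact: difB. Qed.
Lemma holN U f : hol U f -> hol U (fun z => - f z).
Proof. by move=> hf z Uz; have [l ?] := hf z Uz; exists (- l); exact: difN. Qed.
Lemma holM U f g : hol U f -> hol U g -> hol U (fun z => f z * g z).
Proof. by move=> hf hg z Uz; have [l ?] := hf z Uz; have [m ?] := hg z Uz; exists (l * g z + f z * m); exact: difM. Qed.
Lemma holV U f : hol U f -> (forall z, U z -> f z != 0) -> hol U (fun z => (f z)^-1).
Proof.
move=> hf f0 z Uz; have [l ?] := hf z Uz; exists (- (f z) ^- 2 * l).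
by apply: dif_comp => //; exact: dif_inv (f0 z Uz).
Qed.
Lemma hol_comp U V f g : hol U f -> hol V g -> (forall z, U z -> V (f z)) ->
  hol U (fun z => g (f z)).
Proof.
move=> hf hg UV z Uz; have [l ?] := hf z Uz; have [m ?] := hg _ (UV z Uz).
by exists (m * l); exact: dif_comp.
Qed.
Lemma hol_cexp U f : hol U f -> hol U (fun z => cexp (f z)).
Proof.
by move=> hf z Uz; have [l ?] := hf z Uz; exists (cexp (f z) * l); apply: dif_comp => //; exact: dif_cexp.
Qed.
Lemma hol_sub U V f : (forall z, U z -> V z) -> hol V f -> hol U f.
Proof. by move=> UV hf z /UV /hf. Qed.
Lemma hol_sum U (I : Type) (s : seq I) (F : I -> C -> C) :
  (forall i, hol U (F i)) -> hol U (fun z => \sum_(i <- s) F i z).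
Proof.
move=> hF; elim: s => [|i s IH].
  have -> : (fun z => \sum_(i <- [::]) F i z) = (fun=> 0).
    by apply/funext => z; rewrite big_nil.
  exact: hol_cst.
have -> : (fun z => \sum_(i <- i :: s) F i z) = (fun z => F i z + \sum_(i <- s) F i z).
  by apply/funext => z; rewrite big_cons.
exact: holD.
Qed.
Lemma hol_prod U (I : Type) (s : seq I) (F : I -> C -> C) :
  (forall i, hol U (F i)) -> hol U (fun z => \prod_(i <- s) F i z).
Proof.
move=> hF; elim: s => [|i s IH].
  have -> : (fun z => \prod_(i <- [::]) F i z) = (fun=> 1).
    by apply/funext => z; rewrite big_nil.
  exact: hol_cst.
have -> : (fun z => \prod_(i <- i :: s) F i z) = (fun z => F i z * \prod_(i <- s) F i z).
  by apply/funext => z; rewrite big_cons.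
exact: holM.
Qed.

Lemma cauchy_estimate f p r r1 z M : 0 < r -> r < r1 -> hol (cdisc p r1) f ->
  (forall x, cabs (x - p) = r -> cabs (f x) <= M) -> cdisc p r z ->
  cabs (f z) <= r * M / (r - cabs (z - p)).
Proof.
move=> r0 rr1 hf fM zr; have E := cauchy_hol r0 rr1 hf zr.
have m0 : 0 < r - cabs (z - p) by rewrite subr_gt0.
have pi0 : 0 < 2 * pi :> R by rewrite mulr_gt0 // pi_gt0.
have M0 : 0 <= M.
  by apply: le_trans (cabs_ge0 (f (wcirc p r 0))) (fM _ _); rewrite cabs_wcirc // ltW.
have com : cabs (omega R) = 2 * pi.
  by have := @cabs_dcirc R 1 0 ler01; rewrite /dcirc mul1r cabsM cabs_ecirc !mulr1.
have : cabs (omega R * f z) <= M * (2 * pi * r) / (r - cabs (z - p)).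
  rewrite -E; apply: int01_le => [t t01|t t01].
    apply: cnt_kernel => // s _; apply: cntM; last exact: cnt_dcirc.
    exact: hol_cnt_circ hf s.
  rewrite expr1 cabsM [cabs (f _ * _)]cabsM cabsV cabs_dcirc ?(ltW r0) //.
  apply: ler_pM; rewrite ?mulr_ge0 ?cabs_ge0 ?invr_ge0 ?cabs_ge0 ?(ltW r0) ?pi_ge0 //.
    rewrite ler_wpM2r ?mulr_ge0 ?pi_ge0 ?(ltW r0) // fM // cabs_wcirc // ltW //.
  have far := circ_far r0 t zr.
  by rewrite lef_pV2 // posrE //; exact: lt_le_trans m0 far.
rewrite cabsM com mulrC -ler_pdivlMr //; congr (_ <= _).
by move: (2 * pi) pi0 => P P0; field; rewrite !gt_eqF.
Qed.

Lemma mean_bound f p r r1 M : 0 < r -> r < r1 -> hol (cdisc p r1) f ->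
  (forall x, cabs (x - p) = r -> cabs (f x) <= M) -> cabs (f p) <= M.
Proof.
move=> r0 rr1 hf fM; have pr : cdisc p r p by rewrite /cdisc subrr cabs0.
have := cauchy_estimate r0 rr1 hf fM pr; rewrite subrr cabs0 subr0.
by rewrite mulrAC divff ?gt_eqF // mul1r.
Qed.

(* Division by (x - p)^k keeps f holomorphic for all k; Cauchy's estimate then
   gives |f z| <= K (|z - p| / r)^k. *)
Lemma identity_disc f p r M d : hol (cdisc p r) f -> 0 < d ->
  (forall h, cabs h < d -> f (p + h) = 0) ->
  (forall x, cdisc p r x -> cabs (f x) <= M) ->
  forall z, cdisc p r z -> f z = 0.
Proof.
move=> hf d0 fd fM z zr.
have [->|zp] := eqVneq z p; first by rewrite -[p]addr0 fd // cabs0.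
pose q := (cabs (z - p) + r) / 2; set m := cabs (z - p).
have m0 : 0 < m by rewrite cabs_gt0 subr_eq0.
have mq : m < q by rewrite /q -/m; rewrite /cdisc -/m in zr; lra.
have qr : q < r by rewrite /q -/m; rewrite /cdisc -/m in zr; lra.
have q0 : 0 < q by lra.
have M0 : 0 <= M by apply: le_trans (cabs_ge0 _) (fM z zr).
pose g k x := f x / (x - p) ^+ k.
have hg k : hol (cdisc p r) (g k).
  move=> x xr; have [xp|xp] := eqVneq x p.
    exists 0; apply: (dif_ext_near d0 _ _ (dif_cst id 0 x)); first by [].
    by move=> h hd; rewrite /g xp fd // mul0r.
  have n0 : (x - p) ^+ k != 0 by rewrite expf_neq0 // subr_eq0.
  have [l dl] := hf x xr.
  have := difM dl (dif_comp (dif_pow k (difB (@dif_id R x) (dif_cst id p x))) (dif_inv n0)).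
  by set l' := (X in dif _ _ _ X) => dl'; exists l'.
have est k : cabs (f z) <= q * M / (q - m) * (m / q) ^+ k.
  have gM x : cabs (x - p) = q -> cabs (g k x) <= M / q ^+ k.
    move=> xq; rewrite /g cabsM cabsV cabsX xq ler_wpM2r ?invr_ge0 ?exprn_ge0 ?(ltW q0) //.
    by rewrite fM // /cdisc xq.
  have := cauchy_estimate q0 qr (hg k) gM mq.
  rewrite /g cabsM cabsV cabsX -/m ler_pdivrMr ?exprn_gt0 // => h; apply: le_trans h _.
  rewrite le_eqVlt; apply/orP; left; apply/eqP; rewrite [(m / q) ^+ k]expr_div_n; field.
  by rewrite expf_neq0 ?gt_eqF // subr_gt0.
apply/eqP; rewrite -cabs_eq0 eq_le cabs_ge0 andbT.
set K := q * M / (q - m) in est.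
have qm0 : 0 < q - m by lra.
have K0 : 0 <= K := divr_ge0 (mulr_ge0 (ltW q0) M0) (ltW qm0).
pose th := m / q; have th0 : 0 <= th := divr_ge0 (ltW m0) (ltW q0).
have th1 : `|th| < 1.
  by rewrite (ger0_norm th0) /th ltr_pdivrMr // mul1r.
apply/ler_addgt0Pr => e e0; rewrite add0r.
have /cvgrPdist_lt := cvg_expr th1.
move=> /(_ (e / (K + 1))) [|N _ hN]; first by rewrite divr_gt0 // ltr_wpDl.
have := hN N (leqnn _); rewrite /= sub0r normrN normrX => thN.
apply: le_trans (est N) _; rewrite -/th.
rewrite (ger0_norm th0) in thN.
have : K * th ^+ N <= K * (e / (K + 1)) by rewrite ler_wpM2l // ltW.
move=> h; apply: le_trans h _; rewrite mulrA ler_pdivrMr ?ltr_wpDl // mulrC.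
by rewrite ler_wpM2l ?(ltW e0) // lerDl.
Qed.

(** Compactness is used only for curves: a bound on a slightly larger circle passes to the disc
    through Cauchy's formula. *)
Lemma hol_bounded_disc f p r r1 : 0 < r -> r < r1 -> hol (cdisc p r1) f ->
  exists2 M, 0 <= M & forall x, cdisc p r x -> cabs (f x) <= M.
Proof.
move=> r0 rr1 hf; have [r2 [rr2 r2r1]] : exists r2, r < r2 /\ r2 < r1.
  by exists ((r + r1) / 2); split; lra.
have r20 : 0 < r2 by lra.
have cphi t (_ : 0 <= t <= 1) := hol_cnt_circ r20 r2r1 hf t.
have [M M0 hM] := phi_bound cphi.
exists (r2 * M / (r2 - r)) => [|x xr].
  by rewrite divr_ge0 ?mulr_ge0 // ?(ltW r20) //; lra.
have E := cauchy_hol r20 r2r1 hf.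
have xr2 : cdisc p r2 x by exact: lt_trans xr rr2.
have xr' : cabs (x - p) < r := xr.
have m0 : 0 < r2 - r by lra.
have pi0 : 0 < 2 * pi :> R by rewrite mulr_gt0 // pi_gt0.
have com : cabs (omega R) = 2 * pi.
  by have := @cabs_dcirc R 1 0 ler01; rewrite /dcirc mul1r cabsM cabs_ecirc !mulr1.
have : cabs (omega R * f x) <= M * (2 * pi * r2) / (r2 - r).
  rewrite -(E x xr2); apply: int01_le => [t t01|t t01].
    by apply: cnt_kernel => // s s01; apply: cntM; [exact: cphi|exact: cnt_dcirc].
  rewrite expr1 cabsM [cabs (f _ * _)]cabsM cabsV cabs_dcirc ?(ltW r20) //.
  apply: ler_pM; rewrite ?mulr_ge0 ?cabs_ge0 ?invr_ge0 ?cabs_ge0 ?(ltW r20) ?pi_ge0 //.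
    by rewrite ler_wpM2r ?mulr_ge0 ?pi_ge0 ?(ltW r20) // hM.
  have far := circ_far r20 t xr2.
  have far' : r2 - r <= cabs (wcirc p r2 t - x) by lra.
  by rewrite lef_pV2 // posrE //; exact: lt_le_trans m0 far'.
rewrite cabsM com mulrC -ler_pdivlMr //; congr (_ <= _).
by move: (2 * pi) pi0 => P P0; field; rewrite !gt_eqF.
Qed.

Lemma identity_disc' f p r d : hol (cdisc p r) f -> 0 < d ->
  (forall h, cabs h < d -> f (p + h) = 0) -> forall z, cdisc p r z -> f z = 0.
Proof.
move=> hf d0 fd z zr; have zr' : cabs (z - p) < r := zr.
have m0 := cabs_ge0 (z - p).
pose q := (cabs (z - p) + r) / 2.
have q0 : 0 < q by rewrite /q; lra.
have qr : q < r by rewrite /q; lra.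
have [M M0 hM] := hol_bounded_disc q0 qr hf.
have hq : hol (cdisc p q) f.
  by apply: hol_sub hf => x xq; exact: lt_trans xq qr.
by apply: (identity_disc hq d0 fd hM); rewrite /cdisc /q; lra.
Qed.

(** Vanishing is carried leftwards along the horizontal line through z by a chain of discs of fixed
    radius d that stay in the quadrant. The centres move by less than d / 2, so each disc contains
    the half-size disc about the next centre. *)
Lemma identity_quadrant f x0 s1 : hol (fun z => rhalf x0 z /\ uhalf 0 z) f ->
  (forall z, s1 < Re z -> 0 < Im z -> f z = 0) ->
  forall z, x0 < Re z -> 0 < Im z -> f z = 0.
Proof.
move=> hf fs z zx zy; set x := Re z in zx; set y := Im z in zy.
pose d := Num.min (x - x0) y.
have d0 : 0 < d by rewrite lt_min subr_gt0 zx.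
have dx : d <= x - x0 by rewrite ge_min lexx.
have dy : d <= y by rewrite ge_min lexx orbT.
pose X := Num.max s1 x + 1.
have m1 : s1 <= Num.max s1 x by rewrite le_max lexx.
have m2 : x <= Num.max s1 x by rewrite le_max lexx orbT.
have Xs : s1 < X by rewrite /X; lra.
have Xx : x < X by rewrite /X; lra.
pose N := (Num.truncn ((X - x) / (d / 2))).+1.
have hN : (X - x) / (d / 2) < N%:R by exact: truncnS_gt.
have N0 : 0 < N%:R :> R by rewrite ltr0n.
pose st := (X - x) / N%:R.
have st0 : 0 < st by rewrite divr_gt0 // subr_gt0.
have std : st < d / 2.
  by move: hN; rewrite /st ltr_pdivrMr ?divr_gt0 // ltr_pdivrMr // mulrC.
pose c k : C := Complex (X - k%:R * st) y.
have step k : (k <= N)%N -> exists2 e, 0 < e & forall h, cabs h < e -> f (c k + h) = 0.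
  elim: k => [|k IH] kN.
    exists (Num.min (X - s1) y) => [|h]; first by rewrite lt_min subr_gt0 Xs.
    rewrite lt_min => /andP[h1 h2]; apply: fs.
      rewrite ReD /= mul0r subr0; have := Re_le_cabs h; rewrite ler_norml => /andP[]; lra.
    rewrite ImD /=; have := Im_le_cabs h; rewrite ler_norml => /andP[]; lra.
  have [e e0 he] := IH (ltnW kN).
  have kx : x <= X - k%:R * st.
    have : k%:R * st <= N%:R * st by rewrite ler_wpM2r ?(ltW st0) // ler_nat ltnW.
    have -> : N%:R * st = X - x by rewrite /st; field; rewrite gt_eqF.
    lra.
  have hd : hol (cdisc (c k) d) f.
    apply: hol_sub hf => u; rewrite /cdisc => ud; split.
      have := Re_le_cabs (u - c k); rewrite ReB /= ler_norml => /andP[h1 h2].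
      by rewrite /rhalf; lra.
    have := Im_le_cabs (u - c k); rewrite ImB /= ler_norml => /andP[h1 h2].
    by rewrite /uhalf; lra.
  exists (d / 2) => [|h hh]; first by rewrite divr_gt0.
  apply: (identity_disc' hd e0 he); rewrite /cdisc.
  have -> : c k.+1 + h - c k = h - st%:C%C.
    by apply: complex_eq; rewrite ?(ReB, ReD, ImB, ImD) /=; rewrite -?natr1; ring.
  apply: le_lt_trans (cabs_triB _ _) _; rewrite cabs_real gtr0_norm //; lra.
have [e e0 he] := step N (leqnn _).
have := he 0; rewrite cabs0 addr0 => /(_ e0) <-; congr f.
apply: complex_eq => //=; rewrite /st; field; by rewrite gt_eqF.
Qed.

(** Weierstrass: a locally uniform limit is continuous, Cauchy's formula passes to the limit, and a
    Cauchy transform is differentiable. *)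
Lemma hol_limit U (F : nat -> C -> C) f : copen U -> (forall n, hol U (F n)) ->
  (forall z, U z -> exists2 r, 0 < r & forall e, 0 < e -> exists N, forall n, (N <= n)%N ->
     forall x, cdisc z r x -> cabs (F n x - f x) <= e) -> hol U f.
Proof.
move=> oU hF H z Uz; have [r1 r10 sub1] := open_disc_sub oU Uz.
have [r2 r20 h2] := H z Uz.
pose r3 := Num.min r1 r2; have r30 : 0 < r3 by rewrite lt_min r10.
have sub3 x : cdisc z r3 x -> U x.
  by rewrite /cdisc lt_min => /andP[/sub1].
have h3 e : 0 < e -> exists N, forall n, (N <= n)%N -> forall x, cdisc z r3 x -> cabs (F n x - f x) <= e.
  move=> /h2[N hN]; exists N => n /hN hn x; rewrite /cdisc lt_min => /andP[_]; exact: hn.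
have cf x : cdisc z r3 x -> cnt id f x.
  move=> xr e e0; have [N hN] := h3 (e / 3) ltac:(lra).
  have [d d0 hd] := copen_disc xr.
  have [d' d'0 hd'] := hol_cnt (hF N) (sub3 _ xr) (e := e / 3) ltac:(lra).
  exists (Num.min d d') => [|k]; first by rewrite lt_min d0.
  rewrite lt_min => /andP[/hd k1 /hd' k2].
  apply: le_trans (cabs_dist (F N (x + k)) _ _) _; rewrite [cabs (f _ - _)]cabsB.
  apply: le_trans (lerD (lexx _) (cabs_dist (F N x) _ _)) _.
  have := hN N (leqnn _) _ k1; have := hN N (leqnn _) _ xr; lra.
pose r := r3 / 2; have r0 : 0 < r by rewrite divr_gt0.
have rr3 : r < r3 by rewrite /r; lra.
have hF3 n : hol (cdisc z r3) (F n) by apply: hol_sub (hF n).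
have win t : cdisc z r3 (wcirc z r t) by rewrite /cdisc cabs_wcirc // ltW.
pose phi t := f (wcirc z r t) * dcirc r t.
have cphi t : 0 <= t <= 1 -> cnt rc phi t.
  move=> _; apply: cntM; last exact: cnt_dcirc.
  by apply: cnt_comp; [exact: cnt_wcirc|exact: cf].
have E x : cdisc z r x -> f x = (omega R)^-1 * ctrans z r 1 phi x.
  move=> xr; have x3 : cdisc z r3 x by exact: lt_trans xr rr3.
  have m0 : 0 < r - cabs (x - z) by rewrite subr_gt0.
  set K := 2 * pi * r / (r - cabs (x - z)).
  have pr0 : 0 < 2 * pi * r :> R by rewrite !mulr_gt0 // pi_gt0.
  have K0 : 0 <= K by rewrite divr_ge0 // ltW.
  apply: (mulfI (omega_neq0 R)); rewrite mulVKf ?omega_neq0 //.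
  apply/eqP; rewrite -subr_eq0 -cabs_eq0 eq_le cabs_ge0 andbT.
  apply/ler_addgt0Pr => e e0; rewrite add0r.
  pose k := cabs (omega R) + K + 1.
  have k0 : 0 < k by rewrite ltr_wpDl // addr_ge0 // cabs_ge0.
  have [N hN] := h3 (e / k) (divr_gt0 e0 k0).
  have hNn := hN N (leqnn _).
  apply: le_trans (cabs_dist (omega R * F N x) _ _) _.
  rewrite -mulrBr cabsM [cabs (f x - _)]cabsB -(cauchy_hol r0 rr3 (hF3 N) xr).
  have cN t : 0 <= t <= 1 -> cnt rc (fun t => F N (wcirc z r t) * dcirc r t) t.
    by move=> _; apply: cntM; [exact: hol_cnt_circ (hF3 N) t|exact: cnt_dcirc].
  have H2 : cabs (ctrans z r 1 (fun t => F N (wcirc z r t) * dcirc r t) x - ctrans z r 1 phi x)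
     <= e / k * K.
    rewrite /ctrans -int01B; try exact: cnt_kernel.
    apply: int01_le => [t t01|t t01]; first by apply: cntB; exact: cnt_kernel.
    rewrite /phi expr1 -mulrBl -mulrBl -mulrA cabsM cabsM cabsV cabs_dcirc ?(ltW r0) //.
    apply: ler_pM; rewrite ?divr_ge0 ?cabs_ge0 ?(ltW pr0) //.
      by rewrite hNn.
    rewrite /K ler_wpM2l ?(ltW pr0) // lef_pV2 ?posrE //; first exact: circ_far.
    by apply: lt_le_trans m0 _; exact: circ_far.
  apply: le_trans (lerD (ler_wpM2l (cabs_ge0 _) (hNn _ x3)) H2) _.
  rewrite [_ * (e / k)]mulrC -mulrDr -ler_pdivlMl ?divr_gt0 // invf_div.
  by rewrite divfK ?gt_eqF // /k lerDl.
exists ((omega R)^-1 * ctrans z r 2 phi z).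
have zr : cdisc z r z by rewrite /cdisc subrr cabs0.
have [d d0 hd] := copen_disc zr.
apply: (dif_ext_near d0 _ _ (difZ (omega R)^-1 (dif_ctrans1 r0 zr cphi))) => // h /hd zh.
by rewrite E.
Qed.

(** H is a primitive of h' / h, and h * exp (- H) has zero derivative along every segment from p. *)
Lemma hol_log U h p : copen U -> nice U -> hol U h -> (forall z, U z -> h z != 0) -> U p ->
  exists H : C -> C, [/\ hol U H, H p = 0 & forall z, U z -> h z = h p * cexp (H z)].
Proof.
move=> oU nU hh h0 Up.
have hq : hol U (fun z => deriv h z / h z).
  by apply: holM; [exact: hol_deriv|exact: holV].
have dP := hol_primitive oU nU hq Up.
set H := cseg _ p in dP; exists H.
have Hp : H p = 0 by rewrite /H /cseg subrr mul0r.
split=> //; first by move=> z Uz; exists (deriv h z / h z); exact: dP.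
move=> z Uz.
have d t : 0 <= t <= 1 -> dif rc (fun t => h (seg p z t) * cexp (- H (seg p z t))) t 0.
  move=> t01; have Us := nice_seg nU Up Uz t01.
  have d1 := dif_comp (rdif_seg p z t) (derivP hh Us).
  have d2 := dif_comp (difN (dif_comp (rdif_seg p z t) (dP _ Us))) (dif_cexp _).
  have := difM d1 d2; apply: rdif_conv; field; exact: h0.
have := curve_const ler01 d.
rewrite /seg mul1r mul0r addr0 [p + _]addrC subrK Hp oppr0 cexp0 mulr1 => <-.
by rewrite -mulrA -cexpD addNr cexp0 mulr1.
Qed.

Section ZeroFactors.
Variables (U : C -> Prop) (g : C -> C) (c : C) (r0 r r1 : R).
Hypotheses (U_open : copen U) (r0_gt0 : 0 < r0) (r0r : r0 < r) (rr1 : r < r1).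
Hypotheses (sub : forall z, cdisc c r1 z -> U z) (hg : hol U g) (gc : g c != 0).

Let fact (L : seq C) h := [/\ hol U h, (forall a, a \in L -> cabs (a - c) <= r0) &
  forall z, g z = h z * \prod_(a <- L) (z - a)].

(* Replacing the factors z - a by Blaschke factors of the disc, as in Jensen's
   formula, bounds the number of extracted zeros. *)
Lemma extract_bound : exists N, forall L h, fact L h -> (size L < N)%N.
Proof.
have rpos : 0 < r by exact: lt_trans r0r.
have hg1 : hol (cdisc c r1) g by exact: hol_sub hg.
have [r2 [rr2 r2r1]] : exists r2, r < r2 /\ r2 < r1.
  by have h := rr1; exists ((r + r1) / 2); split; lra.
have [M M0 hM] := hol_bounded_disc (lt_trans rpos rr2) r2r1 hg1.
have gc0 : 0 < cabs (g c) by rewrite cabs_gt0.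
have th : `|r0 / r| < 1.
  by rewrite ger0_norm ?divr_ge0 ?ltW // ltr_pdivrMr ?mul1r.
have /cvgrPdist_lt := cvg_expr th.
move=> /(_ (cabs (g c) / (M + 1))) [|N _ hN]; first by rewrite divr_gt0 // ltr_wpDl.
exists N => L h [hh hL gE]; rewrite ltnNge; apply/negP => NL.
have := hN (size L) NL; rewrite /= sub0r normrN normrX ger0_norm ?divr_ge0 ?ltW //.
apply/negP; rewrite -leNgt.
(* [B a] has modulus |z - a| on the circle of radius r about c and value r at c. Hence |h c| r ^
   size L <= M, while |g c| <= |h c| r0 ^ size L, so |g c| <= M (r0 / r) ^ size L, which fails for
   long L. *)
pose B (a z : C) : C := (r%:C%C ^+ 2 - ((a - c)^*)%C * (z - c)) / r%:C%C.
have hB a : hol (cdisc c r1) (B a).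
  by apply: holM; [apply: holB; [exact: hol_cst|apply: holM; [exact: hol_cst|
    apply: holB; [exact: hol_id|exact: hol_cst]]]|exact: hol_cst].
have rC : r%:C%C != 0 :> C by rewrite fmorph_eq0 gt_eqF.
have Babs a z : cabs (z - c) = r -> cabs (B a z) = cabs (z - a).
  move=> zr; rewrite /B cabsM cabsV cabs_real gtr0_norm //.
  have -> : r%:C%C ^+ 2 = ((z - c)^*)%C * (z - c).
    apply: complex_eq; rewrite ?expr2 ?(ReM, ImM) /=.
      have := cabs_sqr (z - c); rewrite zr; case: (z - c) => u v /=; lra.
    by case: (z - c) => u v /=; ring.
  rewrite -mulrBl cabsM zr mulfK ?gt_eqF // -rmorphB cabs_conj; congr cabs; ring.
pose G z := h z * \prod_(a <- L) B a z.
have hG : hol (cdisc c r1) G.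
  by apply: holM; [exact: hol_sub hh|exact: hol_prod].
have := mean_bound (M := M) rpos rr1 hG.
have GM x : cabs (x - c) = r -> cabs (G x) <= M.
  move=> xr; have -> : cabs (G x) = cabs (g x).
    rewrite gE /G !cabsM !cabs_prod; congr (_ * _).
    by apply: eq_bigr => a _; exact: Babs.
  by apply: hM; rewrite /cdisc xr.
move=> /(_ GM).
have -> : cabs (G c) = cabs (h c) * r ^+ size L.
  rewrite /G cabsM cabs_prod; congr (_ * _).
  rewrite (eq_bigr (fun=> r)) ?big_const_seq ?count_predT ?iter_mulr_1 // => a _.
  by rewrite /B subrr mulr0 subr0 expr2 mulfK // cabs_real gtr0_norm.
move=> hr.
have : cabs (g c) <= cabs (h c) * r0 ^+ size L.
  rewrite gE cabsM cabs_prod ler_wpM2l ?cabs_ge0 //.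
  elim: L hL {gE hr G hG GM NL} => [|a L IH] hL; first by rewrite big_nil.
  rewrite big_cons exprS ler_pM ?cabs_ge0 //.
  - by elim/big_ind: _ => // [x y|i _]; [exact: mulr_ge0|exact: cabs_ge0].
  - by rewrite cabsB hL // mem_head.
  - by apply: IH => b bL; rewrite hL // in_cons bL orbT.
move=> hgc; rewrite ler_pdivrMr ?ltr_wpDl // expr_div_n mulrAC.
rewrite ler_pdivlMr ?exprn_gt0 //.
have rn : 0 <= r ^+ size L by rewrite exprn_ge0 // ltW.
apply: le_trans (ler_wpM2r rn hgc) _.
rewrite [leLHS](_ : _ = r0 ^+ size L * (cabs (h c) * r ^+ size L)); last by ring.
rewrite ler_wpM2l ?exprn_ge0 ?(ltW r0_gt0) //; lra.
Qed.

(** Zeros are divided out one at a time, repetitions recording multiplicity; [extract_bound] forces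
    the process to stop. *)
Lemma extract_zeros : exists (L : seq C) h,
  [/\ hol U h, (forall a, a \in L -> cabs (a - c) <= r0),
    (forall z, g z = h z * \prod_(a <- L) (z - a)) &
    forall z, cabs (z - c) <= r0 -> h z != 0].
Proof.
have [N hN] := extract_bound.
have U0 z : cabs (z - c) <= r0 -> U z.
  move=> zc; apply: sub; apply: le_lt_trans zc _; exact: lt_trans r0r rr1.
have [//|[L [h [F sL]]]] : (exists (L : seq C) h,
    [/\ hol U h, (forall a, a \in L -> cabs (a - c) <= r0),
      (forall z, g z = h z * \prod_(a <- L) (z - a)) &
      forall z, cabs (z - c) <= r0 -> h z != 0]) \/
    (exists (L : seq C) h, fact L h /\ size L = N).
  elim: N {hN} => [|n [IH|[L [h [[hh hL gE] sL]]]]]; [right| |].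
  - by exists [::], g; split=> //; split=> // z; rewrite big_nil mulr1.
  - by left.
  have [[a [ac ha]]|H] := pselect (exists a, cabs (a - c) <= r0 /\ h a = 0).
    right; have [q [hq hE]] := hol_quot U_open hh (U0 a ac).
    exists (a :: L), q; split; last by rewrite /= sL.
    split=> // [b|z].
      by rewrite in_cons => /orP[/eqP->//|]; exact: hL.
    by rewrite gE hE ha add0r big_cons; ring.
  left; exists L, h; split=> // z zc; apply/eqP => hz; apply: H; by exists z.
by have := hN L h F; rewrite sL ltnn.
Qed.

End ZeroFactors.
End Hol.

(** * The alternating zeta function *)

Section Limits.
Variable R : realType.
Local Notation C := (complex R).

Definition limto (u : nat -> C) (l : C) :=
  forall e : R, 0 < e -> exists N, forall n, (N <= n)%N -> cabs (u n - l) <= e.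

Lemma limto_unique u l m : limto u l -> limto u m -> l = m.
Proof.
move=> ul um; apply/eqP; rewrite -subr_eq0 -cabs_eq0 eq_le cabs_ge0 andbT.
apply/ler_addgt0Pr => e e0; rewrite add0r.
have [N hN] := ul (e / 2) ltac:(lra); have [M hM] := um (e / 2) ltac:(lra).
have := hN (N + M)%N (leq_addr _ _); have := hM (N + M)%N (leq_addl _ _).
move=> h1 h2; apply: le_trans (cabs_dist (u (N + M)%N) _ _) _.
by rewrite [cabs (l - _)]cabsB; lra.
Qed.
Lemma limto_cst (l : C) : limto (fun=> l) l.
Proof. by move=> e e0; exists 0%N => n _; rewrite subrr cabs0 ltW. Qed.
Lemma limto_ext u v l : (forall n, u n = v n) -> limto u l -> limto v l.
Proof. by move=> /funext ->. Qed.
Lemma limtoD u v l m : limto u l -> limto v m -> limto (fun n => u n + v n) (l + m).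
Proof.
move=> ul vm e e0; have [N hN] := ul (e / 2) ltac:(lra); have [M hM] := vm (e / 2) ltac:(lra).
exists (N + M)%N => n nNM; have -> : u n + v n - (l + m) = (u n - l) + (v n - m) by ring.
apply: le_trans (cabsD _ _) _.
have := hN n (leq_trans (leq_addr _ _) nNM); have := hM n (leq_trans (leq_addl _ _) nNM).
lra.
Qed.
Lemma limtoM u v l m : limto u l -> limto v m -> limto (fun n => u n * v n) (l * m).
Proof.
move=> ul vm e e0; pose k := 1 + cabs l + cabs m.
have l0 := cabs_ge0 l; have m0 := cabs_ge0 m.
have k0 : 0 < k by rewrite /k; lra.
pose e1 := Num.min 1 (e / k); have e10 : 0 < e1 by rewrite lt_min ltr01 divr_gt0.
have e11 : e1 <= 1 by rewrite ge_min lexx.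
have e1k : e1 * k <= e by rewrite -ler_pdivlMr // ge_min lexx orbT.
have [N hN] := ul e1 e10; have [M hM] := vm e1 e10.
exists (N + M)%N => n nNM.
have h1 := hN n (leq_trans (leq_addr _ _) nNM); have h2 := hM n (leq_trans (leq_addl _ _) nNM).
have -> : u n * v n - l * m = (u n - l) * (v n - m) + (u n - l) * m + l * (v n - m) by ring.
apply: le_trans (cabsD _ _) _; apply: le_trans (lerD (cabsD _ _) (lexx _)) _.
rewrite !cabsM; have a0 := cabs_ge0 (u n - l); have b0 := cabs_ge0 (v n - m).
rewrite /k in e1k; nra.
Qed.
Lemma limtoN u l : limto u l -> limto (fun n => - u n) (- l).
Proof.
move=> ul; rewrite -mulN1r; apply: limto_ext (limtoM (limto_cst (-1)) ul) => n.
by rewrite mulN1r.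
Qed.
Lemma limtoB u v l m : limto u l -> limto v m -> limto (fun n => u n - v n) (l - m).
Proof. by move=> ul vm; apply: limtoD => //; exact: limtoN. Qed.
Lemma limto_sum (I : Type) (s : seq I) (u : I -> nat -> C) (l : I -> C) :
  (forall i, limto (u i) (l i)) ->
  limto (fun n => \sum_(i <- s) u i n) (\sum_(i <- s) l i).
Proof.
move=> ul; elim: s => [|i s IH].
  by rewrite big_nil; apply: limto_ext (limto_cst 0) => n; rewrite big_nil.
by rewrite big_cons; apply: limto_ext (limtoD (ul i) IH) => n; rewrite big_cons.
Qed.
Lemma limto_subseq u l (k : nat -> nat) : (forall n, (n <= k n)%N) -> limto u l ->
  limto (fun n => u (k n)) l.
Proof.
by move=> kn ul e /ul[N hN]; exists N => n Nn; apply: hN; exact: leq_trans Nn (kn n).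
Qed.
Lemma limto_le u l M : limto u l -> (exists N, forall n, (N <= n)%N -> cabs (u n) <= M) -> cabs l <= M.
Proof.
move=> ul [N hN]; apply/ler_addgt0Pr => e /ul[N' hN'].
have := hN (N + N')%N (leq_addr _ _); have := hN' (N + N')%N (leq_addl _ _).
have := cabs_rtriB l (u (N + N')%N); rewrite [cabs (l - _)]cabsB; lra.
Qed.
Lemma limto_ge u l M : limto u l -> (exists N, forall n, (N <= n)%N -> M <= cabs (u n)) -> M <= cabs l.
Proof.
move=> ul [N hN]; apply/ler_addgt0Pr => e /ul[N' hN'].
have := hN (N + N')%N (leq_addr _ _); have := hN' (N + N')%N (leq_addl _ _).
have := cabs_rtriB (u (N + N')%N) l; lra.
Qed.

End Limits.

Section Eta.
Variable R : realType.
Local Notation C := (complex R).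
Implicit Types (s : C) (n N M : nat).

Lemma cabs_npowN n s : cabs (npowN n s) = expR (- Re s * ln n%:R).
Proof. by rewrite /npowN cabs_cexp mulrC ReRM ReN mulrC. Qed.

Lemma ln_nat_ge0 n : 0 <= ln (n.+1%:R : R).
Proof. by rewrite ln_ge0 // ler1n. Qed.

Lemma ln_nat_mono m n : (m <= n)%N -> ln (m.+1%:R : R) <= ln (n.+1%:R).
Proof. by move=> mn; rewrite ler_ln ?posrE ?ltr0n // ler_nat. Qed.

Lemma cabs_npowN_mono s m n : 0 <= Re s -> (m <= n)%N ->
  cabs (npowN n.+1 s) <= cabs (npowN m.+1 s).
Proof.
move=> s0 mn; rewrite !cabs_npowN ler_expR !mulNr lerN2 ler_wpM2l //.
exact: ln_nat_mono.
Qed.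

Lemma cabs_npowN_le1 s n : 0 <= Re s -> cabs (npowN n.+1 s) <= 1.
Proof.
move=> s0; apply: le_trans (cabs_npowN_mono s0 (leq0n n)) _.
by rewrite cabs_npowN ln1 mulr0 expR0.
Qed.

Lemma npowNM m n s : npowN (m.+1 * n.+1) s = npowN m.+1 s * npowN n.+1 s.
Proof.
by rewrite /npowN natrM lnM ?posrE ?ltr0n // rmorphD /= mulrDr cexpD.
Qed.

Definition alt N s : C := \sum_(0 <= n < N) (-1) ^+ n * npowN n.+1 s.
Definition zsum N s : C := \sum_(0 <= n < N) npowN n.+1 s.
(* kap s zeta s = eta s. *)
Definition kap s : C := 1 - 2 * npowN 2 s.

Lemma alt_zsum N s : alt N.*2 s = zsum N.*2 s - 2 * npowN 2 s * zsum N s.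
Proof.
elim: N => [|N IH]; first by rewrite /alt /zsum !big_geq // mulr0 subrr.
rewrite doubleS /alt /zsum !big_nat_recr //= -/(alt _ _) -/(zsum _ _) -/(zsum N s) IH.
have -> : npowN N.*2.+2 s = npowN 2 s * npowN N.+1 s.
  by rewrite -npowNM mul2n doubleS.
rewrite exprS -mul2n exprM sqrrN !expr1n; ring.
Qed.

Let del n : R := ln n.+2%:R - ln n.+1%:R.
(** The logarithm of the ratio of consecutive terms: [npowN n.+2 s = cexp (w s n) * npowN n.+1
    s]. *)
Let w s n : C := - s * (del n)%:C%C.

Lemma del_ge0 n : 0 <= del n.
Proof. by rewrite subr_ge0; exact: ln_nat_mono. Qed.

Lemma ratio_ln n : del n = ln (1 + n.+1%:R^-1).
Proof.
rewrite /del -ln_div ?posrE ?ltr0n //; congr ln.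
by rewrite -[n.+2]addn1 natrD mulrDl divff ?mul1r // pnatr_eq0.
Qed.

Lemma del_le n : del n <= n.+1%:R^-1.
Proof.
by rewrite ratio_ln; apply: le_ln1Dx; apply: lt_le_trans (ltrN10 R) _; rewrite invr_ge0 ler0n.
Qed.

Lemma del_decr n : del n.+1 <= del n.
Proof.
rewrite !ratio_ln ler_ln ?posrE ?addr_gt0 ?invr_gt0 ?ltr0n // lerD2l.
by rewrite lef_pV2 ?posrE ?ltr0n // ler_nat.
Qed.

Lemma expR_half : expR (2^-1 : R) <= 2.
Proof.
have := expR_ge1Dx (- 2^-1 : R); rewrite expRN => h.
have e0 := expR_gt0 (2^-1 : R).
have : 1 - 2^-1 <= (expR (2^-1 : R))^-1 by [].
rewrite -[X in _ <= X]div1r ler_pdivlMr //; lra.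
Qed.

Lemma cexp_small (z : C) : cabs z <= 2^-1 -> cabs (cexp z - 1) <= 2 * cabs z.
Proof.
move=> z2; apply: le_trans (cexp_sub1 z) _; rewrite mulrC ler_wpM2r ?cabs_ge0 //.
by apply: le_trans expR_half; rewrite ler_expR.
Qed.

Section Tail.
Variables (s : C) (N : nat).
Hypotheses (s0 : 0 <= Re s) (sN : 2 * cabs s <= N.+1%:R).

Let u n := (-1) ^+ n * npowN n.+1 s.
(** The recursion u (n+1) = - exp (w n) u n gives u n = A n (u (n+1) - u n), so the alternating sum
    is ready for summation by parts against the slowly varying A. The condition 2 |s| <= N + 1 makes
    |w| <= 1/2, which keeps the denominators away from 0. *)
Let A n := - (1 + cexp (w s n))^-1.

Let w_le n : (N <= n)%N -> cabs (w s n) <= 2^-1.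
Proof.
move=> Nn; rewrite /w cabsM cabsN cabs_real ger0_norm ?del_ge0 //.
apply: le_trans (ler_wpM2l (cabs_ge0 s) (del_le n)) _.
rewrite ler_pdivrMr ?ltr0n //; have : N.+1%:R <= n.+1%:R :> R by rewrite ler_nat.
have := sN; lra.
Qed.

Let den_ge1 n : (N <= n)%N -> 1 <= cabs (1 + cexp (w s n)).
Proof.
move=> Nn; have := cexp_small (w_le Nn); have := w_le Nn => h1 h2.
have := cabs_rtri 2 (cexp (w s n) - 1); rewrite cabs_nat.
have -> : 2 + (cexp (w s n) - 1) = 1 + cexp (w s n) by ring.
lra.
Qed.

Let den_neq0 n : (N <= n)%N -> 1 + cexp (w s n) != 0.
Proof. by move=> /den_ge1 h; rewrite -cabs_gt0; apply: lt_le_trans h. Qed.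

Let A_le n : (N <= n)%N -> cabs (A n) <= 1.
Proof. by move=> Nn; rewrite /A cabsN cabsV invf_le1 ?den_ge1 //; apply: lt_le_trans (den_ge1 Nn). Qed.

Let uS n : u n.+1 = - cexp (w s n) * u n.
Proof.
rewrite /u exprS; have -> : npowN n.+2 s = cexp (w s n) * npowN n.+1 s.
  by rewrite /npowN -cexpD; congr cexp; rewrite /w /del rmorphB /=; ring.
ring.
Qed.

Let u_abel n : (N <= n)%N -> u n = (u n.+1 * A n.+1 - u n * A n) - u n.+1 * (A n.+1 - A n).
Proof.
move=> Nn; have -> : u n.+1 * A n.+1 - u n * A n - u n.+1 * (A n.+1 - A n) = (u n.+1 - u n) * A n by ring.
by rewrite uS /A; field; exact: den_neq0.
Qed.

Let dA n : (N <= n)%N -> cabs (A n.+1 - A n) <= 2 * cabs s * (del n - del n.+1).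
Proof.
move=> Nn; have NSn : (N <= n.+1)%N := leqW Nn.
have d1 := den_neq0 Nn; have d2 := den_neq0 NSn.
have -> : A n.+1 - A n = (cexp (w s n.+1) * (1 - cexp (w s n - w s n.+1))) /
    ((1 + cexp (w s n)) * (1 + cexp (w s n.+1))).
  rewrite mulrBr mulr1 -cexpD [w s n.+1 + _]addrC subrK /A.
  by field; rewrite d1 d2.
have dd : 0 <= del n - del n.+1 by rewrite subr_ge0 del_decr.
have wE : cabs (w s n - w s n.+1) = cabs s * (del n - del n.+1).
  have -> : w s n - w s n.+1 = - s * (del n - del n.+1)%:C%C.
    by rewrite /w [(del n - del n.+1)%:C%C]rmorphB /=; ring.
  by rewrite cabsM cabsN cabs_real ger0_norm.
have wl : cabs (w s n - w s n.+1) <= 2^-1.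
  rewrite wE; have := w_le Nn; rewrite /w cabsM cabsN cabs_real ger0_norm ?del_ge0 //.
  apply: le_trans; rewrite ler_wpM2l ?cabs_ge0 // gerBl; exact: del_ge0.
rewrite cabsM cabsV [cabs ((1 + _) * _)]cabsM ler_pdivrMr; last first.
  by rewrite mulr_gt0 // cabs_gt0.
have e1 : cabs (cexp (w s n.+1)) <= 1.
  rewrite cabs_cexp -expR0 ler_expR /w mulrC ReRM ReN mulrN oppr_le0 mulr_ge0 //.
  exact: del_ge0.
have h1 : cabs (cexp (w s n.+1) * (1 - cexp (w s n - w s n.+1))) <=
    2 * cabs s * (del n - del n.+1).
  rewrite cabsM -[leRHS]mul1r; apply: ler_pM; rewrite ?cabs_ge0 // cabsB.
  by apply: le_trans (cexp_small wl) _; rewrite wE mulrA.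
apply: le_trans h1 _; rewrite ler_peMr ?mulr_ge0 ?cabs_ge0 //.
by have := ler_pM ler01 ler01 (den_ge1 Nn) (den_ge1 NSn); rewrite mulr1.
Qed.

(** Summation by parts: the two boundary terms give 2, and the total variation of A, at most 2 |s|
    del N <= 1, gives the third unit. It allows eta to be replaced, up to O(1), by a Dirichlet
    polynomial of length comparable to |s|. *)
Lemma alt_tail M : (N <= M)%N -> cabs (alt M s - alt N s) <= 3 * cabs (npowN N.+1 s).
Proof.
move=> NM; set T := cabs (npowN N.+1 s).
have T0 : 0 <= T by exact: cabs_ge0.
have uT n : (N <= n)%N -> cabs (u n) <= T.
  by move=> Nn; rewrite /u cabsM cabs_sgn mul1r; exact: cabs_npowN_mono.
have -> : alt M s - alt N s = \sum_(N <= n < M) u n.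
  by rewrite /alt (big_cat_nat (n := N)) //= addrAC subrr add0r.
have -> : \sum_(N <= n < M) u n = (u M * A M - u N * A N) -
    \sum_(N <= n < M) u n.+1 * (A n.+1 - A n).
  rewrite -(@telescope_sumr _ _ _ (fun n => u n * A n)) // -sumrB.
  by apply: eq_big_nat => n /andP[Nn _]; exact: u_abel.
apply: le_trans (cabs_triB _ _) _.
have h1 : cabs (u M * A M - u N * A N) <= 2 * T.
  apply: le_trans (cabs_triB _ _) _; rewrite [cabs (u M * A M)]cabsM [cabs (u N * A N)]cabsM.
  have := ler_pM (cabs_ge0 _) (cabs_ge0 _) (uT M NM) (A_le NM).
  have := ler_pM (cabs_ge0 _) (cabs_ge0 _) (uT N (leqnn _)) (A_le (leqnn N)).
  lra.
have h2 : cabs (\sum_(N <= n < M) u n.+1 * (A n.+1 - A n)) <= T * (2 * cabs s * (del N - del M)).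
  apply: le_trans (cabs_sum _ _ _) _.
  have -> : del N - del M = \sum_(N <= n < M) (del n - del n.+1).
    by rewrite -opprB -(@telescope_sumr _ _ _ del) // -sumrN; apply: eq_bigr => n _; rewrite opprB.
  rewrite !mulr_sumr; apply: ler_sum_nat => n /andP[Nn _].
  rewrite cabsM; apply: ler_pM; rewrite ?cabs_ge0 ?dA // uT //; exact: leqW.
have h3 : 2 * cabs s * (del N - del M) <= 1.
  apply: (@le_trans _ _ (2 * cabs s * del N)).
    by rewrite ler_wpM2l ?mulr_ge0 ?cabs_ge0 // gerBl; exact: del_ge0.
  apply: le_trans (ler_wpM2l _ (del_le N)) _; first by rewrite mulr_ge0 // cabs_ge0.
  by rewrite ler_pdivrMr ?ltr0n // mul1r.
have := ler_wpM2l T0 h3; lra.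
Qed.

End Tail.

Lemma npowN_small e : 0 < e -> exists N0, forall N s, (N0 <= N)%N -> 2^-1 <= Re s ->
  cabs (npowN N.+1 s) <= e.
Proof.
(* The modulus is at most (N + 1) ^ (-1/2), which is below e as soon as N + 1 >= 1 / e^2. *)
move=> e0; exists (Num.truncn (e ^- 2)).+1 => N s N0 sh.
have h : e ^- 2 <= N.+1%:R.
  apply: le_trans (ltW (truncnS_gt _)) _; rewrite ler_nat; exact: leqW.
rewrite cabs_npowN mulNr expRN; apply: (@le_trans _ _ (expR (2^-1 * ln N.+1%:R))^-1).
  by rewrite lef_pV2 ?posrE ?expR_gt0 // ler_expR ler_wpM2r // ln_nat_ge0.
rewrite -[leRHS]invrK lef_pV2 ?posrE ?expR_gt0 ?invr_gt0 //.
rewrite -[leLHS]lnK ?posrE ?invr_gt0 // ler_expR.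
rewrite mulrC ler_pdivlMr // mulr_natr -lnXn ?invr_gt0 // exprVn.
by rewrite ler_ln ?posrE ?invr_gt0 ?exprn_gt0 ?ltr0n.
Qed.

Definition eta s : C := xget 0 [set l | limto (fun n => alt n s) l].

Lemma eta_lim s : 2^-1 <= Re s -> limto (fun n => alt n s) (eta s).
Proof.
move=> sh; have [l hl] : exists l, limto (fun n => alt n s) l.
  apply: cauchy_C => e e0; have [N1 hN1] := npowN_small (divr_gt0 e0 (ltr0n R 6)).
  pose N2 := (Num.truncn (2 * cabs s)).+1; pose N := maxn N1 N2.
  have hN : 2 * cabs s <= N.+1%:R.
    apply: le_trans (ltW (truncnS_gt _)) _; rewrite ler_nat; exact: leqW (leq_maxr _ _).
  have s0 : 0 <= Re s by lra.
  exists N => m n Nm Nn; have := hN1 N s (leq_maxl _ _) sh.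
  have := alt_tail s0 hN Nm; have := alt_tail s0 hN Nn => h1 h2 h3.
  apply: le_trans (cabs_dist (alt N s) _ _) _; rewrite [cabs (alt N s - _)]cabsB; lra.
by rewrite /eta; case: xgetP => [m _ //|/(_ l)].
Qed.

Lemma eta_tail s N : 2^-1 <= Re s -> 2 * cabs s <= N.+1%:R ->
  cabs (alt N s - eta s) <= 3 * cabs (npowN N.+1 s).
Proof.
move=> sh sN; have s0 : 0 <= Re s by lra.
rewrite cabsB; apply: (limto_le (limtoB (eta_lim sh) (limto_cst (alt N s)))).
by exists N => n; exact: alt_tail.
Qed.

Lemma eta_approx s N : 2^-1 <= Re s -> 2 * cabs s <= N.+1%:R ->
  cabs (eta s) <= cabs (alt N s) + 3.
Proof.
move=> sh sN; have := eta_tail sh sN; have s0 : 0 <= Re s by lra.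
have := cabs_npowN_le1 N s0; have := cabs_rtriB (eta s) (alt N s).
by rewrite [cabs (eta s - _)]cabsB; lra.
Qed.

Lemma cabs_alt_le N s : 0 <= Re s -> cabs (alt N s) <= N%:R.
Proof.
move=> s0; apply: le_trans (cabs_sum _ _ _) _.
have -> : N%:R = \sum_(0 <= n < N) 1 :> R by rewrite sumr_const_nat subn0.
by apply: ler_sum_nat => n _; rewrite cabsM cabs_sgn mul1r cabs_npowN_le1.
Qed.

Lemma eta_growth s : 2^-1 <= Re s -> cabs (eta s) <= 2 * cabs s + 4.
Proof.
move=> sh; pose N := Num.truncn (2 * cabs s).
have h : 2 * cabs s <= N.+1%:R by exact: ltW (truncnS_gt _).
have s0 : 0 <= Re s by lra.
have := eta_approx sh h; have := cabs_alt_le N s0.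
have : N%:R <= 2 * cabs s by rewrite truncn_le ?mulr_ge0 ?cabs_ge0.
lra.
Qed.

Lemma hol_npowN U n : hol U (npowN (R := R) n).
Proof.
apply: hol_cexp; apply: holM; last exact: hol_cst.
by apply: holN; exact: hol_id.
Qed.

Lemma hol_eta : hol (rhalf (2^-1)) eta.
Proof.
apply: (@hol_limit R _ alt) => [|n|z zh]; first exact: copen_rhalf.
  apply: hol_sum => i; apply: holM; [exact: hol_cst|exact: hol_npowN].
have [r r0 sub] := open_disc_sub (@copen_rhalf R _) zh.
exists r => // e e0; have [N1 hN1] := npowN_small (divr_gt0 e0 (ltr0n R 3)).
pose N2 := (Num.truncn (2 * (cabs z + r))).+1.
exists (maxn N1 N2) => n; rewrite geq_max => /andP[n1 n2] x xr.
have xh : 2^-1 <= Re x by apply: ltW; exact: sub xr.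
have xn : 2 * cabs x <= n.+1%:R.
  apply: (@le_trans _ _ (2 * (cabs z + r))).
    rewrite ler_wpM2l //; have := cabs_rtriB x z; rewrite /cdisc in xr; lra.
  by apply: le_trans (ltW (truncnS_gt _)) _; rewrite ler_nat; exact: leqW.
apply: le_trans (eta_tail xh xn) _; have := hN1 n x n1 xh; lra.
Qed.

Lemma zsum_lim s : 2 <= Re s -> exists Z, limto (fun n => zsum n s) Z.
Proof.
move=> s2; apply: cauchy_C => e e0.
pose N := (Num.truncn (2 / e)).+1.
have hN : 2 / e <= N%:R by exact: ltW (truncnS_gt _).
have N0 : 0 < N%:R :> R by rewrite ltr0n.
have term n : (0 < n)%N -> cabs (npowN n.+1 s) <= n%:R^-1 - n.+1%:R^-1.
  move=> n0; rewrite cabs_npowN mulNr expRN.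
  have n0' : 0 < n%:R :> R by rewrite ltr0n.
  have -> : n%:R^-1 - n.+1%:R^-1 = (n%:R * n.+1%:R)^-1 :> R.
    by rewrite -natr1; field; rewrite gt_eqF //= gt_eqF //; lra.
  rewrite lef_pV2 ?posrE ?expR_gt0 ?mulr_gt0 ?ltr0n //.
  apply: (@le_trans _ _ (expR (2 * ln n.+1%:R))); last first.
    by rewrite ler_expR ler_wpM2r // ln_nat_ge0.
  rewrite [2 * _]mulr_natl -lnXn ?ltr0n // lnK ?posrE ?exprn_gt0 ?ltr0n // expr2.
  by rewrite ler_wpM2r ?ler0n // ler_nat.
have tail M : (N <= M)%N -> cabs (zsum M s - zsum N s) <= N%:R^-1 - M%:R^-1.
  move=> NM; rewrite /zsum (big_cat_nat (n := N)) //= addrAC subrr add0r.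
  apply: le_trans (cabs_sum _ _ _) _.
  have -> : N%:R^-1 - M%:R^-1 = \sum_(N <= n < M) (n%:R^-1 - n.+1%:R^-1) :> R.
    by rewrite -opprB -(@telescope_sumr _ _ _ (fun n : nat => n%:R^-1 : R)) // -sumrN; apply: eq_bigr => n _; rewrite opprB.
  by apply: ler_sum_nat => n /andP[Nn _]; apply: term; exact: leq_trans Nn.
have Ne : N%:R^-1 <= e / 2.
  by rewrite -[leRHS]invrK lef_pV2 ?posrE ?invr_gt0 ?divr_gt0 // invf_div.
exists N => m n Nm Nn.
have h1 := tail m Nm; have h2 := tail n Nn.
have i1 : 0 <= m%:R^-1 :> R by rewrite invr_ge0 ler0n.
have i2 : 0 <= n%:R^-1 :> R by rewrite invr_ge0 ler0n.
apply: le_trans (cabs_dist (zsum N s) _ _) _; rewrite [cabs (zsum N s - _)]cabsB; lra.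
Qed.

(** The limit of [alt_zsum] along partial sums of even length. *)
Lemma eta_zeta s Z : 2 <= Re s -> limto (fun n => zsum n s) Z -> kap s * Z = eta s.
Proof.
move=> s2 sZ; have sh : 2^-1 <= Re s by lra.
have dbl n : (n <= n.*2)%N by rewrite -addnn leq_addr.
have h1 := limto_subseq dbl (eta_lim sh).
have h2 := limtoB (limto_subseq dbl sZ) (limtoM (limto_cst (2 * npowN 2 s)) sZ).
apply: limto_unique (limto_ext _ h1); last by move=> n; rewrite alt_zsum.
by rewrite /kap mulrBl mul1r.
Qed.

End Eta.

(** * Mean square of the partial sums of eta *)

Section MeanSquare.
Variable R : realType.
Local Notation C := (complex R).

Lemma is_derive_bigsum (I : Type) (s : seq I) (F : I -> R -> R) (F' : I -> R) (t : R) :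
  (forall i, is_derive t 1 (F i) (F' i)) ->
  is_derive t 1 (fun x => \sum_(i <- s) F i x) (\sum_(i <- s) F' i).
Proof.
move=> dF; elim: s => [|i s IH].
  have -> : (fun x => \sum_(i <- [::]) F i x) = cst 0.
    by apply/funext => x; rewrite big_nil.
  by rewrite big_nil; exact: is_derive_cst.
have -> : (fun x => \sum_(i <- i :: s) F i x) = (F i + (fun x => \sum_(i <- s) F i x)).
  by apply/funext => x; rewrite big_cons.
by rewrite big_cons; exact: is_deriveD.
Qed.

Definition harm (N : nat) : R := \sum_(0 <= n < N) n.+1%:R^-1.

Lemma harm_ge0 N : 0 <= harm N.
Proof. by apply: sumr_ge0 => n _; rewrite invr_ge0 ler0n. Qed.

Lemma harm_mono M N : (M <= N)%N -> harm M <= harm N.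
Proof.
move=> MN; rewrite /harm (big_cat_nat (n := M) (p := N)) //= lerDl.
by apply: sumr_ge0 => n _; rewrite invr_ge0 ler0n.
Qed.

Lemma harm_ln N : harm N.+1 <= 1 + ln N.+1%:R.
Proof.
elim: N => [|N IH]; first by rewrite /harm big_nat1 ln1 addr0 invr1.
rewrite /harm big_nat_recr //= -/(harm _).
have h1 : -1 < - N.+2%:R^-1 :> R by rewrite ltrN2 invf_lt1 ?ltr0n // ltr1n.
have := le_ln1Dx h1.
have -> : 1 + - N.+2%:R^-1 = N.+1%:R / N.+2%:R :> R.
  rewrite -[N.+2]addn1 natrD; have : 0 < N.+1%:R :> R by rewrite ltr0n.
  move: (N.+1%:R : R) => x x0; field; rewrite gt_eqF //; lra.
rewrite ln_div ?posrE ?ltr0n // => H.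
apply: le_trans (lerD IH (lexx _)) _; rewrite -addrA lerD2l.
move: H; move: (ln N.+1%:R) (ln N.+2%:R) (N.+2%:R^-1 : R) => A B x; lra.
Qed.

(** With truncated subtraction, [q (m - n)] is 1 / (m - n) for n < m and 0 otherwise, so
    [q (m - n) + q (n - m)] is 1 / |m - n| off the diagonal. *)
Let q (k : nat) : R := if k is 0 then 0 else k%:R^-1.

Lemma sum_q_sub m N : \sum_(0 <= n < N) q (n - m) = harm (N - m).-1.
Proof.
elim: N => [|N IH]; first by rewrite big_geq // sub0n /harm big_geq.
rewrite big_nat_recr //= IH; have [Nm|mN] := leqP N m.
  have /eqP -> : (N - m == 0)%N by rewrite subn_eq0.
  rewrite /= addr0; have [->|neq] := eqVneq N m.
    by rewrite subSnn.
  have /eqP -> : (N.+1 - m == 0)%N by rewrite subn_eq0 ltn_neqAle neq.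
  by [].
rewrite subSn ?(ltnW mN) //=; have : (0 < N - m)%N by rewrite subn_gt0.
by case: (N - m)%N => // k _ /=; rewrite /harm [in RHS]big_nat_recr.
Qed.

Lemma sum_q_le m N : \sum_(0 <= n < N) q (n - m) <= harm N.
Proof. rewrite sum_q_sub; apply: harm_mono; lia. Qed.

Section Fixed.
Variables (N : nat) (sg : R).
Hypothesis sg2 : 2^-1 <= sg.

Let th n : R := ln n.+1%:R.
Let c n : R := (-1) ^+ n * expR (- sg * th n).
(** The primitive of [W' m n]: the square of the polynomial is expanded into cosines and integrated
    term by term. *)
Let W (m n : nat) (t : R) : R := if m == n then t else sin ((th m - th n) * t) / (th m - th n).
Let W' m n (t : R) : R := cos ((th m - th n) * t).

Let th_inj m n : m != n -> th m - th n != 0.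
Proof.
move=> mn; rewrite subr_eq0; apply: contra mn => /eqP /ln_inj.
by rewrite !posrE !ltr0n => /(_ isT isT) /eqP; rewrite eqr_nat.
Qed.

Let dW (m n : nat) (t : R) : is_derive t 1 (W m n) (W' m n t).
Proof.
rewrite /W /W'; have [->|mn] := eqVneq m n.
  by rewrite subrr mul0r cos0; exact: is_derive_id.
have d := @is_derive1_comp _ sin (fun x : R => (th m - th n) * x) t _ _
   (is_derive_sin _) (is_derive_lin (th m - th n) t).
have -> : (fun t0 : R => sin ((th m - th n) * t0) / (th m - th n)) =
   (th m - th n)^-1 *: (sin \o (fun x : R => (th m - th n) * x)).
  by apply/funext => x; rewrite /= mulrC.
apply: is_derive_eq; rewrite /GRing.scale /= mulrC -mulrA divff ?mulr1 //; exact: th_inj.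
Qed.

Let V t : R := \sum_(0 <= m < N) \sum_(0 <= n < N) c m * c n * W m n t.

Let npowE n t : npowN n.+1 (Complex sg t) =
  Complex (expR (- sg * th n) * cos (th n * t)) (- (expR (- sg * th n) * sin (th n * t))).
Proof.
rewrite /npowN.
have -> : - (Complex sg t) * (ln n.+1%:R)%:C%C = Complex (- sg * th n) (- (th n * t)).
  by apply: complex_eq; rewrite ?(ReM, ImM) /= /th; ring.
by rewrite /cexp /= cosN sinN mulrN.
Qed.

Let alt_sq t : cabs (alt N (Complex sg t)) ^+ 2 =
  \sum_(0 <= m < N) \sum_(0 <= n < N) c m * c n * W' m n t.
Proof.
have sgE n : (-1) ^+ n = ((-1) ^+ n : R)%:C%C :> C by rewrite rmorphXn rmorphN1.
have ReE : Re (alt N (Complex sg t)) = \sum_(0 <= n < N) c n * cos (th n * t).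
  rewrite /alt (big_morph _ (@ReD R) (erefl _)); apply: eq_bigr => n _.
  by rewrite sgE ReRM npowE /= /c mulrA.
have ImE : Im (alt N (Complex sg t)) = - \sum_(0 <= n < N) c n * sin (th n * t).
  rewrite /alt (big_morph _ (@ImD R) (erefl _)) -sumrN; apply: eq_bigr => n _.
  by rewrite sgE ImRM npowE /= /c mulrN mulrA.
rewrite cabs_sqr ReE ImE sqrrN !expr2 !mulr_suml -big_split /=.
apply: eq_bigr => m _; rewrite !mulr_sumr -big_split /=.
apply: eq_bigr => n _; rewrite /W' mulrBl cosB; ring.
Qed.

Let dV (t : R) : is_derive t 1 V (cabs (alt N (Complex sg t)) ^+ 2).
Proof.
rewrite alt_sq; apply: is_derive_bigsum => m; apply: is_derive_bigsum => n.
exact: (@is_deriveZ _ R^o R^o (W m n) (c m * c n) t 1 _ (dW m n t)).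
Qed.

(** From sg >= 1/2 the product is at most ((m + 1) (n + 1)) ^ (-1/2), and the smaller index
    dominates. *)
Let c_le m n : (n <= m)%N -> `|c m * c n| <= n.+1%:R^-1.
Proof.
move=> nm; rewrite normrM /c !normrM !normrX normrN1 !expr1n !mul1r !ger0_norm ?expR_ge0 //.
rewrite -expRD -[leRHS]lnK ?posrE ?invr_gt0 ?ltr0n // ler_expR lnV ?posrE ?ltr0n //.
have h1 : th n <= th m by exact: ln_nat_mono.
have h0 : 0 <= th n by exact: ln_nat_ge0.
have hs : 0 <= th m + th n by lra.
have := ler_wpM2r hs sg2; rewrite -/(th n); lra.
Qed.

Let gap m n : (n < m)%N -> (m - n)%:R / m.+1%:R <= th m - th n.
Proof.
move=> nm.
have m0 : (0 : R) < m.+1%:R by rewrite ltr0n.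
have n0 : (0 : R) < n.+1%:R by rewrite ltr0n.
have p : 0 < n.+1%:R / m.+1%:R :> R by rewrite divr_gt0.
have h1 : -1 < n.+1%:R / m.+1%:R - 1 :> R by rewrite ltrBrDl subrr.
have := le_ln1Dx h1.
have -> : 1 + (n.+1%:R / m.+1%:R - 1) = n.+1%:R / m.+1%:R :> R by ring.
rewrite ln_div ?posrE // -/(th n) -/(th m).
have -> : (m - n)%:R / m.+1%:R = 1 - n.+1%:R / m.+1%:R :> R.
  rewrite natrB ?(ltnW nm) // -[m.+1]addn1 -[n.+1]addn1 !natrD; field.
  by rewrite natr1 gt_eqF.
by move=> H; rewrite -lerN2 !opprB.
Qed.

(** By [c_le] and [gap] the quotient is at most (m + 1) / ((n + 1) (m - n)), which splits as 1 / (m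
    - n) + 1 / (n + 1). *)
Let off m n : (n < m)%N -> `|c m * c n| / (th m - th n) <= q (m - n) + n.+1%:R^-1.
Proof.
move=> nm; have g := gap nm.
have m0 : (0 : R) < m.+1%:R by rewrite ltr0n.
have n0 : (0 : R) < n.+1%:R by rewrite ltr0n.
have d0 : (0 : R) < (m - n)%:R by rewrite ltr0n subn_gt0.
have gp : 0 < (m - n)%:R / m.+1%:R :> R by rewrite divr_gt0.
apply: (@le_trans _ _ (n.+1%:R^-1 / ((m - n)%:R / m.+1%:R))).
  apply: ler_pM; rewrite ?normr_ge0 ?invr_ge0 ?c_le ?(ltnW nm) //.
    exact: le_trans (ltW gp) g.
  by rewrite lef_pV2 ?posrE //; exact: lt_le_trans gp g.
have -> : q (m - n) = (m - n)%:R^-1 by move: nm; rewrite -subn_gt0; case: (m - n)%N.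
have E : m.+1%:R = (m - n)%:R + n.+1%:R :> R by rewrite -natrD; congr _%:R; lia.
rewrite E le_eqVlt; apply/orP; left; apply/eqP; field.
by rewrite !gt_eqF // addr_gt0.
Qed.

Let Wdiff m n (a b : R) : a <= b -> c m * c n * W m n b - c m * c n * W m n a <=
  (if m == n then (b - a) * m.+1%:R^-1 else 0) +
  2 * (q (m - n) + q (n - m) + m.+1%:R^-1 + n.+1%:R^-1).
Proof.
move=> ab.
have q0 k : 0 <= q k by case: k => [|k] /=; rewrite ?lexx ?invr_ge0 ?ler0n.
have i0 k : (0 : R) <= k.+1%:R^-1 by rewrite invr_ge0 ler0n.
set X := c m * c n.
rewrite /W; case: eqVneq => [mn|mn].
  have h : X <= m.+1%:R^-1.
    by apply: le_trans (ler_norm _) _; rewrite /X mn; exact: c_le (leqnn n).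
  rewrite -mulrBr mulrC; apply: (@le_trans _ _ ((b - a) * m.+1%:R^-1)).
    by rewrite ler_wpM2l ?subr_ge0.
  by rewrite lerDl mulr_ge0 // !addr_ge0.
have bnd : `|X| / `|th m - th n| <= q (m - n) + q (n - m) + m.+1%:R^-1 + n.+1%:R^-1.
  have [nm|nm] := leqP m n; last first.
    have t0 : 0 <= th m - th n by rewrite subr_ge0 ln_nat_mono // ltnW.
    rewrite (ger0_norm t0); apply: le_trans (off nm) _.
    by rewrite lerD2r -addrA lerDl addr_ge0.
  have nm' : (m < n)%N by rewrite ltn_neqAle mn.
  have t0 : 0 <= th n - th m by rewrite subr_ge0 ln_nat_mono.
  rewrite distrC (ger0_norm t0) /X [c m * _]mulrC; apply: le_trans (off nm') _.
  have := q0 (m - n)%N; have := i0 n.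
  move: (q (m - n)%N) (q (n - m)%N) (m.+1%:R^-1 : R) (n.+1%:R^-1 : R) => A B D E; lra.
rewrite add0r -mulrBr -mulrBl.
set S := sin _ - sin _.
have S2 : `|S| <= 2.
  apply: le_trans (ler_normB _ _) _; apply: le_trans (lerD (sin_max _) (sin_max _)) _.
  lra.
apply: le_trans (ler_norm _) _.
have -> : X * (S / (th m - th n)) = S * (X / (th m - th n)) by ring.
rewrite normrM; apply: ler_pM => //.
by rewrite normrM normfV.
Qed.

(** The diagonal contributes (b - a) times the harmonic sum. Off the diagonal each of the four sums
    in [Wdiff] is at most N times the harmonic sum, and the factor 2 from the difference of two
    sines makes 8. *)
Lemma mean_square : exists V : R -> R,
  (forall t : R, is_derive t 1 V (cabs (alt N (Complex sg t)) ^+ 2)) /\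
  forall a b, a <= b -> V b - V a <= ((b - a) + 8 * N%:R) * harm N.
Proof.
exists V; split=> // a b ab; rewrite /V -sumrB.
apply: (@le_trans _ _ (\sum_(0 <= m < N) ((b - a) * m.+1%:R^-1 +
   2 * (\sum_(0 <= n < N) q (m - n) + harm N + N%:R * m.+1%:R^-1 + harm N)))).
  apply: ler_sum_nat => m /andP[_ mN]; rewrite -sumrB.
  apply: (@le_trans _ _ (\sum_(0 <= n < N) ((if m == n then (b - a) * m.+1%:R^-1 else 0) +
    2 * (q (m - n) + q (n - m) + m.+1%:R^-1 + n.+1%:R^-1)))).
    by apply: ler_sum_nat => n _; exact: Wdiff.
  rewrite big_split /= -mulr_sumr !big_split /=.
  have -> : \sum_(0 <= n < N) (if m == n then (b - a) * m.+1%:R^-1 else 0) = (b - a) * m.+1%:R^-1.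
    rewrite big_mkord (bigD1 (Ordinal mN)) //= eqxx big1 ?addr0 // => i.
    by rewrite -val_eqE /= eq_sym => /negbTE ->.
  rewrite lerD2l ler_wpM2l // lerD2r; apply: lerD; last first.
    by rewrite sumr_const_nat subn0 mulr_natl.
  by rewrite lerD2l sum_q_le.
rewrite big_split /= -!mulr_sumr !big_split /= -mulr_sumr exchange_big /=.
rewrite -/(harm N) sumr_const_nat subn0.
have : \sum_(0 <= n < N) \sum_(0 <= m < N) q (m - n) <= N%:R * harm N.
  have -> : N%:R * harm N = \sum_(0 <= n < N) harm N by rewrite sumr_const_nat subn0 mulr_natl.
  by apply: ler_sum_nat => n _; exact: sum_q_le.
rewrite -mulr_natl; lra.
Qed.

End Fixed.
End MeanSquare.

(** * Jensen's inequality on a half disc *)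

Section HalfDisc.
Variable R : realType.
Local Notation C := (complex R).
Local Notation rc := (fun x : R => x%:C%C).

(** An open convex neighbourhood of the closed right half of the unit disc; being zero-free there
    provides a logarithm up to the boundary. *)
Definition hdisc (eta : R) (z : C) := rhalf (- eta) z /\ cdisc 0 (1 + eta) z.

Lemma copen_hdisc eta : copen (hdisc eta).
Proof. by apply: copenI; [exact: copen_rhalf|exact: copen_disc]. Qed.
Lemma nice_hdisc eta : nice (hdisc eta).
Proof. by apply: niceI; [exact: nice_rhalf|exact: nice_disc]. Qed.

Lemma in_hdisc eta z : 0 < eta -> 0 <= Re z -> cabs z <= 1 -> hdisc eta z.
Proof. by move=> e0 z0 z1; split; rewrite /rhalf /cdisc ?subr0; lra. Qed.

Let c : C := (2^-1)%:C%C.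

Lemma half_in eta : 0 < eta -> hdisc eta c.
Proof.
have h0 : 0 <= 2^-1 :> R by rewrite invr_ge0.
by move=> e0; apply: in_hdisc; rewrite // cabs_real ger0_norm // invf_le1 // ler1n.
Qed.

Definition earc (t : R) : C := Complex (cos t) (sin t).
Lemma cabs_earc t : cabs (earc t) = 1.
Proof. by rewrite /cabs /= cos2Dsin2 sqrtr1. Qed.
Lemma rdif_earc t : dif rc earc t (Complex 0 1 * earc t).
Proof.
have := rdif_Complex (is_derive_cos t) (is_derive_sin t).
by apply: rdif_conv; apply: complex_eq; rewrite ?(ReM, ImM) /=; ring.
Qed.

(* 4 / (4 z^2 - 1) + 4 / (4 - z^2), multiplied by z - 1/2: up to orientation,
   the logarithmic derivative of the Green function of the half disc with pole
   at 1/2. *)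
Let kt (z : C) : C := 2 / (2 * z + 1) + 2 * (2 * z - 1) / (4 - z ^+ 2).

Section Mean.
Variables (eta : R) (G : C -> C).
Hypotheses (eta_gt0 : 0 < eta) (eta_le : eta <= 4^-1).
Hypotheses (hG : hol (hdisc eta) G) (G0 : forall z, hdisc eta z -> G z != 0).

Let den1 z : hdisc eta z -> 2 * z + 1 != 0.
Proof.
move=> [z1 _]; apply/eqP => /(congr1 (@complex.Re R)).
have -> : (2 : C) = (2 : R)%:C%C by rewrite rmorph_nat.
rewrite ReD ReRM /= => h; have := eta_le; rewrite /rhalf in z1; lra.
Qed.

Let den2 z : hdisc eta z -> 4 - z ^+ 2 != 0.
Proof.
move=> [_ z1]; rewrite /cdisc subr0 in z1.
have h := cabs_rtriB 4 (z ^+ 2); rewrite cabs_nat cabsX in h.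
rewrite -cabs_gt0; apply: lt_le_trans h; have z0 := cabs_ge0 z; have := eta_le; nra.
Qed.

(** Poisson's formula at 1/2 as an inequality. H is the logarithm of G / G c; since H c = 0, H times
    the derivative of the Green function has no pole, so it has a primitive F. The increments of Im
    F along diameter and arc cancel, and they are the integrals of ln |G| - ln |G c| against the
    Poisson densities. *)
Lemma halfdisc_mean (u P : R -> R) (K : R) :
  (forall y : R, -1 <= y <= 1 -> is_derive y 1 P (u y)) ->
  (forall y, -1 <= y <= 1 -> 0 <= u y) ->
  (forall y, -1 <= y <= 1 -> ln (cabs (G (Complex 0 (- y)))) <= u y) ->
  0 <= K ->
  (forall z, cabs z = 1 -> 0 <= Re z -> Re z * ln (cabs (G z)) <= K) ->
  0 <= ln (cabs (G c)) ->
  ln (cabs (G c)) <= 2 * pi * K + 3 * (P 1 - P (- 1)).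
Proof.
move=> dP u0 uG K0 KG l0; set l := ln (cabs (G c)) in l0 *.
have cU := half_in eta_gt0.
have oU := @copen_hdisc eta; have nU := @nice_hdisc eta.
have [H [hH Hc HE]] := hol_log oU nU hG G0 cU.
have [Q [hQ QE]] := hol_quot oU hH cU.
have Gc0 : 0 < cabs (G c) by rewrite cabs_gt0 G0.
have lnG z : hdisc eta z -> ln (cabs (G z)) = l + Re (H z).
  move=> Uz; rewrite (HE z Uz) cabsM cabs_cexp lnM ?posrE ?expR_gt0 //.
  by rewrite expRK.
have h2 : hol (hdisc eta) (fun z : C => 2 * z).
  by apply: holM; [exact: hol_cst|exact: hol_id].
have hkt : hol (hdisc eta) kt.
  apply: holD; apply: holM.
  - exact: hol_cst.
  - apply: holV => //; apply: holD => //; exact: hol_cst.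
  - by apply: holM; [exact: hol_cst|apply: holB => //; exact: hol_cst].
  - apply: holV => //; apply: holB; first exact: hol_cst.
    by move=> z _; exists (2%:R * z ^+ 2.-1 * 1); apply: dif_pow; exact: dif_id.
have hPhi : hol (hdisc eta) (fun z => Q z * kt z) by exact: holM.
have dF := hol_primitive oU nU hPhi cU.
set F := cseg _ c in dF.
have cE : c = 2^-1 by rewrite /c fmorphV rmorph_nat.
have PhiE z k : hdisc eta z -> z - c != 0 -> kt z = k * (z - c) -> Q z * kt z = H z * k.
  by move=> Uz zc ->; rewrite QE Hc add0r; ring.
have arc_in (t : R) : - (pi / 2) <= t <= pi / 2 -> hdisc eta (earc t).
  by move=> t2; apply: in_hdisc; rewrite ?cabs_earc //= cos_ge0_pihalf.
(* 2 pi times the density of harmonic measure at 1/2 on the arc. The denominator lies between 9 and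
   25, so w2 lies between 24/25 cos t and 8/3 cos t; [w1] below is the corresponding density on the
   diameter. *)
pose w2 t : R := 24 * cos t / (9 * cos t ^+ 2 + 25 * sin t ^+ 2).
have w2den (t : R) : 9 <= 9 * cos t ^+ 2 + 25 * sin t ^+ 2 <= 25.
  have := cos2Dsin2 t; have := sqr_ge0 (cos t); have := sqr_ge0 (sin t) => a b d; lra.
have dA (t : R) : - (pi / 2) <= t <= pi / 2 ->
    is_derive t 1 (fun t => Im (F (earc t))) (w2 t * (ln (cabs (G (earc t))) - l)).
  move=> t2; have Ut := arc_in t t2.
  have := rdif_Im (dif_comp (rdif_earc t) (dF _ Ut)); set d1 := (X in is_derive _ _ _ X).
  suff -> : d1 = w2 t * (ln (cabs (G (earc t))) - l) by [].
  have zc : earc t - c != 0.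
    apply/eqP => /eqP; rewrite subr_eq0 => /eqP E; have := cabs_earc t; rewrite E cabs_real.
    rewrite ger0_norm ?invr_ge0 //; lra.
  have /andP[q1 q2] := w2den t.
  have e0 : earc t != 0 by rewrite -cabs_gt0 cabs_earc.
  have kE : kt (earc t) = ((w2 t)%:C%C / earc t) * (earc t - c).
    have n1 := den1 Ut; have n2 := den2 Ut.
    set e := earc t in zc e0 n1 n2 *.
    pose A := Complex (3 * cos t) (5 * sin t); pose B := Complex (3 * cos t) (- (5 * sin t)).
    have r4 : 4 = (4 : R)%:C%C :> C by rewrite rmorph_nat.
    have cs := cos2Dsin2 t.
    have eA : (2 * e + 1) * (2 * e - 1) = e * A.
      have -> : (2 * e + 1) * (2 * e - 1) = 4 * (e * e) - 1 by ring.
      by rewrite r4; apply: complex_eq; rewrite !(ReB, ImB, ReRM, ImRM, ReM, ImM) /=; lra.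
    have eB : 4 - e ^+ 2 = e * B.
      by rewrite r4 expr2; apply: complex_eq; rewrite !(ReB, ImB, ReM, ImM) /=; lra.
    have AB : A * B = (9 * cos t ^+ 2 + 25 * sin t ^+ 2)%:C%C.
      by apply: complex_eq; rewrite !(ReM, ImM) /=; lra.
    have D0 : (9 * cos t ^+ 2 + 25 * sin t ^+ 2)%:C%C != 0 :> C.
      by rewrite fmorph_eq0 gt_eqF //; lra.
    have A0 : A != 0 by apply: contraNneq D0 => E; rewrite -AB E mul0r.
    have B0 : B != 0 by apply: contraNneq D0 => E; rewrite -AB E mulr0.
    have sum : (24 * cos t)%:C%C = 4 * (A + B).
      by rewrite r4; apply: complex_eq; rewrite !(ReRM, ImRM, ReD, ImD) /=; lra.
    have m0 : 2 * e - 1 != 0.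
      have -> : 2 * e - 1 = 2 * (e - c) by rewrite cE; field.
      by rewrite mulf_neq0 // pnatr_eq0.
    have -> : (w2 t)%:C%C = (24 * cos t)%:C%C / (9 * cos t ^+ 2 + 25 * sin t ^+ 2)%:C%C.
      by rewrite /w2 fmorph_div.
    rewrite -AB sum /kt eB cE.
    have -> : 2 / (2 * e + 1) = 2 * (2 * e - 1) / (e * A).
      by rewrite -eA; field; rewrite m0 n1.
    by field; rewrite A0 B0 e0.
  rewrite /d1 (PhiE _ _ Ut zc kE) lnG // [l + _]addrC addrK.
  have -> : H (earc t) * ((w2 t)%:C%C / earc t) * (Complex 0 1 * earc t) =
    (w2 t)%:C%C * (Complex 0 1 * H (earc t)) by field.
  by rewrite ImRM ImM /=; ring.
(* The diameter is run downwards, from i to -i, so that it closes up with the arc, which runs from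
   -i to i. *)
pose sg y : C := Complex 0 (- y).
pose w1 y : R := 4 / (1 + 4 * y ^+ 2) - 4 / (4 + y ^+ 2).
have sg_in (y : R) : -1 <= y <= 1 -> hdisc eta (sg y).
  move=> y1; apply: in_hdisc => //=.
  by rewrite /cabs /= expr0n add0r sqrrN sqrtr_sqr ler_norml.
have dB (y : R) : -1 <= y <= 1 ->
    is_derive y 1 (fun y => Im (F (sg y))) (w1 y * (ln (cabs (G (sg y))) - l)).
  move=> y1; have Us := sg_in y y1.
  have dsg : dif rc sg y (Complex 0 (-1)) by apply: rdif_Complex.
  have := rdif_Im (dif_comp dsg (dF _ Us)); set d1 := (X in is_derive _ _ _ X).
  suff -> : d1 = w1 y * (ln (cabs (G (sg y))) - l) by [].
  have zc : sg y - c != 0.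
    apply/eqP => /(congr1 (@complex.Re R)); rewrite ReB /=; lra.
  have kE : kt (sg y) = (- w1 y)%:C%C * (sg y - c).
    have n1 := den1 Us; have n2 := den2 Us.
    set e := sg y in zc n1 n2 *.
    have r4 : 4 = (4 : R)%:C%C :> C by rewrite rmorph_nat.
    have y2 := sqr_ge0 y.
    have eA : (2 * e + 1) * (2 * e - 1) = - (1 + 4 * y ^+ 2)%:C%C.
      have -> : (2 * e + 1) * (2 * e - 1) = 4 * (e * e) - 1 by ring.
      by rewrite r4; apply: complex_eq; rewrite !(ReB, ImB, ReN, ImN, ReRM, ImRM, ReM, ImM) /=; ring.
    have eB : 4 - e ^+ 2 = (4 + y ^+ 2)%:C%C.
      by rewrite r4 expr2; apply: complex_eq; rewrite !(ReB, ImB, ReM, ImM) /=; ring.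
    have A0 : (1 + 4 * y ^+ 2)%:C%C != 0 :> C by rewrite fmorph_eq0 gt_eqF //; lra.
    have B0 : (4 + y ^+ 2)%:C%C != 0 :> C by rewrite fmorph_eq0 gt_eqF //; lra.
    have m0 : 2 * e - 1 != 0.
      have -> : 2 * e - 1 = 2 * (e - c) by rewrite cE; field.
      by rewrite mulf_neq0 // pnatr_eq0.
    have -> : (- w1 y)%:C%C = - (4 / (1 + 4 * y ^+ 2)%:C%C - 4 / (4 + y ^+ 2)%:C%C).
      by rewrite /w1 rmorphN rmorphB !fmorph_div r4.
    rewrite /kt eB cE.
    have -> : 2 / (2 * e + 1) = 2 * (2 * e - 1) / (- (1 + 4 * y ^+ 2)%:C%C).
      by rewrite -eA; field; rewrite m0 n1.
    by move: (1 + 4 * y ^+ 2)%:C%C (4 + y ^+ 2)%:C%C A0 B0 => A B A0 B0; field; rewrite A0 B0.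
  rewrite /d1 (PhiE _ _ Us zc kE) lnG // [l + _]addrC addrK.
  rewrite [_ * (- w1 y)%:C%C]mulrC -mulrA ImRM ImM /=; ring.
have w1_ge0 (y : R) : -1 <= y <= 1 -> 0 <= w1 y <= 4.
  move=> y1; have y2 : y ^+ 2 <= 1 by rewrite -(expr1n _ 2) -[y ^+ 2]real_normK ?num_real // lerXn2r ?nnegrE // ler_norml.
  have y0 := sqr_ge0 y.
  have a0 : 0 < 1 + 4 * y ^+ 2 by lra.
  have b0 : 0 < 4 + y ^+ 2 by lra.
  rewrite /w1 subr_ge0; apply/andP; split.
    by rewrite ler_wpM2l // lef_pV2 ?posrE //; lra.
  apply: (@le_trans _ _ (4 / (1 + 4 * y ^+ 2))); first by rewrite gerBl divr_ge0 // ltW.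
  by rewrite ler_pdivrMr //; lra.
have pi2 : 0 <= pi :> R := pi_ge0 R.
(* Here ln |G c| is gained: w2 l >= 24/25 l cos t because l >= 0, and cos integrates to 2. *)
have I1 : Im (F (earc (pi / 2))) - Im (F (earc (- (pi / 2)))) <= 8 / 3 * K * pi - 48 / 25 * l.
  have dg (t : R) : is_derive t 1 ((fun t : R => (8 / 3 * K) * t) - (24 / 25 * l) *: sin)
      (8 / 3 * K - 24 / 25 * l * cos t).
    exact: (is_deriveB (is_derive_lin (8 / 3 * K) t)
      (@is_deriveZ _ R^o R^o sin (24 / 25 * l) t 1 _ (is_derive_sin t))).
  have ab : - (pi / 2) <= pi / 2 :> R by lra.
  have le1 t : - (pi / 2) <= t <= pi / 2 ->
      w2 t * (ln (cabs (G (earc t))) - l) <= 8 / 3 * K - 24 / 25 * l * cos t.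
    move=> t2; have /andP[q1 q2] := w2den t.
    have c0 : 0 <= cos t by rewrite cos_ge0_pihalf.
    have := KG (earc t) (cabs_earc t) c0; rewrite [Re _]/= => KGt.
    rewrite mulrBr; apply: lerB.
      have -> : w2 t * ln (cabs (G (earc t))) =
        24 * (cos t * ln (cabs (G (earc t)))) / (9 * cos t ^+ 2 + 25 * sin t ^+ 2).
        by rewrite /w2; ring.
      rewrite ler_pdivrMr; last by lra.
      have := ler_wpM2l K0 q1; lra.
    have -> : w2 t * l = 24 * (l * cos t) / (9 * cos t ^+ 2 + 25 * sin t ^+ 2).
      by rewrite /w2; ring.
    rewrite ler_pdivlMr; last by lra.
    have h1 := mulr_ge0 l0 c0; have := ler_wpM2l h1 q2; lra.
  have := mono_derive ab dA (fun t _ => dg t) le1.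
  rewrite !fctE /GRing.scale /= sinN sin_pihalf; lra.
have I2 : Im (F (sg 1)) - Im (F (sg (- 1))) <= 4 * P 1 - 4 * P (-1).
  have dg (y : R) : -1 <= y <= 1 -> is_derive y 1 (4 *: P) (4 * u y).
    by move=> y1; exact: (@is_deriveZ _ R^o R^o P 4 y 1 _ (dP y y1)).
  have ab : -1 <= 1 :> R by lra.
  have le1 y : -1 <= y <= 1 -> w1 y * (ln (cabs (G (sg y))) - l) <= 4 * u y.
    move=> y1; have /andP[q1 q2] := w1_ge0 y y1.
    apply: (@le_trans _ _ (w1 y * u y)).
      rewrite ler_wpM2l //; have := uG y y1; rewrite -/(sg y); lra.
    by rewrite ler_wpM2r // u0.
  by have := mono_derive ab dB dg le1.
have I3 : 0 <= P 1 - P (-1).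
  have ab : -1 <= 1 :> R by lra.
  have := mono_derive ab (fun y _ => is_derive_cst (0 : R) y 1) dP u0.
  by rewrite /cst subrr.
(* The two paths form a loop, so the left-hand sides of [I1] and [I2] add up to 0. Hence 48/25 l <=
   8/3 pi K + 4 (P 1 - P (-1)), and the constants 2 and 3 are rounded up from 25/18 and 25/12. *)
have E1 : sg 1 = earc (- (pi / 2)) by rewrite /earc cosN sinN cos_pihalf sin_pihalf.
have E2 : sg (-1) = earc (pi / 2) by rewrite /earc cos_pihalf sin_pihalf /sg opprK.
rewrite E1 E2 in I2.
have := mulr_ge0 pi2 K0; lra.
Qed.

End Mean.

Section Blaschke.

(* The numerator of the Blaschke factor (z - a) (1 + a z) / bnum a z of the half disc, which
   has modulus 1 on the boundary. *)
Definition bnum (a z : C) : C := (z + (a^*)%C) * (1 - (a^*)%C * z).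

Lemma mul_conj (x : C) : x * (x^*)%C = (cabs x ^+ 2)%:C%C.
Proof.
by rewrite cabs_sqr; case: x => u v; apply: complex_eq; rewrite ?(ReM, ImM) /=; ring.
Qed.

Lemma blaschke_side (a : C) (y : R) :
  cabs (bnum a (Complex 0 y)) = cabs (Complex 0 y - a) * cabs (1 + a * Complex 0 y).
Proof.
rewrite /bnum cabsM; congr (_ * _).
  by rewrite -cabs_conj -cabsN; congr cabs; case: a => u v; apply: complex_eq;
    rewrite ?(ReM, ImM, ReD, ImD, ReN, ImN) /=; ring.
by rewrite -cabs_conj; congr cabs; case: a => u v; apply: complex_eq;
    rewrite ?(ReM, ImM, ReD, ImD, ReN, ImN) /=; ring.
Qed.

Lemma blaschke_arc (a z : C) : cabs z = 1 ->
  cabs (bnum a z) = cabs (z - a) * cabs (1 + a * z).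
Proof.
move=> z1; have zz := mul_conj z; rewrite z1 expr1n in zz.
rewrite /bnum cabsM mulrC; congr (_ * _).
  have -> : 1 - (a^*)%C * z = z * ((z - a)^*)%C.
    by rewrite rmorphB mulrBr zz; ring.
  by rewrite cabsM z1 mul1r cabs_conj.
have -> : z + (a^*)%C = z * ((1 + a * z)^*)%C.
  rewrite rmorphD rmorph1 rmorphM mulrDr mulr1 mulrCA zz; ring.
by rewrite cabsM z1 mul1r cabs_conj.
Qed.

(** The squared inverse of the quotient is exactly 1 - (3/2) X / D with X = Re a (1 - |a|^2), so its
    logarithm is controlled by ln (1 - x) <= - x; then (1/2) (3/2) X / 6 = X / 8. *)
Lemma blaschke_half (a : C) : 0 < Re a -> cabs a < 1 -> c - a != 0 ->
  Re a * (1 - cabs a ^+ 2) / 8 <=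
    ln (cabs (bnum a c) / (cabs (c - a) * cabs (1 + a * c))).
Proof.
move=> a0 a1 ca.
have c2 : cabs c = 2^-1 by rewrite cabs_real ger0_norm // invr_ge0.
have a2 : cabs a ^+ 2 < 1 by rewrite expr_lt1 // cabs_ge0.
have n1 : 0 < cabs (1 + a * c).
  apply: lt_le_trans _ (cabs_rtri _ _); rewrite cabs1 cabsM c2; lra.
have n2 : 0 < cabs (c - a) by rewrite cabs_gt0.
have m1 : 0 < cabs (1 - (a^*)%C * c).
  apply: lt_le_trans _ (cabs_rtriB _ _); rewrite cabs1 cabsM cabs_conj c2; lra.
have m2 : 0 < cabs (c + (a^*)%C).
  have i2 : 0 < 2^-1 :> R by rewrite invr_gt0.
  have p : 0 < 2^-1 + Re a by rewrite addr_gt0.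
  apply: lt_le_trans _ (Re_le_cabs _).
  have -> : Re (c + (a^*)%C) = 2^-1 + Re a by rewrite ReD; case: (a).
  by rewrite gtr0_norm.
set B := cabs (bnum a c) / _.
have B0 : 0 < B by rewrite /B divr_gt0 // ?mulr_gt0 // cabsM mulr_gt0.
set D := (cabs (c + (a^*)%C) * cabs (1 - (a^*)%C * c)) ^+ 2.
have D0 : 0 < D by rewrite exprn_gt0 // mulr_gt0.
(* Both factors have modulus at most 3/2, and (3/2)^4 = 81/16 < 6. *)
have D6 : D <= 6.
  have d1 : cabs (c + (a^*)%C) <= 3 / 2.
    by apply: le_trans (cabsD _ _) _; rewrite c2 cabs_conj; lra.
  have d2 : cabs (1 - (a^*)%C * c) <= 3 / 2.
    by apply: le_trans (cabs_triB _ _) _; rewrite cabs1 cabsM cabs_conj c2; lra.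
  have d3 := ler_pM (ltW m2) (ltW m1) d1 d2.
  have := ler_pM (ltW (mulr_gt0 m2 m1)) (ltW (mulr_gt0 m2 m1)) d3 d3.
  rewrite /D expr2; lra.
set X := Re a * (1 - cabs a ^+ 2).
have X0 : 0 < X by rewrite mulr_gt0 // subr_gt0.
have E : B ^- 2 = 1 - (3 / 2) * X / D.
  have -> : B ^- 2 = ((cabs (c - a) * cabs (1 + a * c)) ^+ 2) / D.
    rewrite /B /bnum cabsM -/D expr_div_n invf_div; congr (_ / _).
  have -> : (cabs (c - a) * cabs (1 + a * c)) ^+ 2 = D - (3 / 2) * X.
    rewrite /D /X !exprMn !cabs_sqr; case: (a) => u v.
    rewrite ?(ReM, ImM, ReD, ImD, ReB, ImB, ReN, ImN) /=; by field.
  by rewrite mulrBl divff ?gt_eqF.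
have lnE : ln B = - 2^-1 * ln (B ^- 2).
  by rewrite lnV ?posrE ?exprn_gt0 // lnXn // -mulr_natr; field.
have q1 : -1 < - ((3 / 2) * X / D).
  have : 0 < B ^- 2 by rewrite invr_gt0 exprn_gt0.
  by rewrite E; lra.
have := le_ln1Dx q1; rewrite -E => h.
have XD : X / 6 <= X / D by rewrite ler_wpM2l ?(ltW X0) // lef_pV2 ?posrE.
have E3 : (3 / 2) * X / D = (3 / 2) * (X / D) by ring.
rewrite lnE; rewrite E3 in h; lra.
Qed.

End Blaschke.

Lemma small_eta (T : eqType) (L : seq T) (Q : T -> R -> Prop) (e0 : R) : 0 < e0 ->
  (forall a, a \in L -> exists2 e, 0 < e & forall e', e' <= e -> Q a e') ->
  exists e, [/\ 0 < e, e <= e0 & forall a, a \in L -> Q a e].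
Proof.
move=> e00 HL.
suff [e [h1 h2 h3]] : exists e, [/\ 0 < e, e <= e0 &
    forall a, a \in L -> forall e', e' <= e -> Q a e'].
  by exists e; split=> // a aL; exact: h3.
elim: L HL => [|a L IH] HL; first by exists e0; split.
have [|e [h1 h2 h3]] := IH; first by move=> b bL; apply: HL; rewrite in_cons bL orbT.
have [e' e'0 he'] := HL a (mem_head _ _).
exists (Num.min e e'); split; first by rewrite lt_min h1.
  by rewrite ge_min h2.
move=> b; rewrite in_cons => /orP[/eqP->|bL] x; rewrite le_min => /andP[x1 x2].
  exact: he'.
exact: h3.
Qed.

Lemma hol_prod_in U (I : eqType) (s : seq I) (F : I -> C -> C) :
  (forall i, i \in s -> hol U (F i)) -> hol U (fun z => \prod_(i <- s) F i z).
Proof.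
elim: s => [|i s IH] hF.
  have -> : (fun z => \prod_(i <- [::]) F i z) = (fun=> 1).
    by apply/funext => z; rewrite big_nil.
  exact: hol_cst.
have -> : (fun z => \prod_(i <- i :: s) F i z) = (fun z => F i z * \prod_(i <- s) F i z).
  by apply/funext => z; rewrite big_cons.
apply: holM; first by apply: hF; rewrite mem_head.
by apply: IH => j js; apply: hF; rewrite in_cons js orbT.
Qed.

Lemma ln_cabs_prod (I : eqType) (s : seq I) (F : I -> C) :
  (forall i, i \in s -> F i != 0) ->
  ln (cabs (\prod_(i <- s) F i)) = \sum_(i <- s) ln (cabs (F i)).
Proof.
elim: s => [|i s IH] F0; first by rewrite !big_nil cabs1 ln1.
have Fs j : j \in s -> F j != 0 by move=> js; apply: F0; rewrite in_cons js orbT.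
rewrite !big_cons cabsM lnM ?posrE ?cabs_gt0 ?IH //; first by apply: F0; rewrite mem_head.
by rewrite prodf_seq_neq0; apply/allP => j js /=; exact: Fs.
Qed.

(** Factors with a inside the half disc are divided by their Blaschke factors. This leaves |g|
    unchanged on the boundary, removes the zeros, and raises ln |g c| by at least the weights of the
    zeros, so the upper bound of [halfdisc_mean] for the new value bounds their sum. *)
Lemma jensen_halfdisc (eta : R) (h : C -> C) (L : seq C) (u P : R -> R) (K A : R) :
  let g z := h z * \prod_(a <- L) (z - a) in
  0 < eta -> eta <= 4^-1 -> hol (hdisc eta) h -> (forall z, hdisc eta z -> h z != 0) ->
  (forall a, a \in L -> (0 < Re a) && (cabs a < 1) || (Re a < 0) || (1 < cabs a)) ->
  (forall y : R, -1 <= y <= 1 -> is_derive y 1 P (u y)) ->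
  (forall y, -1 <= y <= 1 -> 0 <= u y) ->
  (forall y, -1 <= y <= 1 -> ln (cabs (g (Complex 0 (- y)))) <= u y) ->
  0 <= K ->
  (forall z, cabs z = 1 -> 0 <= Re z -> Re z * ln (cabs (g z)) <= K) ->
  g c != 0 -> 0 <= A -> - A <= ln (cabs (g c)) ->
  \sum_(a <- L | (0 < Re a) && (cabs a <= 3 / 4)) Re a / 20 <=
    A + 2 * pi * K + 3 * (P 1 - P (- 1)).
Proof.
move=> g eta0 eta4 hh h0 HL dP u0 ug K0 Kg gc A0 Ag.
pose ins (a : C) := (0 < Re a) && (cabs a < 1).
pose fac (a z : C) := if ins a then bnum a z / (1 + a * z) else z - a.
pose G z := h z * \prod_(a <- L) fac a z.
pose Q (a : C) (e : R) := (forall z, hdisc e z -> fac a z != 0) /\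
   (ins a -> forall z, hdisc e z -> 1 + a * z != 0).
(* Finitely many zeros off the boundary keep a positive distance from it, so a thinner neighbourhood
   of the half disc makes every new factor zero-free and every denominator nonzero. *)
have [e [e0 ee eQ]] : exists e, [/\ 0 < e, e <= eta & forall a, a \in L -> Q a e].
  apply: small_eta => // a aL.
  have [ia|ia] := boolP (ins a); last first.
    have [a0|a0] := ltP (Re a) 0.
      exists (- Re a); first by rewrite oppr_gt0.
      move=> e' e'a; split; last by rewrite (negbTE ia).
      move=> z [z1 _]; rewrite /fac (negbTE ia) subr_eq0; apply/eqP => E.
      by move: z1; rewrite /rhalf E; lra.
    have a1 : 1 < cabs a.
      have := HL a aL; rewrite -/(ins a) (negbTE ia) /= => /orP[|//].
      by rewrite ltNge a0.
    exists (cabs a - 1); first by rewrite subr_gt0.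
    move=> e' e'a; split; last by rewrite (negbTE ia).
    move=> z [_]; rewrite /cdisc subr0 => z1; rewrite /fac (negbTE ia) subr_eq0; apply/eqP => E.
    by move: z1; rewrite E; lra.
  have /andP[a0 a1] := ia.
  pose m := (1 - cabs a) / 2.
  have m0 : 0 < m by rewrite /m; lra.
  exists (Num.min (Re a) m); first by rewrite lt_min a0.
  move=> e'; rewrite le_min => /andP[ea em].
  have big z : hdisc e' z -> cabs (a * z) < 1.
    move=> [_]; rewrite /cdisc subr0 cabsM => z1.
    have ca := cabs_ge0 a.
    have : cabs a * cabs z <= cabs a * (1 + m) by rewrite ler_wpM2l //; lra.
    rewrite /m in em m0 *; nra.
  have d1 z : hdisc e' z -> 1 + a * z != 0.
    move=> /big z1; rewrite -cabs_gt0; apply: lt_le_trans _ (cabs_rtri _ _).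
    by rewrite cabs1 subr_gt0.
  split=> // z Uz; rewrite /fac ia mulf_neq0 ?invr_neq0 ?d1 // /bnum mulf_neq0 //.
    have [z1 _] := Uz; apply/eqP => /(congr1 (@complex.Re R)); rewrite ReD /=.
    by case: (a) a0 ea => x y /= ? ?; rewrite /rhalf in z1; lra.
  rewrite -cabs_gt0; apply: lt_le_trans _ (cabs_rtriB _ _).
  by rewrite cabs1 cabsM cabs_conj -cabsM subr_gt0 big.
have sub z : hdisc e z -> hdisc eta z.
  by move=> [z1 z2]; split; rewrite /rhalf /cdisc in z1 z2 *; lra.
have hG : hol (hdisc e) G.
  apply: holM; first exact: hol_sub hh.
  apply: hol_prod_in => a aL; rewrite /fac; have [_ Qa] := eQ a aL.
  have [ia|_] := boolP (ins a); last by apply: holB; [exact: hol_id|exact: hol_cst].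
  have haz b : hol (hdisc e) (fun z => b * z) by apply: holM; [exact: hol_cst|exact: hol_id].
  apply: holM; last by apply: holV; [apply: holD => //; exact: hol_cst|exact: Qa].
  by apply: holM; [apply: holD; [exact: hol_id|exact: hol_cst]|apply: holB => //; exact: hol_cst].
have fac0 z a : hdisc e z -> a \in L -> fac a z != 0.
  by move=> Uz /eQ[+ _]; apply.
have G0 z : hdisc e z -> G z != 0.
  move=> Uz; apply: mulf_neq0; first by apply: h0; exact: sub.
  by rewrite prodf_seq_neq0; apply/allP => a aL /=; exact: fac0.
have bdry z : hdisc e z ->
    (forall a, ins a -> cabs (bnum a z) = cabs (z - a) * cabs (1 + a * z)) ->
    cabs (G z) = cabs (g z).
  move=> Uz bE; rewrite /G /g !cabsM !cabs_prod; congr (_ * _).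
  rewrite !(big_seq_cond predT); apply: eq_bigr => a /andP[aL _]; rewrite /fac.
  case: ifP => // ia; rewrite cabsM cabsV bE // mulfK // cabs_eq0.
  by have [_ Qa] := eQ a aL; exact: Qa.
have cU := half_in e0.
have gca a : a \in L -> c - a != 0.
  move=> aL; apply: contraNneq gc => E; rewrite /g mulf_eq0; apply/orP; right.
  by rewrite prodf_seq_eq0; apply/hasP; exists a => //=; apply/eqP.
have hc0 : 0 < cabs (h c) by rewrite cabs_gt0; apply: h0; exact: sub.
have pr1 : 0 < cabs (\prod_(a <- L) (c - a)).
  by rewrite cabs_gt0 prodf_seq_neq0; apply/allP => a aL /=; exact: gca.
have pr2 : 0 < cabs (\prod_(a <- L) fac a c).
  by rewrite cabs_gt0 prodf_seq_neq0; apply/allP => a aL /=; exact: fac0.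
have lnGE : ln (cabs (G c)) = ln (cabs (g c)) + \sum_(a <- L) (ln (cabs (fac a c)) - ln (cabs (c - a))).
  rewrite /G /g !cabsM !lnM ?posrE // !ln_cabs_prod; last 2 first.
  - by move=> a aL; exact: gca.
  - by move=> a aL; exact: fac0.
  by rewrite sumrB; ring.
set S := \sum_(a <- L | _) _.
have lS : S <= ln (cabs (G c)) - ln (cabs (g c)).
  rewrite lnGE [X in _ <= X - _]addrC addrK /S big_mkcond /=.
  rewrite big_seq [leRHS]big_seq; apply: ler_sum => a aL.
  have fa0 : 0 < cabs (fac a c) by rewrite cabs_gt0 fac0.
  have ca0 : 0 < cabs (c - a) by rewrite cabs_gt0 gca.
  have [ia|ia] := boolP (ins a); last first.
    rewrite /fac (negbTE ia) subrr; case: ifP => // /andP[a0 a1].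
    by move: ia; rewrite /ins a0 /=; lra.
  have /andP[a0 a1] := ia.
  have [_ Qa] := eQ a aL; have n1 : 0 < cabs (1 + a * c) by rewrite cabs_gt0; exact: Qa.
  have E : ln (cabs (fac a c)) - ln (cabs (c - a)) =
      ln (cabs (bnum a c) / (cabs (c - a) * cabs (1 + a * c))).
    rewrite -ln_div ?posrE //; congr ln; rewrite /fac ia cabsM cabsV.
    by field; rewrite !gt_eqF.
  rewrite E; apply: le_trans (blaschke_half a0 a1 (gca a aL)).
  have X0 : 0 <= Re a * (1 - cabs a ^+ 2).
    by rewrite mulr_ge0 ?(ltW a0) // subr_ge0 expr_le1 ?cabs_ge0 // ltW.
  case: ifP => [/andP[_ a34]|_]; last by rewrite divr_ge0.
  (* (1 - 9/16) / 8 = 7/128 is at least the weight 1/20. *)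
  have : cabs a ^+ 2 <= (3 / 4) ^+ 2 by rewrite lerXn2r ?nnegrE ?cabs_ge0.
  move: (cabs a ^+ 2) => q q1; have := ler_wpM2l (ltW a0) q1.
  lra.
(* [halfdisc_mean] asks for ln |G c| >= 0; in the other case [lS] already gives S <= A. *)
have [l0|l0] := ltP (ln (cabs (G c))) 0.
  have := @mono_derive R _ _ P u (-1) 1 _ (fun y _ => is_derive_cst (0 : R) y 1) dP u0.
  rewrite /cst subrr => /(_ _) P0.
  have {}P0 : 0 <= P 1 - P (-1) by apply: P0; lra.
  have := mulr_ge0 (pi_ge0 R) K0; lra.
have := @halfdisc_mean e G e0 (le_trans ee eta4) hG G0 u P K dP u0 _ K0 _ l0.
have yin (y : R) : -1 <= y <= 1 -> hdisc e (Complex 0 (- y)).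
  move=> y1; apply: in_hdisc => //=.
  by rewrite /cabs /= expr0n add0r sqrrN sqrtr_sqr ler_norml.
move=> H; have {H} : ln (cabs (G c)) <= 2 * pi * K + 3 * (P 1 - P (-1)).
  apply: H => [y y1|z z1 z0].
    by rewrite bdry; [exact: ug|exact: yin|move=> a _; exact: blaschke_side].
  rewrite bdry; [exact: Kg| |by move=> a _; exact: blaschke_arc].
  by apply: in_hdisc => //; rewrite z1.
lra.
Qed.

End HalfDisc.

(** * Hoffman's identity *)

Section Dels.
Variable T : Type.

(** Pairs each entry with the list left after its deletion: in Hoffman's recursion these are the
    entries that the head can be merged with. *)
Fixpoint dels (bs : seq T) : seq (T * seq T) :=
  if bs is b :: bs' then (b, bs') :: [seq (p.1, b :: p.2) | p <- dels bs'] else [::].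

End Dels.

Lemma dels_size (T : eqType) (bs : seq T) p : p \in dels bs -> (size p.2).+1 = size bs.
Proof.
elim: bs p => [|b bs IH] p //=; rewrite in_cons => /orP[/eqP->//|/mapP[q /IH <- ->]] //.
Qed.

Lemma dels_all (T : eqType) (Q : pred T) (bs : seq T) p : all Q bs -> p \in dels bs ->
  Q p.1 && all Q p.2.
Proof.
elim: bs p => [|b bs IH] p //= /andP[Qb Qbs].
rewrite in_cons => /orP[/eqP->/=|/mapP[q /(IH _ Qbs) /andP[q1 q2] ->]] /=; first by rewrite Qb.
by rewrite q1 Qb.
Qed.

Section InjectiveSums.
Variables (K : comNzRingType) (V : zmodType) (X : finType) (v : V -> X -> K).
Hypothesis vD : forall a b x, v (a + b) x = v a x * v b x.
Implicit Types (S : {set X}) (bs : seq V).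

(** A sum over tuples of distinct indices outside S, one index for each entry of [bs]; the recursion
    collects the indices already used in S. [isum_ffun] gives the form with injective functions. *)
Fixpoint isum bs S : K :=
  if bs is b :: bs' then \sum_(x | x \notin S) v b x * isum bs' (x |: S) else 1.

(** A tuple of distinct indices either avoids x or takes the value x at exactly one position; the
    sum over [dels] runs over that position. *)
Lemma isum_split bs S x : x \notin S ->
  isum bs S = isum bs (x |: S) + \sum_(p <- dels bs) v p.1 x * isum p.2 (x |: S).
Proof.
elim: bs S => [|b bs IH] S xS /=; first by rewrite big_nil addr0.
rewrite big_cons big_map /= (bigD1 x) //= addrCA; congr (_ + _).
have -> : \sum_(y | y \notin x |: S) v b y * isum bs (y |: (x |: S)) =
    \sum_(y | (y \notin S) && (y != x)) v b y * isum bs (y |: (x |: S)).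
  by apply: eq_bigl => y; rewrite in_setU1 negb_or andbC.
have -> : \sum_(p <- dels bs) v p.1 x *
      (\sum_(y | y \notin x |: S) v b y * isum p.2 (y |: (x |: S))) =
    \sum_(y | (y \notin S) && (y != x)) v b y *
      \sum_(p <- dels bs) v p.1 x * isum p.2 (y |: (x |: S)).
  under [RHS]eq_bigr do rewrite mulr_sumr.
  rewrite exchange_big /=; apply: eq_bigr => p _; rewrite mulr_sumr.
  apply: eq_big => [y|y _]; first by rewrite in_setU1 negb_or andbC.
  by rewrite mulrCA.
rewrite -big_split /=; apply: eq_bigr => y /andP[yS yx].
rewrite -mulrDr; congr (_ * _); rewrite finset.setUCA; apply: IH.
by rewrite in_setU1 negb_or xS andbT eq_sym.
Qed.

(* Hoffman's identity, one step: the terms subtracted are those in which the first index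
   coincides with another one, whose exponents then add up. *)
Lemma isum_rec b bs S : isum (b :: bs) S =
  (\sum_(x | x \notin S) v b x) * isum bs S - \sum_(p <- dels bs) isum ((b + p.1) :: p.2) S.
Proof.
rewrite /= mulr_suml; apply/eqP; rewrite -subr_eq opprK eq_sym addrC; apply/eqP.
rewrite exchange_big /= -big_split /=; apply: eq_bigr => x xS.
rewrite (isum_split bs xS) mulrDr mulr_sumr addrC; congr (_ + _).
by apply: eq_bigr => p _; rewrite vD mulrA.
Qed.

Definition fcons k (x : X) (m : {ffun 'I_k -> X}) : {ffun 'I_k.+1 -> X} :=
  [ffun i => oapp m x (unlift ord0 i)].

Lemma fcons0 k x (m : {ffun 'I_k -> X}) : fcons x m ord0 = x.
Proof. by rewrite ffunE unlift_none. Qed.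
Lemma fconsS k x (m : {ffun 'I_k -> X}) i : fcons x m (lift ord0 i) = m i.
Proof. by rewrite ffunE liftK. Qed.

Lemma fcons_inj k x (m : {ffun 'I_k -> X}) S :
  injectiveb (fcons x m) && [forall i, fcons x m i \notin S] =
  (x \notin S) && (injectiveb m && [forall i, m i \notin x |: S]).
Proof.
apply/andP/andP => [[/injectiveP inj /forallP H]|[xS /andP[/injectiveP inj /forallP H]]].
  split; first by have := H ord0; rewrite fcons0.
  apply/andP; split.
    apply/injectiveP => i j ij; apply: (@lift_inj _ ord0); apply: inj.
    by rewrite !fconsS.
  apply/forallP => i; have := H (lift ord0 i); rewrite fconsS in_setU1 negb_or => ->.
  rewrite andbT; apply/eqP => E.
  by have := inj ord0 (lift ord0 i); rewrite fcons0 fconsS E => /(_ erefl).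
split.
  apply/injectiveP => i j; case: (unliftP ord0 i) => [i'|] ->;
    case: (unliftP ord0 j) => [j'|] ->; rewrite ?fcons0 ?fconsS //.
  - by move=> /inj ->.
  - by move=> E; have := H i'; rewrite E in_setU1 eqxx.
  - by move=> E; have := H j'; rewrite -E in_setU1 eqxx.
apply/forallP => i; case: (unliftP ord0 i) => [i'|] ->; rewrite ?fcons0 ?fconsS //.
by have := H i'; rewrite in_setU1 negb_or => /andP[].
Qed.

Lemma isum_ffun (k : nat) (b : 'I_k -> V) S :
  isum [seq b i | i <- enum 'I_k] S =
  \sum_(m : {ffun 'I_k -> X} | injectiveb m && [forall i, m i \notin S]) \prod_i v (b i) (m i).
Proof.
elim: k b S => [|k IH] b S.
  pose f0 : {ffun 'I_0 -> X} := ffun0 (card_ord 0).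
  rewrite enum_ord0 /= (big_pred1 f0) ?big_ord0 // => m.
  have mf : m = f0 by apply/ffunP => -[].
  rewrite /= mf eqxx; apply/andP; split; [apply/injectiveP => -[]|apply/forallP => -[]] => //.
rewrite enum_ordSl /= -map_comp.
pose h (p : X * {ffun 'I_k -> X}) := fcons p.1 p.2.
pose h' (m : {ffun 'I_k.+1 -> X}) := (m ord0, [ffun i => m (lift ord0 i)]).
rewrite (reindex h) /=; last first.
  exists h' => [[x m]|m] _; rewrite /h /h' /=.
    by rewrite fcons0; congr pair; apply/ffunP => i; rewrite ffunE fconsS.
  apply/ffunP => i; case: (unliftP ord0 i) => [i'|] ->; rewrite ?fcons0 ?fconsS //.
  by rewrite ffunE.
under [RHS]eq_bigl do rewrite /h fcons_inj.
rewrite -(pair_big_dep (fun x => x \notin S)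
  (fun x (m : {ffun 'I_k -> X}) => injectiveb m && [forall i, m i \notin x |: S])
  (fun x m => \prod_i v (b i) (fcons x m i))) /=.
apply: eq_bigr => x xS; rewrite (IH (b \o lift ord0)) mulr_sumr.
apply: eq_bigr => m _; rewrite big_ord_recl fcons0; congr (_ * _).
by apply: eq_bigr => i _; rewrite fconsS.
Qed.

End InjectiveSums.

Section Sorting.
Variables (r N : nat).
Implicit Types (m : {ffun 'I_r -> 'I_N}) (t : {perm 'I_r}).

Definition incr m := [forall i : 'I_r, forall j : 'I_r, (i < j)%N ==> (m i < m j)%N].
Definition fperm m t : {ffun 'I_r -> 'I_N} := [ffun i => m (t i)].

Lemma incrP m : reflect (forall i j : 'I_r, (i < j)%N -> (m i < m j)%N) (incr m).
Proof.
apply: (iffP forallP) => [H i j ij|H i]; first by have /forallP/(_ j) := H i; rewrite ij.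
by apply/forallP => j; apply/implyP; exact: H.
Qed.

Lemma incr_fperm_inj m t : incr (fperm m t) -> injective m.
Proof.
move=> /incrP H i j ij; apply: (perm_inj (s := (t^-1)%g)); apply: val_inj => /=.
have E x : m x = fperm m t ((t^-1)%g x) by rewrite ffunE permKV.
have [lt|gt|//] := ltngtP ((t^-1)%g i) ((t^-1)%g j).
  by have := H _ _ lt; rewrite -!E ij ltnn.
by have := H _ _ gt; rewrite -!E ij ltnn.
Qed.

Let rank m (j : 'I_r) : nat := #|[set k | (m k < m j)%N]%SET|.

Let rank_lt m j : (rank m j < r)%N.
Proof.
rewrite -[X in (_ < X)%N](card_ord r) -cardsT; apply: proper_card; apply/properP.
split; first by apply/fintype.subsetP => x _; rewrite finset.in_setT.
by exists j; rewrite ?inE ?ltnn.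
Qed.

Let rank_mono m i j : (m i < m j)%N -> (rank m i < rank m j)%N.
Proof.
move=> ij; apply: proper_card; apply/properP; split.
  by apply/fintype.subsetP => k; rewrite !inE => /ltn_trans; exact.
by exists i; rewrite ?inE ?ltnn.
Qed.

(** The sorting permutation is the inverse of the rank map, which sends j to the number of values of
    m below m j. *)
Lemma sort_unique m : injective m ->
  exists t0 : {perm 'I_r}, forall t, incr (fperm m t) = (t == t0).
Proof.
move=> minj; pose rk j := Ordinal (rank_lt m j).
have rk_inj : injective rk.
  move=> i j /(congr1 val) /= E; apply: minj; apply: val_inj => /=.
  by have [lt|gt|//] := ltngtP (m i) (m j);
    [have := rank_mono lt|have := rank_mono gt]; rewrite E ltnn.
pose p := perm rk_inj; exists (p^-1)%g => t; apply/idP/eqP => [/incrP H|->].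
  apply/permP => i; apply: (perm_inj (s := p)); rewrite permKV permE; apply: val_inj => /=.
  (* Transported by t^-1, the set counted by the rank becomes the set of positions k < i, because m
     composed with t increases; it has i elements. *)
  rewrite /rank -(card_imset _ (perm_inj (s := (t^-1)%g))).
  have -> : [set (t^-1)%g x | x in [set k | (m k < m (t i))%N]]%SET = [set k : 'I_r | (k < i)%N]%SET.
    apply/setP => k; rewrite inE; apply/imsetP/idP => [[x]|ki].
      rewrite inE => xi ->; rewrite ltnNge leq_eqVlt; apply/negP => /orP[/eqP/val_inj E|lt].
        by move: xi; rewrite E permKV ltnn.
      by have := H _ _ lt; rewrite !ffunE permKV => /(ltn_trans xi); rewrite ltnn.
    by exists (t k); rewrite ?permK // inE; have := H _ _ ki; rewrite !ffunE.
  have ci : #|[set: 'I_i]%SET| = val i by rewrite cardsT card_ord.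
  have winj : injective (widen_ord (ltnW (ltn_ord i))).
    by move=> x y /(congr1 val) /= /val_inj.
  rewrite -[RHS]ci -(card_imset _ winj).
  apply: eq_card => k; rewrite inE; apply/idP/imsetP => [ki|[x _ ->]] /=; last exact: ltn_ord.
  by exists (Ordinal ki); [rewrite finset.in_setT|exact: val_inj].
apply/incrP => i j ij; rewrite !ffunE ltnNge; apply/negP => ji.
have rkE x : rank m ((p^-1)%g x) = x.
  have : p ((p^-1)%g x) = x by rewrite permKV.
  by rewrite permE => /(congr1 val).
have [lt|ge] := ltnP (m ((p^-1)%g j)) (m ((p^-1)%g i)).
  by have := rank_mono lt; rewrite !rkE => /(ltn_trans ij); rewrite ltnn.
have E : m ((p^-1)%g i) = m ((p^-1)%g j) by apply: val_inj; apply/eqP; rewrite /= eqn_leq ge ji.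
by have /perm_inj E2 := minj _ _ E; rewrite E2 ltnn in ij.
Qed.

(** Symmetrisation replaces the order condition by distinctness: each injective tuple is sorted by
    exactly one permutation, and a tuple with a repetition by none. *)
Lemma sum_sorted (K : comNzRingType) (F : 'I_r -> 'I_N -> K) (P : pred 'I_N) :
  \sum_(t : {perm 'I_r}) \sum_(n : {ffun 'I_r -> 'I_N} | [forall i, P (n i)] && incr n)
     \prod_(i < r) F (t i) (n i) =
  \sum_(m : {ffun 'I_r -> 'I_N} | injectiveb m && [forall i, P (m i)]) \prod_(i < r) F i (m i).
Proof.
have step (t : {perm 'I_r}) : \sum_(n : {ffun 'I_r -> 'I_N} | [forall i, P (n i)] && incr n)
     \prod_(i < r) F (t i) (n i) =
   \sum_(m : {ffun 'I_r -> 'I_N} | [forall i, P (m i)] && incr (fperm m t)) \prod_(i < r) F i (m i).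
  rewrite (reindex (fperm^~ t)) /=; last first.
    exists (fperm^~ (t^-1)%g) => m _; apply/ffunP => i; rewrite !ffunE ?permK ?permKV //.
  apply: eq_big => [m|m _].
    congr (_ && _); apply/forallP/forallP => H i; last by rewrite ffunE.
    by have := H ((t^-1)%g i); rewrite ffunE permKV.
  by rewrite [RHS](reindex_inj (perm_inj (s := t))) /=; apply: eq_bigr => i _; rewrite ffunE.
under eq_bigr do rewrite step.
under eq_bigr do rewrite big_mkcond /=.
rewrite exchange_big /= [RHS]big_mkcond /=; apply: eq_bigr => m _.
have [Pm|_] := boolP [forall i, P (m i)]; last by rewrite andbF /= [LHS]big1.
rewrite andbT /=; case: ifP => [/injectiveP/sort_unique[t0 Ht0]|ninj].
  by rewrite (bigD1 t0) //= Ht0 eqxx [X in _ + X]big1 ?addr0 // => t tt; rewrite Ht0 (negbTE tt).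
rewrite [LHS]big1 // => t _; case: ifP => // /incr_fperm_inj inj.
by move/negP: ninj; case; apply/injectiveP.
Qed.

End Sorting.

(** * Translation of topological limits and differentiability into estimates with the modulus *)

Section Bridge.
Variable R : realType.
Local Notation C := (complex R).

Lemma nbhs_cabs (z : C) (P : C -> Prop) :
  (\forall w \near (z : C^o), P w) <->
  exists2 d : R, 0 < d & forall h, cabs h < d -> P (z + h).
Proof.
split.
- move=> /nbhs_normP[e /= e0 he].
  (* In the partial order of the complex numbers, 0 < e forces e to be real. *)
  have eR : e = (Re e)%:C%C.
    by move: e0; rewrite ltcE /= => /andP[/eqP h _]; case: (e) h => x y /= ->.
  exists (Re e) => [|h hh]; first by move: e0; rewrite ltcE /= => /andP[].
  apply: he; rewrite /= opprD addrA subrr sub0r normrN eR cabs_norm ltcR //.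
- move=> [d d0 hd]; apply/nbhs_normP; exists d%:C%C; first by rewrite /= ltcR.
  move=> w /=; rewrite distrC cabs_norm ltcR => wd.
  by rewrite -[w](subrK z) addrC; exact: hd.
Qed.

Lemma dif_derivable (f : C -> C) (z l : C) :
  dif id f z l <-> derivable (f : C^o -> C^o) z 1 /\ derive (f : C^o -> C^o) z 1 = l.
Proof.
have cv : dif id f z l <->
    (h^-1 *: ((f : C^o -> C^o) (h *: 1 + z) - f z) @[h --> (0 : C^o)^'] --> (l : C^o)).
  split.
  - move=> df; apply/cvgrPdist_le => /= e e0.
    have eR : e = (Re e)%:C%C.
      by move: e0; rewrite ltcE /= => /andP[/eqP h _]; case: (e) h => x y /= ->.
    have e0' : 0 < Re e by move: e0; rewrite ltcE /= => /andP[].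
    have [d d0 hd] := df _ e0'.
    rewrite near_withinE; apply/nbhs_cabs; exists d => // h hh h0.
    rewrite add0r in h0 *; rewrite eR cabs_norm lecR.
    have c0 : 0 < cabs h by rewrite cabs_gt0.
    rewrite -(ler_pM2r c0) -cabsM; apply: le_trans (hd h hh).
    rewrite /GRing.scale /= mulr1 mulrBl mulrAC mulVf // mul1r [h + z]addrC cabsB.
    exact: lexx.
  - move=> /cvgrPdist_le H e e0.
    have := H e%:C%C; rewrite ltcR => /(_ e0).
    rewrite near_withinE => /nbhs_cabs[d d0 hd]; exists d => // h hh.
    have [->|h0] := eqVneq h 0; first by rewrite addr0 subrr mulr0 subrr cabs0 mulr0.
    have := hd h hh; rewrite add0r => /(_ h0); rewrite cabs_norm lecR.
    have c0 : 0 < cabs h by rewrite cabs_gt0.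
    rewrite -(ler_pM2r c0) -cabsM; apply: le_trans.
    rewrite /GRing.scale /= mulr1 mulrBl mulrAC mulVf // mul1r [h + z]addrC cabsB.
    by [].
split=> [/cv H|[dv lE]]; last by apply/cv; rewrite -lE; exact: dv.
by split; [apply/cvg_ex; exists l|exact/cvg_lim].
Qed.

Lemma differentiable_dif (f : C -> C) (z : C) :
  differentiable (f : C^o -> C^o) (z : C^o) <-> exists l, dif id f z l.
Proof.
split=> [/derivable1_diffP df|[l /dif_derivable[df _]]]; last exact/derivable1_diffP.
by exists (derive (f : C^o -> C^o) z 1); apply/dif_derivable.
Qed.

Lemma limto_cvg (u : nat -> C) (l : C) :
  (u N @[N --> \oo] --> (l : C^o)) -> limto u l.
Proof.
move=> ul e e0.
have /cvgrPdist_le H : (u : nat -> C^o) @ \oo --> (l : C^o) := ul.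
have := H e%:C%C; rewrite ltcR => /(_ e0)[N _ hN].
by exists N => n /hN; rewrite cabs_norm lecR cabsB.
Qed.

End Bridge.

(** * Clearing the poles of polynomials in the functions zeta (b s) *)

Section Good.
Variables (R : realType) (al : R).
Hypothesis al_gt0 : 0 < al.
Local Notation C := (complex R).

Definition y3 : R := 1 / (2 * al).

Definition kapP (Bs : seq R) (s : C) : C := \prod_(b <- Bs) kap (b%:C%C * s).
(** The summand 1 keeps each factor at least 1, so that a bound remains valid when further factors
    are added and the logarithm is nonnegative. *)
Definition etaP (Bs : seq R) (s : C) : R := \prod_(b <- Bs) (1 + cabs (eta (b%:C%C * s))).

Lemma y3_gt0 : 0 < y3. Proof. by rewrite divr_gt0 // mulr_gt0. Qed.

Lemma Re_scaled b s : al <= b -> y3 < Re s -> 2^-1 < Re (b%:C%C * s).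
Proof.
move=> ab ys; rewrite ReRM; apply: (@lt_le_trans _ _ (al * Re s)).
  have -> : 2^-1 = al * y3 by rewrite /y3; field; rewrite gt_eqF.
  by rewrite ltr_pM2l.
rewrite ler_wpM2r //; apply: ltW; exact: lt_trans y3_gt0 ys.
Qed.

Lemma etaP_cat B1 B2 s : etaP (B1 ++ B2) s = etaP B1 s * etaP B2 s.
Proof. by rewrite /etaP big_cat. Qed.
Lemma kapP_cat B1 B2 s : kapP (B1 ++ B2) s = kapP B1 s * kapP B2 s.
Proof. by rewrite /kapP big_cat. Qed.

Lemma etaP_ge1 Bs s : 1 <= etaP Bs s.
Proof.
rewrite /etaP; elim: Bs => [|b Bs IH]; first by rewrite big_nil.
rewrite big_cons; have h : 1 <= 1 + cabs (eta (b%:C%C * s)) by rewrite lerDl cabs_ge0.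
by have := ler_pM ler01 ler01 h IH; rewrite mulr1.
Qed.

Lemma cabs_kap_le (s : C) : 0 <= Re s -> cabs (kap s) <= 3.
Proof.
move=> s0; apply: le_trans (cabs_triB _ _) _; rewrite cabs1 cabsM cabs_nat.
have := cabs_npowN_le1 1 s0; lra.
Qed.

Lemma cabs_kapP_le Bs s : all (>= al) Bs -> 0 <= Re s -> cabs (kapP Bs s) <= 3 ^+ size Bs.
Proof.
move=> + s0; rewrite /kapP; elim: Bs => [|b Bs IH] /=; first by rewrite big_nil cabs1.
move=> /andP[ab aBs]; rewrite big_cons cabsM exprS.
apply: ler_pM; rewrite ?cabs_ge0 ?IH // cabs_kap_le // ReRM mulr_ge0 //.
by apply: le_trans ab; exact: ltW.
Qed.

Lemma hol_scale U V (f : C -> C) (b : R) : hol V f ->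
  (forall s, U s -> V (b%:C%C * s)) -> hol U (fun s => f (b%:C%C * s)).
Proof.
move=> hf UV; apply: (hol_comp (V := V)) => //.
by apply: holM; [exact: hol_cst|exact: hol_id].
Qed.

Lemma hol_kapP U Bs : hol U (kapP Bs).
Proof.
apply: hol_prod => b; apply: (@hol_scale _ (fun=> True)) => //.
apply: holB; first exact: hol_cst.
by apply: holM; [exact: hol_cst|exact: hol_npowN].
Qed.

(* [kapP Bs] clears the poles of the continuation of lim_n phi n. *)
Definition good (phi : nat -> C -> C) := exists (Bs : seq R) (A : R) (psi : C -> C),
  [/\ all (>= al) Bs, 0 <= A, hol (rhalf y3) psi,
    forall s, y3 < Re s -> cabs (psi s) <= A * etaP Bs s &
    forall s, 2 / al <= Re s -> exists l,
      limto (phi^~ s) l /\ kapP Bs s * l = psi s].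

Lemma good_ext phi phi' : (forall n s, phi n s = phi' n s) -> good phi -> good phi'.
Proof.
move=> E [Bs [A [psi [h1 h2 h3 h4 h5]]]]; exists Bs, A, psi; split=> // s /h5[l [hl E']].
by exists l; split=> //; apply: limto_ext hl => n; exact: E.
Qed.

Lemma good_cst (c : C) : good (fun _ _ => c).
Proof.
exists [::], (cabs c), (fun=> c); split=> //; first exact: cabs_ge0.
- exact: hol_cst.
- by move=> s _; rewrite /etaP big_nil mulr1.
- by move=> s _; exists c; split; [exact: limto_cst|rewrite /kapP big_nil mul1r].
Qed.

Lemma goodM f g : good f -> good g -> good (fun n s => f n s * g n s).
Proof.
move=> [B1 [A1 [p1 [a1 a2 a3 a4 a5]]]] [B2 [A2 [p2 [b1 b2 b3 b4 b5]]]].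
exists (B1 ++ B2), (A1 * A2), (fun s => p1 s * p2 s); split.
- by rewrite all_cat a1.
- exact: mulr_ge0.
- exact: holM.
- move=> s ys; rewrite cabsM etaP_cat mulrACA; apply: ler_pM; rewrite ?cabs_ge0 ?a4 ?b4 //.
- move=> s ys; have [l [l1 l2]] := a5 s ys; have [m [m1 m2]] := b5 s ys.
  by exists (l * m); split; [exact: limtoM|rewrite kapP_cat -l2 -m2; ring].
Qed.

(** A common denominator is formed by cross multiplication; the multipliers cost at most 3 for each
    factor, and [etaP_ge1] enlarges each bound to the product of both. *)
Lemma goodD f g : good f -> good g -> good (fun n s => f n s + g n s).
Proof.
move=> [B1 [A1 [p1 [a1 a2 a3 a4 a5]]]] [B2 [A2 [p2 [b1 b2 b3 b4 b5]]]].
exists (B1 ++ B2), (3 ^+ size B2 * A1 + 3 ^+ size B1 * A2),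
  (fun s => kapP B2 s * p1 s + kapP B1 s * p2 s); split.
- by rewrite all_cat a1.
- by rewrite addr_ge0 // mulr_ge0 // exprn_ge0.
- by apply: holD; apply: holM => //; exact: hol_kapP.
- move=> s ys; have s0 : 0 <= Re s by apply: ltW; exact: lt_trans y3_gt0 ys.
  apply: le_trans (cabsD _ _) _; rewrite mulrDl etaP_cat !cabsM.
  have e1 := etaP_ge1 B1 s; have e2 := etaP_ge1 B2 s.
  apply: lerD.
    rewrite -mulrA; apply: ler_pM; rewrite ?cabs_ge0 ?cabs_kapP_le //.
    apply: le_trans (a4 s ys) _; rewrite ler_wpM2l // ler_peMr //.
    exact: le_trans e1.
  rewrite -mulrA; apply: ler_pM; rewrite ?cabs_ge0 ?cabs_kapP_le //.
  apply: le_trans (b4 s ys) _; rewrite ler_wpM2l // ler_peMl //.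
  exact: le_trans e2.
- move=> s ys; have [l [l1 l2]] := a5 s ys; have [m [m1 m2]] := b5 s ys.
  by exists (l + m); split; [exact: limtoD|rewrite kapP_cat -l2 -m2; ring].
Qed.

Lemma goodN f : good f -> good (fun n s => - f n s).
Proof.
move=> hf; apply: good_ext (goodM (good_cst (-1)) hf) => n s; exact: mulN1r.
Qed.

Lemma goodB f g : good f -> good g -> good (fun n s => f n s - g n s).
Proof. by move=> hf hg; apply: goodD => //; exact: goodN. Qed.

Lemma good_sum (I : eqType) (L : seq I) (F : I -> nat -> C -> C) :
  (forall i, i \in L -> good (F i)) -> good (fun n s => \sum_(i <- L) F i n s).
Proof.
elim: L => [|i L IH] H.
  by apply: good_ext (good_cst 0) => n s; rewrite big_nil.
apply: good_ext (goodD (H i (mem_head _ _)) (IH _)) => [n s|j jL].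
  by rewrite big_cons.
by apply: H; rewrite in_cons jL orbT.
Qed.

Lemma good_zsum b : al <= b -> good (fun n s => zsum n (b%:C%C * s)).
Proof.
move=> ab; exists [:: b], 1, (fun s => eta (b%:C%C * s)); split=> //=.
- by rewrite ab.
- apply: (@hol_scale _ (rhalf 2^-1)); first exact: hol_eta.
  by move=> s; exact: Re_scaled.
- by move=> s ys; rewrite mul1r /etaP big_seq1 lerDr.
- move=> s ys; have s2 : 2 <= Re (b%:C%C * s).
    rewrite ReRM; apply: (@le_trans _ _ (al * Re s)).
      by move: ys; rewrite ler_pdivrMr // mulrC.
    rewrite ler_wpM2r //; apply: le_trans ys; rewrite divr_ge0 // ltW //.
  have [Z hZ] := zsum_lim s2; exists Z; split=> //.
  by rewrite /kapP big_seq1; exact: eta_zeta.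
Qed.

(** Index 0 gets the value 0, so that sums over ['I_N.+1] are sums over 1 <= k <= N while additivity
    in the exponent, needed for Hoffman's recursion, is kept. *)
Definition dterm (N : nat) (s : C) (b : R) (k : 'I_N.+1) : C :=
  if k == ord0 then 0 else npowN k (b%:C%C * s).

Lemma dtermD N s a b k : @dterm N s (a + b) k = dterm s a k * dterm s b k.
Proof.
rewrite /dterm; case: ifP => _; first by rewrite mul0r.
by rewrite /npowN -cexpD rmorphD /=; congr cexp; ring.
Qed.

Lemma sum_dterm N s b : \sum_(k < N.+1 | k \notin (finset.set0 : {set 'I_N.+1})) dterm s b k = zsum N (b%:C%C * s).
Proof.
rewrite (eq_bigl predT) => [|k]; last by rewrite finset.in_set0.
rewrite big_ord_recl /dterm eqxx add0r /zsum big_mkord; apply: eq_bigr => k _.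
by rewrite lift0.
Qed.

Definition hoff (bs : seq R) (N : nat) (s : C) : C := isum (@dterm N s) bs finset.set0.

(** Induction on the number of exponents: [isum_rec] leads to shorter lists, and merging two
    exponents keeps them at least al. *)
Lemma good_hoff bs : all (>= al) bs -> good (hoff bs).
Proof.
have [n] := ubnP (size bs); elim: n bs => // n IH [|b bs] /=.
  by move=> _ _; exact: good_cst.
rewrite ltnS => bsn /andP[ab abs].
have := goodB (goodM (good_zsum ab) (IH bs bsn abs))
  (@good_sum _ (dels bs) (fun p => hoff ((b + p.1) :: p.2)) _).
move=> H; apply: good_ext (H _) => [N s|p pd].
  by rewrite /hoff isum_rec ?sum_dterm //; exact: dtermD.
have := dels_all abs pd => /andP[p1 p2]; apply: IH => /=.
  by rewrite (dels_size pd).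
by rewrite p2 andbT; apply: le_trans ab _; rewrite lerDl; apply: le_trans p1; exact: ltW.
Qed.

End Good.

Section GapLemma.
Variable R : realType.

Lemma min_gap (V : seq R) x0 : x0 \in V -> exists l k, [/\ l \in V, 0 < k &
  forall x, x \in V -> x = l \/ l + k <= x].
Proof.
elim: V x0 => [|x V IH] x0 //; case: V IH => [|y V] IH _.
  exists x, 1; split=> //; first exact: mem_head.
  by move=> z; rewrite inE => /eqP->; left.
have [l [k [lV k0 lk]]] := IH y (mem_head _ _).
have lV' : l \in [:: x, y & V] by rewrite inE lV orbT.
case: (ltgtP x l) => xl.
- exists x, (l - x); split; [exact: mem_head|by rewrite subr_gt0|].
  move=> z; rewrite inE => /orP[/eqP->|/lk[->|h]]; first by left.
    by right; rewrite addrC subrK.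
  by right; rewrite addrC subrK; apply: le_trans h; rewrite lerDl ltW.
- exists l, (Num.min k (x - l)); split=> //; first by rewrite lt_min k0 subr_gt0.
  move=> z; rewrite inE => /orP[/eqP->|/lk[->|h]]; [right| by left|right].
    by rewrite -lerBrDl ge_min lexx orbT.
  by apply: le_trans h; rewrite lerD2l ge_min lexx.
- exists l, k; split=> //.
  by move=> z; rewrite inE => /orP[/eqP->|/lk//]; left.
Qed.

End GapLemma.

(** * Continuation and leading term of the symmetrised zeta function *)

Section SymMzeta.
Variables (R : realType) (r : nat) (a : nat -> R).
Hypothesis hr : (2 <= r)%N.
Hypothesis ha : forall i j : nat, (1 <= i)%N -> (i <= j)%N -> (j <= r)%N -> a j <= a i.
Hypothesis har : 0 < a r.
Variable F : 'rV[complex R]_r -> complex R.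
Hypothesis hF : is_mzeta F.
Local Notation C := (complex R).
Local Notation al := (a r).

Let b (i : 'I_r) : R := a i.+1.
Let f := sym_mzeta a F.
Let bs := [seq b i | i <- enum 'I_r].

Let b_ge i : al <= b i.
Proof. by apply: ha. Qed.

Let b_gt0 i : 0 < b i. Proof. exact: lt_le_trans har (b_ge i). Qed.

Let bs_all : all (>= al) bs.
Proof. by apply/allP => x /mapP[i _ ->]; exact: b_ge. Qed.

Let hoff_ffun N s : hoff bs N s =
  \sum_(m : {ffun 'I_r -> 'I_N.+1} | injectiveb m && [forall i, (0 < m i)%N])
     \prod_(i < r) npowN (m i) ((b i)%:C%C * s).
Proof.
rewrite /hoff isum_ffun.
rewrite (bigID (fun m : {ffun 'I_r -> 'I_N.+1} => [forall i, (0 < m i)%N])) /=.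
rewrite [X in _ + X](_ : _ = 0) ?addr0; last first.
  apply: big1 => m /andP[_ mn].
  have [i mi] : exists i, ~~ (0 < m i)%N by apply/existsP; rewrite -negb_forall.
  rewrite -eqn0Ngt in mi; move/eqP: mi => mi; rewrite (bigD1 i) //= /dterm.
  by have -> : m i == ord0; [apply/eqP/val_inj|rewrite mul0r].
apply: eq_big => [m|m /andP[_ /forallP mpos]].
  have -> : [forall i, m i \notin (finset.set0 : {set 'I_N.+1})] = true.
    by apply/forallP => i; rewrite finset.in_set0.
  by rewrite andbT.
apply: eq_bigr => i _; rewrite /dterm; case: ifP => // /eqP E.
by have := mpos i; rewrite E.
Qed.

Let row_s (t : {perm 'I_r}) (s : C) : 'rV[C]_r := \row_(i < r) ((a (t i).+1)%:C%C * s).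

(** The identity already holds for the finite sums with indices up to N, so no rearrangement of
    series is involved. *)
Lemma hoff_mzeta N s : hoff bs N s = \sum_(t : {perm 'I_r}) mzeta_partial (row_s t s) N.
Proof.
rewrite hoff_ffun -(sum_sorted (fun i (k : 'I_N.+1) => npowN k ((b i)%:C%C * s)) (fun k => (0 < k)%N)).
apply: eq_bigr => t _; apply: eq_bigr => n _; apply: eq_bigr => i _.
by rewrite mxE.
Qed.

Lemma row_domain t s : 2 / al <= Re s -> mzeta_domain (row_s t s).
Proof.
move=> ss l; rewrite /tail_sum (big_morph _ (@ReD R) (erefl _)).
have s2 i : 2 <= Re (row_s t s 0 i).
  rewrite mxE ReRM; apply: (@le_trans _ _ (al * Re s)).
    by move: ss; rewrite ler_pdivrMr // mulrC.
  rewrite ler_wpM2r //; last exact: b_ge.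
  by apply: le_trans ss; rewrite divr_ge0 // ltW.
apply: (@lt_le_trans _ _ (\sum_(i < r | (l <= i)%N) 2)); last by apply: ler_sum => i _; exact: s2.
rewrite -(big_geq_mkord l r predT (fun=> 2)) sumr_const_nat -mulr_natr.
have : 0 < (r - l)%:R :> R by rewrite ltr0n subn_gt0.
lra.
Qed.

Lemma f_lim s : 2 / al <= Re s -> limto (hoff bs ^~ s) (f s).
Proof.
move=> ss; apply: limto_ext (fun N => esym (hoff_mzeta N s)) _.
apply: limto_sum => t; apply: limto_cvg.
by have := mzeta_series hF (row_domain t ss).
Qed.

(** On a polar hyperplane a tail sum is real, whereas here its imaginary part is a positive multiple
    of Im s. *)
Lemma row_polar t s : 0 < Im s -> ~ mzeta_polar (row_s t s).
Proof.
move=> s0 [l [k [_ E]]]; have : Im (tail_sum (row_s t s) l) = 0.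
  by rewrite E -(rmorph_int (real_complex R)).
rewrite /tail_sum (big_morph _ (@ImD R) (erefl _)).
apply/eqP; rewrite gt_eqF // (bigD1 l) //= ltr_wpDr //.
  by apply: sumr_ge0 => i _; rewrite mxE ImRM mulr_ge0 ?ltW // b_gt0.
by rewrite mxE ImRM mulr_gt0 // b_gt0.
Qed.

Lemma f_hol : hol (uhalf 0) f.
Proof.
have -> : f = (fun s => \sum_(t <- index_enum {perm 'I_r}) F (row_s t s)).
  by apply/funext.
apply: hol_sum => t s s0; apply/differentiable_dif.
pose v : 'rV[C]_r := \row_(i < r) (a (t i).+1)%:C%C.
have rE : (fun x : C^o => F (row_s t x) : C^o) = (F : 'rV[C]_r -> C^o) \o ( *:%R ^~ v).
  apply/funext => x /=; congr F; apply/rowP => i; by rewrite !mxE mulrC.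
rewrite rE; apply: differentiable_comp; first by have [] := is_diff_scalel (s : C^o) v.
have sE : (s : C^o) *: v = row_s t s by apply/rowP => i; rewrite !mxE mulrC.
have := mzeta_holomorphic hF (@row_polar t s s0).
by move=> /nbhs_singleton; rewrite sE.
Qed.

(** The identity with psi follows from the series for Re s >= 2 / al, real s included, and spreads
    over the upper quadrant by the identity principle. On the real axis nearer to y3 nothing is
    claimed about f. *)
Lemma continuation : exists Bs A psi, [/\ all (>= al) Bs, 0 <= A, hol (rhalf (y3 al)) psi,
    forall s, y3 al < Re s -> cabs (psi s) <= A * etaP Bs s &
    (forall s, y3 al < Re s -> 0 < Im s -> kapP Bs s * f s = psi s) /\
    (forall s, 2 / al <= Re s -> kapP Bs s * f s = psi s)].
Proof.
have [Bs [A [psi [h1 h2 h3 h4 h5]]]] := good_hoff har bs_all.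
exists Bs, A, psi; split=> //.
have far s : 2 / al <= Re s -> kapP Bs s * f s = psi s.
  move=> ss; have [l [hl <-]] := h5 s ss.
  by rewrite (limto_unique (f_lim ss) hl).
split=> // s ys s0; apply/eqP; rewrite -subr_eq0; apply/eqP.
have hh : hol (fun z => rhalf (y3 al) z /\ uhalf 0 z) (fun z => kapP Bs z * f z - psi z).
  apply: holB; last by apply: hol_sub h3 => z [].
  apply: holM; first exact: hol_kapP.
  by apply: hol_sub f_hol => z [].
apply: (identity_quadrant (s1 := 2 / al) hh _ ys s0) => z zs z0.
by rewrite far ?subrr // ltW.
Qed.

(** The frequency of a tuple: its term in the Dirichlet series is exp (- lam g * s). *)
Definition lam (g : 'I_r -> nat) : R := \sum_(i < r) b i * ln (g i)%:R.

Local Notation lm m := (lam (fun i => nat_of_ord (m i))).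

Let adm N (m : {ffun 'I_r -> 'I_N.+1}) := injectiveb m && [forall i, (0 < m i)%N].

Let lamE N (m : {ffun 'I_r -> 'I_N.+1}) s :
  \prod_(i < r) npowN (m i) ((b i)%:C%C * s) = cexp (- ((lm m)%:C%C * s)).
Proof.
rewrite /npowN -cexp_sum; congr cexp.
rewrite /lam rmorph_sum /= mulr_suml -sumrN; apply: eq_bigr => i _.
by rewrite rmorphM /=; ring.
Qed.

Let lam_term (g : 'I_r -> nat) i : (forall i, (0 < g i)%N) -> b i * ln (g i)%:R <= lam g.
Proof.
move=> g0; rewrite /lam (bigD1 i) //= lerDl; apply: sumr_ge0 => j _.
by rewrite mulr_ge0 ?(ltW (b_gt0 _)) // ln_ge0 // ler1n.
Qed.

(** The least frequency and the gap above it do not depend on the truncation. With La the frequency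
    of (1, ..., r), an index exceeding L >= exp ((La + 1) / al) forces the frequency to be at least
    La + 1, so only the finitely many tuples with indices up to L compete. *)
Lemma lam_gap : exists l0 k N0, [/\ 0 < l0, 0 < k & forall N, (N0 <= N)%N ->
  (exists2 m : {ffun 'I_r -> 'I_N.+1}, adm m & lm m = l0) /\
  (forall m : {ffun 'I_r -> 'I_N.+1}, adm m -> lm m = l0 \/ l0 + k <= lm m)].
Proof.
pose g0 (i : 'I_r) := (i : nat).+1; pose La := lam g0.
pose L := maxn r (Num.truncn (expR ((La + 1) / al))).+1.
have Lb : expR ((La + 1) / al) <= L%:R.
  by apply: le_trans (ltW (truncnS_gt _)) _; rewrite ler_nat leq_maxr.
have rL : (r <= L)%N by exact: leq_maxl.
pose V := [seq lm m | m : {ffun 'I_r -> 'I_L.+1} <- enum {: {ffun 'I_r -> 'I_L.+1}} & adm m].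
have inV (m : {ffun 'I_r -> 'I_L.+1}) : adm m -> lm m \in V.
  by move=> am; apply/mapP; exists m; rewrite // mem_filter am mem_enum.
have transfer N (g : 'I_r -> nat) : (forall i, (0 < g i <= N)%N) -> injective g ->
    exists2 m : {ffun 'I_r -> 'I_N.+1}, adm m & lm m = lam g.
  move=> gN ginj; exists [ffun i => inord (g i)].
    apply/andP; split.
      apply/injectiveP => i j; rewrite !ffunE => /(congr1 val) /=.
      have /andP[_ gi] := gN i; have /andP[_ gj] := gN j.
      by rewrite !inordK ?ltnS //; exact: ginj.
    by apply/forallP => i; have /andP[g1 gi] := gN i; rewrite ffunE inordK ?ltnS.
  apply: eq_bigr => i _; have /andP[_ gi] := gN i.
  by rewrite ffunE inordK ?ltnS.
have adm_g N (m : {ffun 'I_r -> 'I_N.+1}) : adm m -> (forall i, (0 < m i)%N) /\ injective (fun i => m i : nat).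
  move=> /andP[/injectiveP minj /forallP mpos]; split=> // i j /= /val_inj; exact: minj.
have g0L i : (0 < g0 i <= L)%N by rewrite /g0 /=; apply: leq_trans rL.
have [m0 am0 m0E] := transfer L g0 g0L (fun i j => ltac:(by move=> [] /val_inj)).
have [l0 [k0 [lV k00 lk]]] := min_gap (inV m0 am0).
have l0La : l0 <= La.
  by rewrite /La -m0E; case: (lk _ (inV m0 am0)) => [->//|]; apply: le_trans; rewrite lerDl ltW.
have /mapP[m1] := lV; rewrite mem_filter => /andP[am1 _] m1E.
have [m1pos m1inj] := adm_g _ _ am1.
(* The gap is capped by 1 because a tuple with an index above L is only known to have frequency at
   least La + 1 >= l0 + 1. *)
exists l0, (Num.min k0 1), L; split.
(* As r >= 2, distinct positive indices cannot all be 1; hence l0 > 0. *)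
- have [i mi] : exists i, (1 < m1 i)%N.
    pose i0 := Ordinal (ltn_trans (ltn0Sn 0) hr); pose i1 := Ordinal hr.
    have [h|h] := ltnP 1 (m1 i0); first by exists i0.
    have [h'|h'] := ltnP 1 (m1 i1); first by exists i1.
    have e0 : m1 i0 = 1%N :> nat by apply/eqP; rewrite eqn_leq h m1pos.
    have e1 : m1 i1 = 1%N :> nat by apply/eqP; rewrite eqn_leq h' m1pos.
    by have := m1inj i0 i1; rewrite e0 e1 => /(_ erefl) /(congr1 val).
  rewrite m1E; apply: lt_le_trans (lam_term i m1pos).
  by rewrite mulr_gt0 ?b_gt0 // ln_gt0 // ltr1n.
- by rewrite lt_min k00 ltr01.
move=> N LN; split.
  have [|m am mE] := transfer N (fun i => m1 i : nat) _ m1inj.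
    move=> i; rewrite m1pos /=; apply: leq_trans LN; have := ltn_ord (m1 i).
    by rewrite ltnS.
  by exists m; rewrite // mE m1E.
move=> m am; have [mpos minj] := adm_g _ _ am.
have [/forallP ml|] := boolP [forall i, (m i <= L)%N].
  have [|m' am' m'E] := transfer L (fun i => m i : nat) _ minj.
    by move=> i; rewrite mpos ml.
  rewrite -m'E; case: (lk _ (inV m' am')) => [->|h]; [by left|right].
  by apply: le_trans h; rewrite lerD2l ge_min lexx.
rewrite negb_forall => H; right.
have [i mi] : exists i, ~~ (m i <= L)%N by apply/existsP.
rewrite -ltnNge in mi.
apply: le_trans (lam_term i mpos).
have lnm : (La + 1) / al <= ln (m i)%:R.
  rewrite -[leLHS]expRK ler_ln ?posrE ?expR_gt0 ?ltr0n ?mpos //.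
  by apply: le_trans Lb _; rewrite ler_nat ltnW.
have ln0 : 0 <= ln (m i)%:R :> R by rewrite ln_ge0 // ler1n mpos.
apply: (@le_trans _ _ (al * ln (m i)%:R)); last by rewrite ler_wpM2r // b_ge.
apply: (@le_trans _ _ (La + 1)).
  by apply: lerD => //; rewrite ge_min lexx orbT.
by move: lnm; rewrite ler_pdivrMr // mulrC.
Qed.

(** Dropping distinctness, the sum is at most a product of r sums of k ^ -2, each at most 2, since b
    i * (2 / al) >= 2. *)
Lemma lam_sum N : \sum_(m : {ffun 'I_r -> 'I_N.+1} | adm m) expR (- (lm m * (2 / al))) <= 2 ^+ r.
Proof.
pose e (k : 'I_N.+1) : R := if k == ord0 then 0 else (k%:R ^+ 2)^-1.
have e0 k : 0 <= e k by rewrite /e; case: ifP => // _; rewrite invr_ge0 sqr_ge0.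
have se : \sum_k e k <= 2.
  have H n : \sum_(i < n.+1) (i.+1%:R ^+ 2)^-1 <= 2 - n.+1%:R^-1 :> R.
    elim: n => [|n IH]; first by rewrite big_ord1 expr1n invr1; lra.
    rewrite big_ord_recr /=; apply: le_trans (lerD IH (lexx _)) _.
    rewrite -addrA lerD2l addrC -lerBrDr opprK [leRHS]addrC -[n.+2]addn1 natrD.
    have : 0 < n.+1%:R :> R by rewrite ltr0n.
    move: (n.+1%:R : R) => x x0.
    rewrite -subr_ge0.
    have -> : x^-1 - (x + 1)^-1 - ((x + 1) ^+ 2)^-1 = (x * (x + 1) ^+ 2)^-1.
      by field; rewrite gt_eqF ?gt_eqF //; lra.
    by rewrite invr_ge0 mulr_ge0 ?sqr_ge0 // ltW.
  rewrite big_ord_recl /e eqxx add0r; case: (N) => [|n]; first by rewrite big_ord0.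
  apply: le_trans (H n) _; rewrite gerBl invr_ge0 //.
apply: (@le_trans _ _ (\sum_(m : {ffun 'I_r -> 'I_N.+1}) \prod_i e (m i))); last first.
  rewrite -(bigA_distr_bigA (fun (i : 'I_r) k => e k)) /= prodr_const card_ord.
  by apply: lerXn2r => //; rewrite nnegrE // sumr_ge0.
rewrite big_mkcond /=; apply: ler_sum => m _; case: ifP => [/andP[_ /forallP mpos]|_]; last exact: prodr_ge0.
rewrite /lam mulr_suml -sumrN (big_morph _ (@expRD R) (@expR0 R)); apply: ler_prod => i _.
rewrite expR_ge0 /= /e; have mi := mpos i.
have -> : (m i == ord0) = false by apply/eqP => E; rewrite E in mi.
have m0 : 0 < (m i)%:R :> R by rewrite ltr0n.
have -> : ((m i)%:R ^+ 2)^-1 = expR (- (2 * ln (m i)%:R)) :> R.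
  by rewrite expRN expRM_natl lnK.
rewrite ler_expR lerN2 mulrAC ler_wpM2r //; first by rewrite ln_ge0 // ler1n.
by rewrite mulrCA ler_peMr // ler_pdivlMr // mul1r b_ge.
Qed.

(** After multiplication by exp (l0 s), the tuples of least frequency contribute their number, which
    is at least 1, and the others at most C1 exp (- k (Re s - 2 / al)). *)
Lemma lead : exists l0 C1 B0, [/\ 0 < l0, 0 <= C1, 2 / al <= B0 & forall s, B0 <= Re s ->
  2^-1 <= cabs (f s) * expR (l0 * Re s) <= C1].
Proof.
have [l0 [k [N0 [l00 k0 H]]]] := lam_gap.
pose C1 := expR (l0 * (2 / al)) * 2 ^+ r; have C10 : 0 <= C1 by rewrite mulr_ge0 ?expR_ge0 ?exprn_ge0.
have cE N s : hoff bs N s * cexp (l0%:C%C * s) =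
    \sum_(m : {ffun 'I_r -> 'I_N.+1} | adm m) cexp (- ((lm m - l0)%:C%C * s)).
  rewrite hoff_ffun mulr_suml; apply: eq_bigr => m _; rewrite lamE -cexpD; congr cexp.
  by rewrite rmorphB /=; ring.
have cC N : \sum_(m : {ffun 'I_r -> 'I_N.+1} | adm m) expR (- ((lm m - l0) * (2 / al))) <= C1.
  apply: le_trans (ler_wpM2l (expR_ge0 _) (lam_sum N)).
  rewrite mulr_sumr; apply: ler_sum => m _; rewrite -expRD; rewrite ler_expR; lra.
(* For Re s beyond this abscissa, k (Re s - 2 / al) >= 2 C1, and exp x >= 1 + x makes the remainder
   at most 1/2. *)
have lB : 2 / al <= 2 / al + 2 * C1 / k by rewrite lerDl; apply: divr_ge0; [exact: mulr_ge0|exact: ltW].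
exists l0, C1, (2 / al + 2 * C1 / k); split=> // s Bs.
have lim : limto (fun N => hoff bs N s * cexp (l0%:C%C * s)) (f s * cexp (l0%:C%C * s)).
  by apply: limtoM; [apply: f_lim; exact: le_trans Bs|exact: limto_cst].
have <- : cabs (f s * cexp (l0%:C%C * s)) = cabs (f s) * expR (l0 * Re s).
  by rewrite cabsM cabs_cexp ReRM.
have ss : 2 / al <= Re s by exact: le_trans Bs.
apply/andP; split.
- apply: (limto_ge lim); exists N0 => N NN; rewrite cE.
  have [[m0 am0 m0E] H2] := H N NN.
  rewrite (bigID (fun m : {ffun 'I_r -> 'I_N.+1} => lm m == l0)) /=.
  have -> : \sum_(m : {ffun 'I_r -> 'I_N.+1} | adm m && (lm m == l0)) cexp (- ((lm m - l0)%:C%C * s)) =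
      (\sum_(m : {ffun 'I_r -> 'I_N.+1} | adm m && (lm m == l0)) 1 : nat)%:R.
    rewrite natr_sum; apply: eq_bigr => m /andP[_ /eqP->].
    by rewrite subrr rmorph0 mul0r oppr0 cexp0.
  have M1 : (1 <= \sum_(m : {ffun 'I_r -> 'I_N.+1} | adm m && (lm m == l0)) 1)%N.
    by rewrite (bigD1 m0) ?am0 ?m0E ?eqxx.
  have E2 : cabs (\sum_(m : {ffun 'I_r -> 'I_N.+1} | adm m && (lm m != l0)) cexp (- ((lm m - l0)%:C%C * s))) <= 2^-1.
    apply: le_trans (cabs_sum _ _ _) _.
    apply: (@le_trans _ _ (expR (- (k * (Re s - 2 / al))) * C1)).
      apply: le_trans (ler_wpM2l (expR_ge0 _) (cC N)).
      rewrite mulr_sumr big_mkcondr; apply: ler_sum => m am; case: ifP => [ml|_]; last first.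
        by rewrite mulr_ge0 ?expR_ge0.
      rewrite cabs_cexp ReN ReRM -expRD ler_expR.
      have xk : k <= lm m - l0.
        by case: (H2 m am) => [E|]; [rewrite E eqxx in ml|lra].
      have := ler_wpM2r (_ : 0 <= Re s - 2 / al) xk; rewrite subr_ge0 => /(_ ss); lra.
    rewrite expRN mulrC ler_pdivrMr ?expR_gt0 //.
    have h1 : 2 * C1 <= k * (Re s - 2 / al).
      have : 2 * C1 / k <= Re s - 2 / al by lra.
      by rewrite ler_pdivrMr // [_ * k]mulrC.
    have := expR_ge1Dx (k * (Re s - 2 / al)); lra.
  set M := (X in X%:R + _) in M1 *.
  have := cabs_rtri M%:R (\sum_(m : {ffun 'I_r -> 'I_N.+1} | adm m && (lm m != l0)) cexp (- ((lm m - l0)%:C%C * s))).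
  rewrite cabs_nat; have : 1 <= M%:R :> R by rewrite ler1n.
  lra.
- apply: (limto_le lim); exists N0 => N NN; rewrite cE.
  apply: le_trans (cabs_sum _ _ _) _; apply: le_trans (cC N); apply: ler_sum => m am.
  rewrite cabs_cexp ReN ReRM ler_expR lerN2 ler_wpM2l // subr_ge0.
  by have [_ H2] := H N NN; case: (H2 m am) => [->//|]; lra.
Qed.

End SymMzeta.

(** * Multiplicities of the w-points *)

Section Multiplicity.
Variable R : realType.
Local Notation C := (complex R).
Implicit Types (U : C -> Prop) (f q phi H : C -> C).

Lemma hol_punctured0 U f z : copen U -> hol U f -> U z ->
  (forall s, U s -> s != z -> f s = 0) -> f z = 0.
Proof.
move=> oU hf Uz H; apply/eqP; apply/negPn/negP => fz.
have f0 : 0 < cabs (f z) by rewrite cabs_gt0.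
have [d d0 hd] := hol_cnt hf Uz (e := cabs (f z) / 2) ltac:(lra).
have [d1 d10 hd1] := oU z Uz.
pose m := Num.min d d1; have m0 : 0 < m by rewrite lt_min d0.
have mh : cabs (m / 2)%:C%C = m / 2 by rewrite cabs_real ger0_norm //; lra.
have md : m <= d by rewrite ge_min lexx.
have md1 : m <= d1 by rewrite ge_min lexx orbT.
have := hd (m / 2)%:C%C; rewrite /= mh => /(_ ltac:(lra)).
rewrite H; first by rewrite sub0r cabsN; lra.
  by apply: hd1; rewrite mh; lra.
rewrite -subr_eq0 addrAC subrr add0r -cabs_gt0 mh; lra.
Qed.

Lemma hol_exp U f m : hol U f -> hol U (fun s => f s ^+ m).
Proof.
move=> hf; elim: m => [|m IH].
  have -> : (fun s => f s ^+ 0) = (fun=> 1) by apply/funext => s; rewrite expr0.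
  exact: hol_cst.
have -> : (fun s => f s ^+ m.+1) = (fun s => f s * f s ^+ m) by apply/funext => s; rewrite exprS.
exact: holM.
Qed.

(** Factors s - z are divided out of phi one at a time; each lowers m by one, and H z != 0 stops the
    process at m = 0. After each division the equation holds off z and extends to z by
    continuity. *)
Lemma order_le U q phi H z m : copen U -> U z -> hol U q -> hol U phi -> hol U H ->
  H z != 0 -> (forall s, U s -> q s * phi s = (s - z) ^+ m * H s) ->
  exists k psi, [/\ (k <= m)%N, hol U psi, psi z != 0 &
    forall s, phi s = (s - z) ^+ k * psi s].
Proof.
move=> oU Uz hq + hH Hz; elim: m phi => [|m IH] phi hphi E.
  exists 0%N, phi; split=> // [|s]; last by rewrite mul1r.
  by apply: contra_neq Hz => p0; have := E z Uz; rewrite p0 mulr0 mul1r => <-.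
have [p0|p0] := eqVneq (phi z) 0; last first.
  by exists 0%N, phi; split=> // s; rewrite mul1r.
have [p [hp pE]] := hol_quot oU hphi Uz.
have [|k [psi [km h1 h2 h3]]] := IH p hp.
  move=> s Us; apply/eqP; rewrite -subr_eq0; apply/eqP.
  have hd : hol U (fun s => q s * p s - (s - z) ^+ m * H s).
    apply: holB; first exact: holM.
    by apply: holM => //; apply: hol_exp; apply: holB; [exact: hol_id|exact: hol_cst].
  have off x : U x -> x != z -> q x * p x - (x - z) ^+ m * H x = 0.
    move=> Ux xz; have := E x Ux; rewrite pE p0 add0r exprS => Ex.
    have xz0 : x - z != 0 by rewrite subr_eq0.
    by apply: (mulfI xz0); rewrite mulrBr mulr0 !mulrA -Ex; ring.
  by have [->|sz] := eqVneq s z; [exact: hol_punctured0 hd Uz off|exact: off].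
exists k.+1, psi; split=> // s.
by rewrite pE p0 add0r h3 exprS mulrA.
Qed.

Lemma zero_order_le U f z k psi : copen U -> U z -> hol U psi -> psi z != 0 ->
  (forall s, f s = (s - z) ^+ k * psi s) -> (zero_order f z <= k%:R%:E)%E.
Proof.
move=> oU Uz hp p0 E; apply: ereal_inf_lbound => /=; exists k => //.
exists psi; split=> //; last by apply/nbhs_cabs; exists 1 => // x _; exact: E.
apply/nbhs_cabs; have [d d0 hd] := oU z Uz; exists d => // h /hd Uh.
by apply/differentiable_dif; exact: hp.
Qed.

Lemma prod_count (L : seq C) s z :
  \prod_(a <- L) (s - a) = (s - z) ^+ (count_mem z L) * \prod_(a <- L | a != z) (s - a).
Proof.
elim: L => [|a L IH] /=; first by rewrite !big_nil mulr1.
rewrite !big_cons IH; case: eqVneq => [->|_] /=; first by rewrite exprS mulrA.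
by rewrite add0n mulrCA.
Qed.

Lemma sum_count (X : choiceType) (s L : seq X) : uniq s -> (\sum_(z <- s) count_mem z L <= size L)%N.
Proof.
elim: s L => [|z s IH] L; first by rewrite big_nil.
rewrite big_cons /= => /andP[zs us]; rewrite -(count_predC (pred1 z) L) leq_add2l -size_filter.
apply: leq_trans (IH _ us); rewrite big_seq [leqRHS]big_seq; apply: leq_sum => x xs.
rewrite count_filter; apply: eq_leq; apply: eq_count => y /=.
by case: eqVneq => //= ->; apply/esym; apply: contraNneq zs => <-.
Qed.

(* [q] clears the denominator of [f - w]; its own zeros can only enlarge [L]. *)
Lemma count_points_le f (w : C) (b T : R) U V q g h (L : seq C) : copen U -> copen V -> hol U f -> hol U q ->
  hol V h -> (forall s, U s -> V s) ->
  (forall s, U s -> q s * (f s - w) = g s) -> (forall s, V s -> g s = h s * \prod_(a <- L) (s - a)) ->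
  (forall z, b < Re z -> 0 < Im z -> Im z < T -> U z) ->
  (forall z, b < Re z -> 0 < Im z -> Im z < T -> g z = 0 -> h z != 0) ->
  (count_points f w b T <= (size L)%:R%:E)%E.
Proof.
move=> oU oV hf hq hh UV gE gL regU regh; rewrite /count_points.
have key (z : C) : f z = w -> b < Re z -> 0 < Im z -> Im z < T ->
    (zero_order (fun s => (f s - w)%R) z <= (count_mem z L)%:R%:E)%E.
  move=> fz bz z0 zT; have Uz := regU z bz z0 zT.
  have gz : g z = 0 by rewrite -gE // fz subrr mulr0.
  pose H s := h s * \prod_(a <- L | a != z) (s - a).
  have [||||k [psi [km hpsi p0 E]]] := @order_le U q (fun s => f s - w) H z (count_mem z L) oU Uz hq.
  - by apply: holB => //; exact: hol_cst.
  - apply: holM; first exact: hol_sub hh.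
    have -> : (fun s => \prod_(a <- L | a != z) (s - a)) =
        (fun s => \prod_(a <- [seq a <- L | a != z]) (s - a)).
      by apply/funext => s; rewrite big_filter.
    by apply: hol_prod => a; apply: holB; [exact: hol_id|exact: hol_cst].
  - rewrite /H mulf_neq0 ?regh //; rewrite prodf_seq_neq0; apply/allP => a _ /=.
    by apply/implyP => az; rewrite subr_eq0 eq_sym.
  - move=> s Us; rewrite gE // gL; last exact: UV.
    by rewrite /H mulrCA; congr (_ * _); exact: prod_count.
  by apply: le_trans (zero_order_le oU Uz hpsi p0 E) _; rewrite lee_fin ler_nat.
have key2 (s : seq C) : uniq s -> (forall z, z \in s -> [/\ f z = w, b < Re z, 0 < Im z & Im z < T]) ->
    (\sum_(z <- s) zero_order (fun s => (f s - w)%R) z <= (size L)%:R%:E)%E.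
  move=> us Hs; apply: (@le_trans _ _ (\sum_(z <- s) ((count_mem z L)%:R : R)%:E)%E).
    by rewrite big_seq [leRHS]big_seq; apply: lee_sum => z /Hs[]; exact: key.
  by rewrite sumEFin lee_fin -natr_sum ler_nat; apply: sum_count.
(* The infinite sum is a supremum over finite sets of points, so [key2] suffices and finiteness of
   the set of w-points need not be proved first. *)
apply: ge_ereal_sup => _ [X [finX XS] <-].
rewrite fsbig_finite //; apply: key2; first exact: finmap.fset_uniq.
by move=> z; rewrite in_fset_set // => /set_mem /XS.
Qed.

End Multiplicity.

(** * Growth of the eta product and its mean on the left line *)

Section LeftLine.
Variables (R : realType) (al : R).
Hypothesis al_gt0 : 0 < al.
Local Notation C := (complex R).

(** A crude bound from ln (1 + x) <= x and the linear growth of eta. It serves only on the arc,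
    where the weight Re z is O(1 / T). *)
Lemma ln_etaP Bs : all (>= al) Bs -> exists2 D, 0 <= D &
  forall s, y3 al < Re s -> ln (etaP Bs s) <= D * (cabs s + 1).
Proof.
elim: Bs => [|b Bs IH] /=.
  by move=> _; exists 0 => // s _; rewrite /etaP big_nil ln1 mul0r.
move=> /andP[ab /IH[D D0 HD]].
have b0 : 0 < b by exact: lt_le_trans ab.
exists (2 * b + 4 + D) => [|s ys]; first lra.
have e1 := etaP_ge1 Bs s.
rewrite /etaP big_cons -/(etaP Bs s) lnM ?posrE; last 2 first.
- by rewrite ltr_wpDr ?cabs_ge0.
- exact: lt_le_trans e1.
rewrite mulrDl; apply: lerD; last exact: HD.
apply: le_trans (le_ln1Dx _) _; first by apply: lt_le_trans (cabs_ge0 _); lra.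
apply: le_trans (eta_growth (ltW (Re_scaled al_gt0 ab ys))) _.
rewrite cabsM cabs_real gtr0_norm //; have := mulr_ge0 (ltW b0) (cabs_ge0 s); have := cabs_ge0 s.
lra.
Qed.

Lemma is_derive_affine (p q t : R) : is_derive t 1 (fun y : R => p - q * y) (- q).
Proof.
apply/is_derive_eps => e e0; exists 1 => // h _.
rewrite [X in `|X|](_ : _ = 0); last by ring.
by rewrite normr0 mulr_ge0 // ltW.
Qed.

(* Concavity of ln in disguise: with X = |eta| and l = ln T, the order of the mean
   square of |eta|, integration bounds the mean of ln |eta| by ln ln T / 2 + O(1). *)
Lemma ln4D (l X : R) : 0 < l -> 0 <= X -> ln (4 + X) <= ln l / 2 + (16 + X ^+ 2) / l.
Proof.
move=> l0 X0; have X4 : 0 < 4 + X by lra.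
have q0 : 0 < (4 + X) ^+ 2 / l by rewrite divr_gt0 // exprn_gt0.
have h1 : ln ((4 + X) ^+ 2) = ln (4 + X) *+ 2 by rewrite lnXn.
have h2 : ln ((4 + X) ^+ 2) = ln ((4 + X) ^+ 2 / l) + ln l.
  by rewrite -lnM ?posrE // divfK ?gt_eqF.
have h3 := ltW (ln_sublinear q0).
have h4 : (4 + X) ^+ 2 / l <= 2 * ((16 + X ^+ 2) / l).
  rewrite mulrA ler_pM2r ?invr_gt0 //; have := sqr_ge0 (4 - X); rewrite !expr2; lra.
move: h1; rewrite h2 mulr2n; lra.
Qed.

Lemma left_line1 (B0 b : R) : al <= b -> exists K T0, forall T x0 rr : R, T0 <= T ->
  y3 al < x0 -> x0 <= B0 -> T <= rr -> rr <= 2 * T ->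
  exists u P : R -> R, [/\ forall y : R, is_derive y 1 P (u y), forall y, 0 <= u y,
    forall y, -1 <= y <= 1 -> ln (1 + cabs (eta (b%:C%C * Complex x0 (T / 2 - rr * y)))) <= u y &
    P 1 - P (- 1) <= K * ln (ln T)].
Proof.
move=> ab; have b0 : 0 < b by exact: lt_le_trans ab.
pose H := 2 + ln (8 * b + 1).
have lb0 : 0 <= ln (8 * b + 1) by rewrite ln_ge0 //; lra.
have H0 : 2 <= H by rewrite /H; lra.
(* For T >= exp (exp 1) both ln T and ln (ln T) are at least 1. Then 33 = 1 + 32 bounds 2 * k1 in
   units of ln (ln T), and 66 H comes from 2 b rr + 8 N <= 66 b rr together with [hN]. *)
exists (33 + 66 * H), (Num.max (expR (expR 1)) B0) => T x0 rr.
rewrite ge_max => /andP[TT TB] yx xB Tr rT.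
have T0 : 0 < T by exact: lt_le_trans (expR_gt0 _) TT.
have T1 : 1 <= T by apply: le_trans TT; rewrite -expR0 ler_expR expR_ge0.
have lT : expR 1 <= ln T by rewrite -[leLHS]expRK ler_ln ?posrE ?expR_gt0.
have lam0 : 0 < ln T by exact: lt_le_trans (expR_gt0 _) lT.
have lam1 : 1 <= ln T by apply: le_trans lT; rewrite -[leLHS]expR0 ler_expR.
have llT : 1 <= ln (ln T) by rewrite -[leLHS]expRK ler_ln ?posrE ?expR_gt0.
(* On the line |s| <= 4 T, so this length satisfies 2 |b s| <= N + 1, as [eta_approx] requires. *)
pose N := Num.truncn (8 * b * T).
have bT0 : 0 <= 8 * b * T by rewrite !mulr_ge0 // ltW.
have NT : N%:R <= 8 * b * T by rewrite truncn_le.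
have TN : 8 * b * T <= N.+1%:R by exact: ltW (truncnS_gt _).
have x00 : 0 < x0 by exact: lt_trans (y3_gt0 al_gt0) yx.
have bx : 2^-1 <= b * x0.
  by have := Re_scaled (s := Complex x0 0) al_gt0 ab yx; rewrite ReRM; exact: ltW.
have [V [dV VV]] := mean_square N bx.
have hN : harm R N <= H * ln T.
  apply: le_trans (harm_mono _ (leqnSn N)) _; apply: le_trans (harm_ln _ N) _.
  have : ln (N.+1%:R : R) <= ln ((8 * b + 1) * T).
    rewrite ler_ln ?posrE ?ltr0n // ?mulr_gt0 //; last lra.
    by rewrite -addn1 natrD; lra.
  rewrite lnM ?posrE //; last lra.
  have := ler_wpM2l lb0 lam1; rewrite /H; lra.
have r0 : 0 < rr by lra.
pose k1 := ln (ln T) / 2 + 16 / ln T; pose k2 := (b * rr * ln T)^-1.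
(* P is obtained from V by the substitution t = b (T / 2) - b rr y, which scales by b rr and
   reverses orientation; hence the coefficient - k2. *)
have k20 : 0 < b * rr * ln T by rewrite !mulr_gt0.
pose X y := cabs (alt N (Complex (b * x0) (b * (T / 2) - b * rr * y))).
exists (fun y => k1 + X y ^+ 2 / ln T), (fun y => k1 * y + (- k2) * V (b * (T / 2) - b * rr * y)); split.
- move=> y.
  have d1 := @is_derive1_comp _ V (fun y : R => b * (T / 2) - b * rr * y) y _ _ (dV _) (is_derive_affine (b * (T / 2)) (b * rr) y).
  have d2 := @is_deriveZ _ R^o R^o _ (- k2) y 1 _ d1.
  have d3 := is_deriveD (is_derive_lin k1 y) d2.
  suff <- : k1 + (- k2) *: (cabs (alt N (Complex (b * x0) (b * (T / 2) - b * rr * y))) ^+ 2 * - (b * rr) : R^o) = k1 + X y ^+ 2 / ln T by exact: d3.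
  rewrite /GRing.scale /= /X /k2; congr (_ + _); move: (cabs _) (ln T) lam0 => z l l0.
  by field; rewrite !gt_eqF.
- move=> y; rewrite /k1 !addr_ge0 // ?divr_ge0 ?sqr_ge0 // ?(ltW lam0) //; lra.
- move=> y /andP[y1 y2].
  have sE : b%:C%C * Complex x0 (T / 2 - rr * y) = Complex (b * x0) (b * (T / 2) - b * rr * y) :> C.
    by apply/eqP; rewrite eq_complex ReRM ImRM /= mulrBr [b * (rr * y)]mulrA !eqxx.
  have ry : `|rr * y| <= rr by rewrite normrM gtr0_norm // ger_pMr // ler_norml y1.
  have sT : 2 * cabs (b%:C%C * Complex x0 (T / 2 - rr * y)) <= N.+1%:R.
    apply: le_trans TN; rewrite cabsM cabs_real gtr0_norm //.
    have := cabs_le_ReIm (Complex x0 (T / 2 - rr * y)) => /=.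
    rewrite (gtr0_norm x00); have : `|T / 2 - rr * y| <= T / 2 + rr.
      by apply: le_trans (ler_normB _ _) _; rewrite (@ger0_norm _ (T / 2)); lra.
    move=> h1 h2; have h3 : cabs (Complex x0 (T / 2 - rr * y)) <= 4 * T by lra.
    by have := ler_wpM2l (ltW b0) h3; lra.
  have e1 := eta_approx (ltW (Re_scaled (s := Complex x0 (T / 2 - rr * y)) al_gt0 ab yx)) sT.
  apply: (@le_trans _ _ (ln (4 + X y))).
    rewrite ler_ln ?posrE; first by move: e1; rewrite sE /X; lra.
      by have := cabs_ge0 (eta (b%:C%C * Complex x0 (T / 2 - rr * y))); lra.
    by have := cabs_ge0 (alt N (Complex (b * x0) (b * (T / 2) - b * rr * y))); rewrite /X; lra.
  by apply: le_trans (ln4D lam0 (cabs_ge0 _)) _; rewrite /k1 mulrDl addrA.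
have VD := VV (b * (T / 2) - b * rr) (b * (T / 2) + b * rr) ltac:(have := mulr_gt0 b0 r0; lra).
have VD2 : V (b * (T / 2) + b * rr) - V (b * (T / 2) - b * rr) <= 66 * H * (b * rr * ln T).
  apply: le_trans VD _.
  apply: (@le_trans _ _ (66 * (b * rr) * (H * ln T))); last by rewrite le_eqVlt; apply/orP; left; apply/eqP; ring.
  have br0 := mulr_gt0 b0 r0; have bTr := ler_wpM2l (ltW b0) Tr.
  apply: ler_pM => //; [|exact: harm_ge0|lra].
  by rewrite addr_ge0 ?mulr_ge0 ?ler0n //; lra.
have E16 : 16 / ln T <= 16 by rewrite ler_pdivrMr // ler_peMr.
have VK : k2 * (V (b * (T / 2) + b * rr) - V (b * (T / 2) - b * rr)) <= 66 * H.
  by rewrite /k2 mulrC ler_pdivrMr.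
rewrite !mulr1 !mulrN1 opprK /k1; have := ler_wpM2l (_ : 0 <= 66 * H) llT.
move=> /(_ ltac:(lra)); lra.
Qed.

Lemma left_line (B0 : R) Bs : all (>= al) Bs -> exists K T0, forall T x0 rr : R, T0 <= T ->
  y3 al < x0 -> x0 <= B0 -> T <= rr -> rr <= 2 * T ->
  exists u P : R -> R, [/\ forall y : R, is_derive y 1 P (u y), forall y, 0 <= u y,
    forall y, -1 <= y <= 1 -> ln (etaP Bs (Complex x0 (T / 2 - rr * y))) <= u y &
    P 1 - P (- 1) <= K * ln (ln T)].
Proof.
elim: Bs => [|b Bs IH] /=.
  move=> _; exists 0, 0 => T x0 rr _ _ _ _ _; exists (fun=> 0), (fun=> 0); split=> //.
  - by move=> y; exact: is_derive_cst.
  - by move=> y _; rewrite /etaP big_nil ln1.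
  - by rewrite subrr mul0r.
move=> /andP[ab /IH[K2 [T2 H2]]]; have [K1 [T1 H1]] := left_line1 B0 ab.
exists (K1 + K2), (Num.max T1 T2) => T x0 rr; rewrite ge_max => /andP[t1 t2] yx xB Tr rT.
have [u1 [P1 [a1 a2 a3 a4]]] := H1 T x0 rr t1 yx xB Tr rT.
have [u2 [P2 [b1 b2 b3 b4]]] := H2 T x0 rr t2 yx xB Tr rT.
exists (fun y => u1 y + u2 y), (fun y => P1 y + P2 y); split.
- by move=> y; exact: is_deriveD.
- by move=> y; exact: addr_ge0.
- move=> y y1; rewrite /etaP big_cons -/(etaP Bs _) lnM ?posrE; first by apply: lerD; [exact: a3|exact: b3].
    by rewrite ltr_wpDr ?cabs_ge0.
  exact: lt_le_trans (etaP_ge1 _ _).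
- by rewrite mulrDl; lra.
Qed.

End LeftLine.

(** * Counting zeros *)

Section ZeroCount.
Variables (R : realType) (al : R) (Bs : seq R).
Local Notation C := (complex R).
Variables (g : C -> C) (A c B0 : R).
Hypotheses (al_gt0 : 0 < al) (bs_al : all (>= al) Bs).
Hypotheses (A_ge1 : 1 <= A) (c_gt0 : 0 < c) (y3_lt : y3 al < B0).
Hypothesis g_le : forall s, y3 al < Re s -> cabs (g s) <= A * etaP Bs s.
Hypothesis g_far : forall s, B0 <= Re s -> c <= cabs (g s) <= A.

Let lnA0 : 0 <= ln A. Proof. exact: ln_ge0. Qed.
Let B00 : 0 < B0. Proof. exact: lt_trans (y3_gt0 al_gt0) y3_lt. Qed.

Let ln_g s : y3 al < Re s -> ln (cabs (g s)) <= ln A + ln (etaP Bs s).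
Proof.
move=> ys; have e1 := etaP_ge1 Bs s; have e0 := ln_ge0 e1.
have [g0|g0] := eqVneq (g s) 0.
  (* At a zero of g the convention ln 0 = 0 applies, and the right-hand side is nonnegative. *)
  by rewrite g0 cabs0 ln0 // addr_ge0.
have A0 : 0 < A by exact: lt_le_trans A_ge1.
have E0 : 0 < etaP Bs s by exact: lt_le_trans e1.
by rewrite -lnM ?posrE // ler_ln ?posrE ?mulr_gt0 ?cabs_gt0 // g_le.
Qed.

(** Where Re s >= B0, g is bounded. Elsewhere rr Re z < B0, so Re z <= B0 / T offsets the bound O(T)
    for ln |g|. *)
Lemma arc_bound : exists2 K, 0 <= K & forall T x0 rr z, Num.max 1 B0 <= T ->
  y3 al < x0 -> x0 <= B0 -> T <= rr -> rr <= 2 * T -> cabs z = 1 -> 0 <= Re z ->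
  Re z * ln (cabs (g (Complex x0 (T / 2) + rr%:C%C * z))) <= K.
Proof.
have [D D0 HD] := ln_etaP al_gt0 bs_al; have hB := B00; have hA := lnA0.
exists (ln A + B0 * (ln A + 5 * D)) => [|T x0 rr z].
  by rewrite addr_ge0 // mulr_ge0 ?(ltW hB) // addr_ge0 // mulr_ge0.
rewrite ge_max => /andP[T1 TB] yx xB Tr rT z1 z0.
move sE : (Complex x0 (T / 2) + rr%:C%C * z) => s.
have Rs : Re s = x0 + rr * Re z by rewrite -sE ReD ReRM.
have r0 : 0 < rr by lra.
have rz0 := mulr_ge0 (ltW r0) z0; have y30 := y3_gt0 al_gt0.
have zle : Re z <= 1 by have := Re_le_cabs z; rewrite z1 ler_norml => /andP[].
have BX : 0 <= B0 * (ln A + 5 * D) by rewrite mulr_ge0 ?(ltW hB) // addr_ge0 // mulr_ge0.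
have [Bs'|sB] := leP B0 (Re s).
  have /andP[g1 g2] := g_far Bs'.
  have lg : ln (cabs (g s)) <= ln A.
    rewrite ler_ln ?posrE //; [exact: lt_le_trans g1|exact: lt_le_trans A_ge1].
  have := ler_wpM2l z0 lg; have := ler_wpM2r hA zle; lra.
have ys : y3 al < Re s by lra.
have lg := ln_g ys; have lD := HD s ys.
have sT : cabs s + 1 <= 5 * T.
  rewrite -sE; have := cabsD (Complex x0 (T / 2)) (rr%:C%C * z).
  rewrite cabsM z1 mulr1 cabs_real gtr0_norm //.
  have := cabs_le_ReIm (Complex x0 (T / 2)) => /=.
  rewrite !ger0_norm; lra.
have l5 : ln (cabs (g s)) <= (ln A + 5 * D) * T.
  have := ler_wpM2l D0 sT; have := ler_wpM2l hA T1; lra.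
have zB : Re z * T <= B0.
  by have := ler_wpM2r z0 Tr; lra.
apply: le_trans (ler_wpM2l z0 l5) _; rewrite mulrCA mulrC.
have : 0 <= ln A + 5 * D by rewrite addr_ge0 // mulr_ge0.
by move=> q0; have := ler_wpM2r q0 zB; lra.
Qed.

Lemma prod_rescale (L : seq C) (s0 z : C) (rr : R) : 0 < rr ->
  rr%:C%C ^+ size L * \prod_(a <- [seq (rr^-1)%:C%C * (a - s0) | a <- L]) (z - a) =
  \prod_(a <- L) (s0 + rr%:C%C * z - a).
Proof.
move=> r0; have rE : rr%:C%C * (rr^-1)%:C%C = 1 :> C by rewrite -rmorphM /= mulfV ?gt_eqF.
elim: L => [|a L IH] /=; first by rewrite !big_nil mulr1.
rewrite !big_cons -IH exprS mulrACA; congr (_ * _).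
by rewrite mulrBr mulrA rE mul1r; ring.
Qed.

(** Jensen's inequality after rescaling to the unit half disc. The point 1/2 goes to real part x0 +
    rr / 2 >= B0, where |g| >= c, so the lower bound at the centre does not depend on T. K and T0
    are fixed before x0, rr and L. *)
Lemma halfdisc_count : exists K T0, forall T x0 rr eta h (L : seq C), T0 <= T ->
  y3 al < x0 -> x0 <= B0 -> T <= rr -> rr <= 2 * T -> 0 < eta -> eta <= 4^-1 ->
  let s0 := Complex x0 (T / 2) in
  hol (hdisc eta) (fun z => h (s0 + rr%:C%C * z)) ->
  (forall z, hdisc eta z -> h (s0 + rr%:C%C * z) != 0) ->
  (forall s, y3 al < Re s -> g s = h s * \prod_(a <- L) (s - a)) ->
  (forall a, a \in L -> Re a != x0 /\ cabs (a - s0) != rr) ->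
  \sum_(a <- L | (x0 < Re a) && (cabs (a - s0) <= 3 / 4 * rr)) (Re a - x0) / rr / 20 <=
    K * ln (ln T).
Proof.
have [K K0 HK] := arc_bound; have [K1 [T1 H1]] := left_line al_gt0 B0 bs_al.
have hB := B00; have hA := lnA0.
(* The lower bound c for |g| may exceed 1, whereas [jensen_halfdisc] asks for a nonnegative A. *)
pose Aj := Num.max 0 (- ln c); have Aj0 : 0 <= Aj by rewrite le_max lexx.
have cAj : - Aj <= ln c by rewrite lerNl le_max lexx orbT.
pose K2 := Aj + 2 * pi * K + 6 * ln A.
have K20 : 0 <= K2 by rewrite /K2 !addr_ge0 // !mulr_ge0 // pi_ge0.
exists (K2 + 3 * K1), (Num.max T1 (Num.max (expR (expR 1)) (Num.max 1 (2 * B0)))).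
move=> T x0 rr et h L; rewrite !ge_max => /and4P[TT1 Tee T1' TB] yx xB Tr rT et0 et4 s0 hh h0 gE gen.
have [u [P [dP u0 Pu PK]]] := H1 T x0 rr TT1 yx xB Tr rT.
have T0 : 0 < T by lra.
have r0 : 0 < rr by lra.
have y30 := y3_gt0 al_gt0.
have llT : 1 <= ln (ln T).
  have lT : expR 1 <= ln T by rewrite -[leLHS]expRK ler_ln ?posrE ?expR_gt0.
  by rewrite -[leLHS]expRK ler_ln ?posrE ?expR_gt0 //; exact: lt_le_trans (expR_gt0 _) lT.
pose sc (a : C) := (rr^-1)%:C%C * (a - s0).
pose h' z := h (s0 + rr%:C%C * z) * rr%:C%C ^+ size L.
have Rsc a : Re (sc a) = (Re a - x0) / rr by rewrite ReRM ReB mulrC.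
have csc a : cabs (sc a) = cabs (a - s0) / rr.
  by rewrite cabsM cabs_real ger0_norm ?invr_ge0 ?(ltW r0) // mulrC.
have gE' z : 0 <= Re z -> h' z * \prod_(a <- map sc L) (z - a) = g (s0 + rr%:C%C * z).
  move=> z0; rewrite /h' -mulrA prod_rescale // gE //.
  by rewrite ReD ReRM /=; have := mulr_ge0 (ltW r0) z0; lra.
have rn0 : rr%:C%C ^+ size L != 0 :> C.
  by rewrite expf_neq0 // -cabs_gt0 cabs_real gtr0_norm.
have ccE : s0 + rr%:C%C * (2^-1)%:C%C = Complex (x0 + rr / 2) (T / 2) :> C.
  by apply/eqP; rewrite eq_complex ReD ReRM ImD ImRM /= mulr0 addr0 !eqxx.
have cc0 : 0 <= Re ((2^-1)%:C%C : C) by rewrite /= invr_ge0.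
have ccB : B0 <= Re (s0 + rr%:C%C * (2^-1)%:C%C) by rewrite ccE /=; lra.
have /andP[gc1 gc2] := g_far ccB.
have j1 : hol (hdisc et) h' by apply: holM => //; exact: hol_cst.
have j2 z : hdisc et z -> h' z != 0 by move=> /h0 hz; rewrite /h' mulf_neq0.
have j3 a : a \in map sc L -> (0 < Re a) && (cabs a < 1) || (Re a < 0) || (1 < cabs a).
  move=> /mapP[b bL ->]; have [b1 b2] := gen b bL; rewrite Rsc csc.
  rewrite !ltr_pdivrMr // !ltr_pdivlMr // !mul0r !mul1r.
  rewrite subr_gt0 subr_lt0; case: (ltgtP (Re b) x0) b1 => //; case: (ltgtP (cabs (b - s0)) rr) b2 => //.
have j4 (y : R) : -1 <= y <= 1 -> is_derive y 1 (fun y => ln A * y + P y) (ln A + u y).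
  by move=> _; apply: is_deriveD => //; exact: is_derive_lin.
have j5 y : -1 <= y <= 1 -> 0 <= ln A + u y by move=> _; rewrite addr_ge0.
have j6 y : -1 <= y <= 1 ->
    ln (cabs (h' (Complex 0 (- y)) * \prod_(a <- map sc L) (Complex 0 (- y) - a))) <= ln A + u y.
  move=> y1; rewrite gE' //=.
  have -> : s0 + rr%:C%C * Complex 0 (- y) = Complex x0 (T / 2 - rr * y).
    by apply/eqP; rewrite eq_complex ReD ReRM ImD ImRM /= mulr0 addr0 mulrN !eqxx.
  by apply: le_trans (ln_g _) _ => //; rewrite lerD2l; exact: Pu.
have j7 z : cabs z = 1 -> 0 <= Re z ->
    Re z * ln (cabs (h' z * \prod_(a <- map sc L) (z - a))) <= K.
  by move=> z1 z0; rewrite gE' //; apply: HK => //; rewrite ge_max T1' /=; lra.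
have j8 : h' (2^-1)%:C%C * \prod_(a <- map sc L) ((2^-1)%:C%C - a) != 0.
  by rewrite gE' // -cabs_gt0; exact: lt_le_trans gc1.
have j9 : - Aj <= ln (cabs (h' (2^-1)%:C%C * \prod_(a <- map sc L) ((2^-1)%:C%C - a))).
  rewrite gE' //; apply: le_trans cAj _; rewrite ler_ln ?posrE //; exact: lt_le_trans gc1.
have := jensen_halfdisc et0 et4 j1 j2 j3 j4 j5 j6 K0 j7 j8 Aj0 j9.
rewrite big_map; under eq_bigl => a do
  rewrite Rsc csc ltr_pdivlMr // mul0r subr_gt0 ler_pdivrMr //.
under eq_bigr => a _ do rewrite Rsc.
move=> J; apply: le_trans J _.
have := ler_wpM2l K20 llT; rewrite /K2; lra.
Qed.

Lemma avoid (V : seq R) (p q : R) : p < q -> exists x, [/\ p < x, x < q & x \notin V].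
Proof.
elim: V p q => [|v V IH] p q pq; first by exists ((p + q) / 2); split=> //; lra.
have [vq|qv] := ltP v q; last first.
  have [x [px xq xV]] := IH p q pq; exists x; split=> //.
  by rewrite inE negb_or xV andbT lt_eqF // (lt_le_trans xq).
have [|x [px xq xV]] := IH (Num.max p v) q; first by rewrite gt_max pq.
move: px; rewrite gt_max => /andP[px vx]; exists x; split=> //.
by rewrite inE negb_or xV andbT gt_eqF.
Qed.

Hypothesis g_hol : hol (rhalf (y3 al)) g.

Lemma far_neq0 s : B0 <= Re s -> g s != 0.
Proof. by move=> /g_far/andP[g1 _]; rewrite -cabs_gt0; exact: lt_le_trans g1. Qed.

(** Zeros can be extracted only in discs about a point where g does not vanish. A disc of very large
    radius centred far to the right, close to a half plane, covers the half disc region and still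
    stays in Re s > y3. *)
Lemma region_zeros (T delta : R) : B0 <= T -> 0 < delta -> delta <= B0 - y3 al ->
  let xm := y3 al + delta / 4 in let sm := Complex xm (T / 2) in
  exists L h, [/\ hol (rhalf (y3 al)) h, forall s, g s = h s * \prod_(a <- L) (s - a) &
    forall s, xm - delta / 16 <= Re s -> cabs (s - sm) <= 4 * T + B0 -> h s != 0].
Proof.
move=> TB d0 dB xm sm; have hB := B00.
pose d := delta / 8; have d1 : 0 < d by rewrite /d; lra.
have [Q Q0 QE] : exists2 Q : R, 0 <= Q & Q = (4 * T + B0) ^+ 2.
  by exists ((4 * T + B0) ^+ 2); rewrite ?sqr_ge0.
(* A point of the region has real part at least xm - d / 2 and |s - sm|^2 <= Q, so its squared
   distance from the centre is at most X^2 + X d + Q <= (X + d)^2. The disc of radius X + 2 d just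
   touches Re s = y3. *)
have [X [X0 XB XQ]] : exists X, [/\ 0 <= X, B0 <= X & Q <= X * d].
  have q0 : 0 <= Q / d by rewrite divr_ge0 // ltW.
  exists (Q / d + B0); split; [lra|lra|rewrite mulrDl divfK ?gt_eqF // lerDl mulr_ge0 // ltW //].
pose cc := Complex (xm + X) (T / 2).
have cdsub z : cdisc cc (X + 2 * d) z -> rhalf (y3 al) z.
  move=> zc; have := Re_le_cabs (z - cc); rewrite ReB /= ler_norml => /andP[z1 _].
  by move: zc z1; rewrite /cdisc /rhalf /xm /d; lra.
have gcc : g cc != 0 by apply: far_neq0; rewrite /= /xm; have := y3_gt0 al_gt0; lra.
have XX : 0 < X + d by lra.
have XX1 : X + d < X + 3 / 2 * d by lra.
have XX2 : X + 3 / 2 * d < X + 2 * d by lra.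
have [L [h [hh _ gE h0]]] := extract_zeros (@copen_rhalf _ _) XX XX1 XX2 cdsub g_hol gcc.
exists L, h; split=> // s sx sR; apply: h0.
rewrite -(@ler_pXn2r _ 2) ?nnegrE ?cabs_ge0 //; last lra.
have : cabs (s - sm) ^+ 2 <= Q by rewrite QE ler_pXn2r ?nnegrE ?cabs_ge0 //; lra.
rewrite !cabs_sqr !ReB !ImB /= !expr2.
have := ler_wpM2l X0 (_ : - (d / 2) <= Re s - xm) => /(_ ltac:(rewrite /d; lra)).
have := mulr_gt0 d1 d1.
move: (Re s) (Im s) => p q; lra.
Qed.

Lemma region_count : exists K T0, forall T delta, T0 <= T -> 0 < delta -> exists L h,
  [/\ hol (rhalf (y3 al)) h, forall s, g s = h s * \prod_(a <- L) (s - a),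
    forall z, y3 al + delta < Re z -> 0 < Im z -> Im z < T -> g z = 0 -> h z != 0 &
    (size L)%:R <= K * (T * ln (ln T) / delta)].
Proof.
have [K1 [T1 H1]] := halfdisc_count; have hB := B00; have y30 := y3_gt0 al_gt0.
(* Each counted zero has weight at least (delta / 2) / (2 T) / 20 = delta / (80 T). The maximum with
   0 makes the bound nonnegative for an empty list. *)
exists (80 * Num.max 0 K1), (Num.max T1 (Num.max (expR 1) (4 * B0))) => T delta.
rewrite !ge_max => /and3P[TT1 Te TB] d0.
have T0 : 0 < T by exact: lt_le_trans (expR_gt0 1) Te.
have ll0 : 0 <= ln (ln T).
  by rewrite ln_ge0 // -[leLHS]expRK ler_ln ?posrE ?expR_gt0.
(* For large delta the region lies in Re s > B0, where g has no zero. *)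
have [dB|Bd] := leP delta (B0 - y3 al); last first.
  exists [::], g; split=> //.
  - by move=> s; rewrite big_nil mulr1.
  - by move=> z zd _ _ gz; apply: far_neq0; lra.
  - by rewrite !mulr_ge0 ?invr_ge0 ?(ltW d0) ?(ltW T0) // le_max lexx.
have [L [h [hh gE h0]]] := region_zeros (T := T) ltac:(lra) d0 dB.
set xm := y3 al + delta / 4 in h0; set sm := Complex xm (T / 2) in h0.
have [x0 [x01 x02 x0L]] := @avoid [seq Re a | a <- L] xm (y3 al + delta / 2) ltac:(rewrite /xm; lra).
pose s0 := Complex x0 (T / 2).
have [rr [r1 r2 rL]] := @avoid [seq cabs (a - s0) | a <- L] T (2 * T) ltac:(lra).
have r0 : 0 < rr by lra.
have sms0 : cabs (s0 - sm) <= B0.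
  have -> : s0 - sm = (x0 - xm)%:C%C by apply/eqP; rewrite eq_complex /= subrr !eqxx.
  rewrite cabs_real ger0_norm; rewrite /xm in x01 *; lra.
(* After scaling by rr < 2 T the neighbourhood of the half disc reaches at most delta / 16 to the
   left of x0, hence stays where h is known to be zero-free. *)
have [et [et0 et4 etT]] : exists et : R, [/\ 0 < et, et <= 4^-1 & 2 * T * et <= delta / 16].
  have q0 : 0 < delta / 16 / (2 * T) by rewrite !divr_gt0 // mulr_gt0.
  exists (Num.min 4^-1 (delta / 16 / (2 * T))); split.
  - by rewrite lt_min q0 andbT invr_gt0.
  - by rewrite ge_min lexx.
  - by rewrite mulrC -ler_pdivlMr ?mulr_gt0 // ge_min lexx orbT.
have inR z : hdisc et z -> xm - delta / 16 <= Re (s0 + rr%:C%C * z) /\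
    cabs (s0 + rr%:C%C * z - sm) <= 4 * T + B0.
  move=> [z1 z2]; rewrite /rhalf in z1; rewrite /cdisc subr0 in z2; split.
    rewrite ReD ReRM /=.
    have := ler_wpM2l (ltW r0) (ltW z1); have := ler_wpM2r (ltW et0) (ltW r2); lra.
  have -> : s0 + rr%:C%C * z - sm = (s0 - sm) + rr%:C%C * z by ring.
  apply: le_trans (cabsD _ _) _; rewrite cabsM cabs_real gtr0_norm //.
  have := ler_wpM2l (ltW r0) (_ : cabs z <= 5 / 4) => /(_ ltac:(lra)); lra.
have S1 : \sum_(a <- L | (x0 < Re a) && (cabs (a - s0) <= 3 / 4 * rr)) (Re a - x0) / rr / 20 <=
    K1 * ln (ln T).
  apply: (H1 T x0 rr et h L) => //; rewrite -/s0.
  - by rewrite /xm in x01; lra.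
  - lra.
  - exact: ltW.
  - exact: ltW.
  - apply: (hol_comp (V := rhalf (y3 al))) => //.
      apply: holD; first exact: hol_cst.
      by apply: holM; [exact: hol_cst|exact: hol_id].
    by move=> z /inR[z1 _]; rewrite /rhalf; rewrite /xm in z1; lra.
  - by move=> z /inR[z1 z2]; exact: h0.
  - move=> a aL; split; [apply: contraNneq x0L => <-|apply: contraNneq rL => <-].
      by apply: map_f.
    by apply: (map_f (fun a => cabs (a - s0))).
pose reg (a : C) := [&& y3 al + delta < Re a, 0 < Im a & Im a < T].
have regB z : reg z -> g z = 0 -> Re z < B0 /\ forall x, 0 <= x -> x <= B0 ->
    cabs (z - Complex x (T / 2)) <= B0 + T / 2.
  move=> /and3P[z1 z2 z3] gz.
  have zB : Re z < B0 by rewrite ltNge; apply/negP => /far_neq0; rewrite gz eqxx.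
  split=> // x x0' xB; apply: le_trans (cabs_le_ReIm _) _; rewrite ReB ImB /=.
  by apply: lerD; rewrite ler_norml; apply/andP; split; lra.
(* L also contains zeros outside the counted region; their factors move into h, which remains
   nonzero at the zeros inside. *)
exists [seq a <- L | reg a], (fun s => h s * \prod_(a <- [seq a <- L | ~~ reg a]) (s - a)); split.
- apply: holM => //; apply: hol_prod => a; apply: holB; [exact: hol_id|exact: hol_cst].
- by move=> s; rewrite gE (bigID reg) /= !big_filter; ring.
- move=> z z1 z2 z3 gz; have rz : reg z by rewrite /reg z1 z2 z3.
  have [zB zx] := regB z rz gz; apply: mulf_neq0.
    apply: h0; first by rewrite /xm; lra.
    by apply: le_trans (zx xm _ _) _; rewrite /xm; lra.
  rewrite prodf_seq_neq0; apply/allP => a; rewrite mem_filter => /andP[ra _] /=.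
  by rewrite subr_eq0; apply: contraNneq ra => <-.
have S2 : (size [seq a <- L | reg a])%:R * (delta / (80 * T)) <= K1 * ln (ln T).
  apply: le_trans S1; rewrite size_filter -sum1_count natr_sum mulr_suml.
  rewrite big_seq_cond [leRHS]big_seq_cond big_mkcond [leRHS]big_mkcond /=; apply: ler_sum => a _.
  have [aL|] //= := boolP (a \in L); have [ra|nra] := boolP (reg a); last first.
    by case: ifP => // /andP[xa _]; rewrite !divr_ge0 ?(ltW r0) // subr_ge0 ltW.
  have ga : g a = 0.
    by rewrite gE; apply/eqP; rewrite mulf_eq0 prodf_seq_eq0; apply/orP; right; apply/hasP; exists a; rewrite //= subrr.
  have [aB ax] := regB a ra ga; have /and3P[a1 _ _] := ra.
  have -> : x0 < Re a by rewrite /xm in x01; lra.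
  (* The distance is at most B0 + T / 2, and B0 <= T / 4 by the choice of the threshold. *)
  have -> : cabs (a - s0) <= 3 / 4 * rr.
    by apply: le_trans (ax x0 _ _) _; rewrite /xm in x01; lra.
  rewrite /= mul1r mulrAC -mulrA -invfM ler_pdivlMr ?mulr_gt0 // mulrAC ler_pdivrMr ?mulr_gt0 //.
  have q0 : 0 <= Re a - x0 - delta / 2 by lra.
  have q1 : 0 <= 2 * T - rr by lra.
  have := mulr_ge0 q0 (ltW T0); have := mulr_ge0 (ltW d0) q1; lra.
have S3 : K1 * ln (ln T) <= Num.max 0 K1 * ln (ln T) by rewrite ler_wpM2r // le_max lexx orbT.
have d80 : 0 < delta / (80 * T) by rewrite divr_gt0 // mulr_gt0.
have := le_trans S2 S3; rewrite -ler_pdivlMr // => /le_trans; apply.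
rewrite le_eqVlt; apply/orP; left; apply/eqP; field.
by rewrite !gt_eqF.
Qed.

End ZeroCount.

Lemma cabs_kapP_ge (R : realType) (al : R) Bs s : 0 < al -> all (>= al) Bs -> 2 / al <= Re s ->
  2^-1 ^+ size Bs <= cabs (kapP Bs s).
Proof.
move=> al0 + sa; have s0 : 0 <= Re s by apply: le_trans sa; rewrite divr_ge0 // ltW.
rewrite /kapP; elim: Bs => [|b Bs IH] /=; first by rewrite big_nil cabs1.
move=> /andP[ab aBs]; rewrite big_cons cabsM exprS.
have h0 : 0 <= 2^-1 :> R by rewrite invr_ge0.
apply: ler_pM => //; last exact: IH.
have bs2 : 2 <= b * Re s.
  apply: (@le_trans _ _ (al * Re s)); last by rewrite ler_wpM2r.
  by move: sa; rewrite ler_pdivrMr // mulrC.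
have n4 : cabs (npowN 2 (b%:C%C * s)) <= 4^-1.
  rewrite cabs_npowN ReRM mulNr.
  have -> : 4^-1 = expR (- (2 * ln 2)) :> R.
    rewrite expRN expRM_natl lnK ?posrE //; congr _^-1; ring.
  by rewrite ler_expR lerN2 ler_wpM2r // ln_ge0 // ler1n.
have := cabs_rtriB 1 (2 * npowN 2 (b%:C%C * s)); rewrite cabs1 cabsM cabs_nat /kap.
lra.
Qed.

(** * The bound for the w-points *)

Section Final.
Variables (R : realType) (r : nat) (a : nat -> R).
Hypothesis hr : (2 <= r)%N.
Hypothesis ha : forall i j : nat, (1 <= i)%N -> (i <= j)%N -> (j <= r)%N -> a j <= a i.
Hypothesis har : 0 < a r.
Variable F : 'rV[complex R]_r -> complex R.
Hypothesis hF : is_mzeta F.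
Variable w : complex R.
Local Notation C := (complex R).
Local Notation al := (a r).
Local Notation f := (sym_mzeta a F).

(** The normalising exponent depends on w: f decays like exp (- l0 s), so for w = 0 it must be l0,
    while for w != 0 the constant - w dominates and it is 0. *)
Lemma lead_shift : exists lam c A B, [/\ 0 <= lam, 0 < c, 0 <= A, 2 / al <= B & forall s, B <= Re s ->
  c <= cabs (f s - w) * expR (lam * Re s) <= A].
Proof.
have [l0 [C1 [B0 [l00 C10 B0al H]]]] := lead hr ha har hF.
have [->|w0] := eqVneq w 0.
  exists l0, 2^-1, C1, B0; split=> //; [exact: ltW|].
  by move=> s /H; rewrite subr0.
have cw : 0 < cabs w by rewrite cabs_gt0.
exists 0, (cabs w / 2), (2 * cabs w), (B0 + 2 * C1 / (cabs w * l0)).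
have q0 : 0 <= 2 * C1 / (cabs w * l0) by rewrite divr_ge0 ?mulr_ge0 ?(ltW l00) ?(ltW cw).
have B00 : 0 < B0 by apply: lt_le_trans B0al; rewrite divr_gt0.
split=> //; [lra|lra|lra|] => s Bs; rewrite mul0r expR0 mulr1.
have /andP[_ h1] := H s ltac:(lra).
have h2 : 2 * C1 / cabs w <= expR (l0 * Re s).
  apply: le_trans (_ : l0 * Re s <= _); last by have := expR_ge1Dx (l0 * Re s); lra.
  have -> : 2 * C1 / cabs w = l0 * (2 * C1 / (cabs w * l0)) by field; rewrite !gt_eqF.
  rewrite ler_wpM2l ?(ltW l00) //; lra.
have h3 : cabs (f s) <= cabs w / 2.
  rewrite -(ler_pM2r (expR_gt0 (l0 * Re s))); apply: le_trans h1 _.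
  by move: h2; rewrite ler_pdivrMr // => h2; lra.
have := cabs_rtriB w (f s); rewrite [cabs (w - _)]cabsB; have := cabs_triB (f s) w.
by move=> h4 h5; apply/andP; split; lra.
Qed.

Lemma points_bound : exists K T0, forall T delta, T0 <= T -> 0 < delta ->
  (count_points f w (y3 al + delta)%R T <= (K * (T * ln (ln T) / delta))%:E)%E.
Proof.
have [Bs [A [psi [bsal A0 hpsi psile [psi1 psi2]]]]] := continuation ha har hF.
have [lam [c [A2 [B0 [lam0 c0 A20 B0al H]]]]] := lead_shift.
(* In the upper quadrant this is kapP * (f - w) * exp (lam s), but written with psi it is
   holomorphic on the whole half plane. *)
pose g s := (psi s - w * kapP Bs s) * cexp (lam%:C%C * s).
have y30 := y3_gt0 har.
have yB : y3 al < B0.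
  apply: lt_le_trans B0al; rewrite /y3 ltr_pdivrMr ?mulr_gt0 //.
  by rewrite mulrCA divfK ?gt_eqF //; lra.
pose n := size Bs.
have n3 : 1 <= 3 ^+ n :> R by rewrite exprn_ege1 // ler1n.
(* One constant for both ranges: the middle term bounds g for Re s >= B0, the last one times [etaP]
   for Re s < B0, and the 1 ensures A' >= 1. *)
pose A' := 1 + 3 ^+ n * A2 + (A + cabs w * 3 ^+ n) * expR (lam * B0).
have t1 : 0 <= 3 ^+ n * A2 by rewrite mulr_ge0 //; lra.
have t2 : 0 <= A + cabs w * 3 ^+ n by rewrite addr_ge0 // mulr_ge0 ?cabs_ge0 //; lra.
have t3 := mulr_ge0 t2 (expR_ge0 (lam * B0)).
have A'1 : 1 <= A' by rewrite /A'; lra.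
have c'0 : 0 < 2^-1 ^+ n * c by rewrite mulr_gt0 // exprn_gt0 // invr_gt0.
have gE s : kapP Bs s * f s = psi s -> g s = kapP Bs s * cexp (lam%:C%C * s) * (f s - w).
  by move=> E; rewrite /g -E; ring.
have gfar s : B0 <= Re s -> 2^-1 ^+ n * c <= cabs (g s) <= 3 ^+ n * A2.
  move=> sB; have sal : 2 / al <= Re s by exact: le_trans sB.
  rewrite (gE s (psi2 s sal)) !cabsM cabs_cexp ReRM -mulrA [expR _ * _]mulrC.
  have /andP[h1 h2] := H s sB.
  have h3 := cabs_kapP_ge har bsal sal; have h4 := cabs_kapP_le har bsal (_ : 0 <= Re s).
  apply/andP; split; apply: ler_pM; rewrite ?mulr_ge0 ?cabs_ge0 ?expR_ge0 ?exprn_ge0 ?(ltW c0) ?invr_ge0 //.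
  by apply: h4; lra.
have gfar' s : B0 <= Re s -> 2^-1 ^+ n * c <= cabs (g s) <= A'.
  by move=> /gfar/andP[-> h]; rewrite /A' /=; lra.
have gle s : y3 al < Re s -> cabs (g s) <= A' * etaP Bs s.
  move=> ys; have e1 := etaP_ge1 Bs s.
  have [sB|sB] := leP B0 (Re s).
    have /andP[_ h] := gfar' s sB; apply: le_trans h _; rewrite ler_peMr //; lra.
  rewrite /g cabsM cabs_cexp ReRM.
  have h1 : cabs (psi s - w * kapP Bs s) <= (A + cabs w * 3 ^+ n) * etaP Bs s.
    apply: le_trans (cabs_triB _ _) _; rewrite mulrDl; apply: lerD; first exact: psile.
    rewrite cabsM; apply: (@le_trans _ _ (cabs w * 3 ^+ n)).
      by rewrite ler_wpM2l ?cabs_ge0 //; apply: (cabs_kapP_le har bsal); lra.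
    by rewrite ler_peMr // mulr_ge0 ?cabs_ge0 //; lra.
  have h2 : expR (lam * Re s) <= expR (lam * B0) by rewrite ler_expR ler_wpM2l // ltW.
  apply: le_trans (ler_pM (cabs_ge0 _) (expR_ge0 _) h1 h2) _.
  rewrite mulrAC ler_wpM2r //; rewrite /A'; lra.
have ghol : hol (rhalf (y3 al)) g.
  apply: holM; first by apply: holB => //; apply: holM; [exact: hol_cst|exact: hol_kapP].
  by apply: hol_cexp; apply: holM; [exact: hol_cst|exact: hol_id].
have [K [T0 HK]] := region_count har bsal A'1 c'0 yB gle gfar' ghol.
exists K, T0 => T delta TT d0; have [L [h [hh gL reg sL]]] := HK T delta TT d0.
apply: (@le_trans _ _ (size L)%:R%:E); last by rewrite lee_fin.
(* Multiplicities of f - w are compared on the upper quadrant, where f is holomorphic; the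
   factorisation of g lives on the half plane. *)
pose U s := rhalf (y3 al) s /\ uhalf 0 s.
apply: (@count_points_le R f w (y3 al + delta) T U (rhalf (y3 al)) (fun s => kapP Bs s * cexp (lam%:C%C * s)) g h).
- by apply: copenI; [exact: copen_rhalf|exact: copen_uhalf].
- exact: copen_rhalf.
- apply: (@hol_sub _ _ (uhalf 0)); [by move=> z []|exact: (f_hol ha har hF)].
- apply: holM; first exact: hol_kapP.
  by apply: hol_cexp; apply: holM; [exact: hol_cst|exact: hol_id].
- exact: hh.
- by move=> s [].
- by move=> s [s1 s2]; rewrite gE // psi1.
- by move=> s _; exact: gL.
- by move=> z z1 z2 _; split=> //; rewrite /rhalf; lra.
- exact: reg.
Qed.

End Final.

Theorem theorem1p6 (R : realType) (r : nat) (hr : (2 <= r)%N) (a : nat -> R)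
    (ha : forall i j : nat, (1 <= i)%N -> (i <= j)%N -> (j <= r)%N -> a j <= a i)
    (har : 0 < a r)
    (zetaEZ : 'rV[complex R]_r -> complex R) (hzeta : is_mzeta zetaEZ)
    (w : complex R) :
  let y3 : R := 1 / (2 * a r) in
  let N (b T : R) : \bar R := count_points (sym_mzeta a zetaEZ) w b T in
  (exists C T0 : R, forall T delta : R, T0 <= T -> 0 < delta ->
     ((2 * pi)%:E * N (y3 + delta)%R T <= (C * (T * ln (ln T) / delta))%:E)%E) /\
  (exists C T0 : R, forall T : R, T0 <= T ->
     ((2 * pi)%:E * N (y3 + (ln (ln T)) ^+ 2 / ln T)%R T
        <= (C * (T * ln T / ln (ln T)))%:E)%E).
Proof.
move=> y3 N; have [K [T0 H]] := points_bound hr ha har hzeta w.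
have H1 T delta : T0 <= T -> 0 < delta ->
    ((2 * pi)%:E * N (y3 + delta)%R T <= (2 * pi * K * (T * ln (ln T) / delta))%:E)%E.
  move=> TT d0; rewrite -mulrA EFinM; apply: lee_wpmul2l (H T delta TT d0).
  by rewrite lee_fin mulr_ge0 // pi_ge0.
split; first by exists (2 * pi * K), T0.
exists (2 * pi * K), (Num.max T0 (expR (expR 1))) => T; rewrite ge_max => /andP[TT Te].
have T1 : 0 < T by exact: lt_le_trans (expR_gt0 _) Te.
have lT : expR 1 <= ln T by rewrite -[leLHS]expRK ler_ln ?posrE ?expR_gt0.
have lT0 : 0 < ln T by exact: lt_le_trans (expR_gt0 _) lT.
have llT : 1 <= ln (ln T) by rewrite -[leLHS]expRK ler_ln ?posrE ?expR_gt0.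
have ll0 : 0 < ln (ln T) by exact: lt_le_trans llT.
apply: le_trans (H1 T _ TT _) _; first by rewrite divr_gt0 // exprn_gt0.
rewrite lee_fin le_eqVlt; apply/orP; left; apply/eqP; congr (_ * _).
by move: (ln (ln T)) (ln T) ll0 lT0 => x y x0 y0; field; rewrite !gt_eqF.
Qed.
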